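(* Let $p\in(0,1)$, fix $u\in(0,1)$, let $$(m_u(N),n_u(N))=\Big(N,\Big\lfloor \tfrac{N}{p}\big(p+(1-p)u\big)^2\Big\rfloor\Big),$$ and let $\hat\pi=\hat\pi_{0,(m_u(N),n_u(N))}$ be the right-most maximal path from the origin to $(m_u(N),n_u(N))$ in the environment $\omega^{(u)}$. (a) Fix $0\le\tau<1$. There exist constants $C_1,C_2<\infty$ such that for all $N\ge1$ and $b\ge C_1$, $$\mathbb{P}\big\{v_0(\lfloor\tau n_u(N)\rfloor)<\tau m_u(N)-bN^{2/3}\ \text{ or }\ v_1(\lfloor\tau n_u(N)\rfloor)>\tau m_u(N)+bN^{2/3}\big\}\le C_2b^{-3}.$$ The same bound holds for vertical displacements, that is, $$\mathbb{P}\big\{w_0(\lfloor\tau m_u(N)\rfloor)<\tau n_u(N)-bN^{2/3}\ \text{ or }\ w_1(\lfloor\tau m_u(N)\rfloor)>\tau n_u(N)+bN^{2/3}\big\}\le C_2b^{-3}.$$ (b) Fix $\tau\in(0,1)$. For every $\varepsilon>0$ there exists $\delta>0$ such that $$\limsup_{N\to\infty}\mathbb{P}\big\{\exists k \text{ such that } |\hat\pi_k-(\tau m_u(N),\tau n_u(N))|\le\delta N^{2/3}\big\}\le\varepsilon.$$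
   Context: Notation: $\mathbb{Z}_+=\{0,1,2,\dots\}$, $e_1=(1,0)$, $e_2=(0,1)$; $|\cdot|$ is the $\ell^1$ norm on $\mathbb{R}^2$. Boundary environment $\omega^{(u)}=\{\omega^{(u)}_{i,j}\}_{(i,j)\in\mathbb{Z}_+^2}$: the weights are independent under $\mathbb{P}$, with $\omega^{(u)}_{i,j}\sim\mathrm{Ber}(p)$ for $i,j\ge1$, $\omega^{(u)}_{i,0}\sim\mathrm{Ber}(u)$ for $i\ge1$, $\omega^{(u)}_{0,j}\sim\mathrm{Ber}\big(\frac{p(1-u)}{u+p(1-u)}\big)$ for $j\ge 1$, and $\omega^{(u)}_{0,0}=0$. An admissible path from $(0,0)$ to $(m,n)\in\mathbb{Z}_+^2$ is a finite sequence of sites starting at $(0,0)$, ending at $(m,n)$, with all steps in $\{e_1,e_2,e_1+e_2\}$. It collects weight as follows: a step along the horizontal axis from $(k-1,0)$ to $(k,0)$ collects $\omega^{(u)}_{k,0}$; a step along the vertical axis from $(0,k-1)$ to $(0,k)$ collects $\omega^{(u)}_{0,k}$; a diagonal step $e_1+e_2$ into a site $v$ collects $\omega^{(u)}_v$; every other step collects $0$. The last passage time $G^{(u)}_{m,n}=G^{(u)}_{0,(m,n)}$ is the maximum, over all admissible paths from $(0,0)$ to $(m,n)$, of the total collected weight. A path attaining the maximum is called maximal. The right-most (equivalently down-most) maximal path $\hat\pi_{0,(m,n)}$ is the maximal path such that no site strictly underneath it belongs to another maximal path. It is constructed backwards from $(m,n)$: at a site $v=(i,j)$ with $i,j\ge1$,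 step to $v-e_2$ if $G^{(u)}_{0,v-e_2}=G^{(u)}_{0,v}$; otherwise step to $v-e_1-e_2$ if $\omega^{(u)}_v=1$; otherwise step to $v-e_1$. Once the path reaches one of the axes it follows that axis to the origin. Writing $\hat\pi=(\hat\pi_0,\hat\pi_1,\dots)$ and $(m,n)=(m_u(N),n_u(N))$, define for $0\le j\le n$ $$v_0(j)=\min\{i\in\{0,\dots,m\}:\exists k,\ \hat\pi_k=(i,j)\},\qquad v_1(j)=\max\{i\in\{0,\dots,m\}:\exists k,\ \hat\pi_k=(i,j)\},$$ and for $0\le i\le m$ $$w_0(i)=\min\{j\in\{0,\dots,n\}:\exists k,\ \hat\pi_k=(i,j)\},\qquad w_1(i)=\max\{j\in\{0,\dots,n\}:\exists k,\ \hat\pi_k=(i,j)\}.$$ *)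

(* Defs.v *)
From HB Require Import structures.
From mathcomp Require Import all_boot all_order all_algebra.
From mathcomp Require Import zify.
From mathcomp Require Import all_classical all_reals all_analysis.

Set Implicit Arguments.
Unset Strict Implicit.
Unset Printing Implicit Defensive.
Import Order.TTheory GRing.Theory Num.Theory.
Import numFieldNormedType.Exports.

Local Open Scope classical_set_scope.

Notation site := (nat * nat)%type.

Definition origin : site := (0, 0)%N.

Definition admissible_step : rel site := fun a b =>
  b \in [:: (a.1.+1, a.2); (a.1, a.2.+1); (a.1.+1, a.2.+1)].

Definition admissible (v : site) (pi : seq site) : bool :=
  if pi is x :: s then
    [&& x == origin, path admissible_step x s & last x s == v]
  else false.

(* The three disjuncts are: a step along the horizontal axis, a step along the
   vertical axis, a diagonal step. *)
Definition step_weight (om : nat -> nat -> bool) (a b : site) : nat :=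
  if [|| (a.2 == 0%N) && (b.2 == 0%N), (a.1 == 0%N) && (b.1 == 0%N)
       | b == (a.1.+1, a.2.+1)]
  then nat_of_bool (om b.1 b.2) else 0%N.

Definition path_weight (om : nat -> nat -> bool) (pi : seq site) : nat :=
  if pi is x :: s then sumn (pairmap (step_weight om) x s) else 0%N.

(* Each step collects at most 1 and there are at most v.1 + v.2 steps, so the
   range of w is no restriction: see lpt_ge and lpt_attained. *)
Definition lpt (om : nat -> nat -> bool) (v : site) : nat :=
  (\max_(w < (v.1 + v.2).+1 |
    `[< exists2 pi, admissible v pi & path_weight om pi = w >]) w)%N.

Definition maximal (om : nat -> nat -> bool) (v : site) (pi : seq site) : Prop :=
  admissible v pi /\ path_weight om pi = lpt om v.

Definition back_step (om : nat -> nat -> bool) (v : site) : site :=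
  match v with
  | (i.+1, j.+1) =>
      if lpt om (i.+1, j) == lpt om (i.+1, j.+1) then (i.+1, j)
      else if om i.+1 j.+1 then (i, j) else (i, j.+1)
  | (i, 0%N) => (i.-1, 0%N)
  | (0%N, j) => (0%N, j.-1)
  end.

Fixpoint back_path (om : nat -> nat -> bool) (k : nat) (v : site) : seq site :=
  if k is k'.+1 then
    if v == origin then [:: v] else rcons (back_path om k' (back_step om v)) v
  else [:: v].

(* v.1 + v.2 backward steps always suffice to reach the origin. *)
Definition rightmost_path (om : nat -> nat -> bool) (v : site) : seq site :=
  back_path om (v.1 + v.2) v.

Section LastPassageFacts.
Variable om : nat -> nat -> bool.

Lemma admissible_rcons v s :
  admissible v s -> v = origin /\ s = [:: origin] \/
  exists u t, [/\ s = rcons t v, admissible u t, admissible_step u v &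
    path_weight om s = path_weight om t + step_weight om u v]%N.
Proof.
case: s => // x s /and3P[/eqP-> ps /eqP <-].
case/lastP: s ps => [_|s z]; first by left.
rewrite rcons_path last_rcons => /andP[ps sz]; right.
exists (last origin s), (origin :: s); split => //=.
- by rewrite ps eqxx.
- by rewrite -cats1 pairmap_cat sumn_cat /= addn0.
Qed.

Lemma admissible_ext u v t : admissible u t -> admissible_step u v ->
  admissible v (rcons t v) /\
  (path_weight om (rcons t v) = path_weight om t + step_weight om u v)%N.
Proof.
case: t => // x s /and3P[/eqP-> ps /eqP <-] st /=.
split; first by rewrite rcons_path ps st last_rcons eqxx.
by rewrite -cats1 pairmap_cat sumn_cat /= addn0.
Qed.

Lemma step_weight_le1 a b : (step_weight om a b <= 1)%N.
Proof. by rewrite /step_weight; case: ifP => // _; case: om. Qed.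

Lemma path_weight_le v s :
  admissible v s -> (path_weight om s <= v.1 + v.2)%N.
Proof.
elim: {s}(size s) {-2}s (erefl (size s)) v => [[]//|n IH s sn v as_].
case: (admissible_rcons as_) => [[-> ->] //|[u [t [E au uv ->]]]].
have {}IH : (path_weight om t <= u.1 + u.2)%N.
  by apply: IH au; move: sn; rewrite E size_rcons => -[].
have := step_weight_le1 u v.
have : (u.1 + u.2 < v.1 + v.2)%N.
  by move: uv; rewrite /admissible_step !inE => /or3P[]/eqP-> /=; lia.
lia.
Qed.

Lemma lpt_ge v s : admissible v s -> (path_weight om s <= lpt om v)%N.
Proof.
move=> av; have lt := path_weight_le av; rewrite -ltnS in lt.
rewrite /lpt; apply: (bigop.bigmax_sup (Ordinal lt)) => //.
by apply/asboolP; exists s.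
Qed.

Lemma admissible_exists v : exists s, admissible v s.
Proof.
case: v => i j; elim: j => [|j [s sj]].
  elim: i => [|i [s si]]; first by exists [:: origin].
  exists (rcons s (i.+1, 0)%N); apply: (admissible_ext si _).1.
  by rewrite /admissible_step !inE eqxx.
exists (rcons s (i, j.+1)%N); apply: (admissible_ext sj _).1.
by rewrite /admissible_step !inE eqxx orbT.
Qed.

Lemma lpt_attained v : exists s, maximal om v s.
Proof.
rewrite /maximal /lpt; have [s0 as0] := admissible_exists v.
have lt := path_weight_le as0; rewrite -ltnS in lt.
have P0 : `[< exists2 pi, admissible v pi & path_weight om pi = Ordinal lt >].
  by apply/asboolP; exists s0.
rewrite (bigop.bigmax_eq_arg (Ordinal lt)) //.
by case: arg_maxnP => //= w /asboolP[s as_ sw] _; exists s.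
Qed.

Lemma lpt_step a b : admissible_step a b ->
  (lpt om a + step_weight om a b <= lpt om b)%N.
Proof.
move=> ab; have [s [aa <-]] := lpt_attained a.
by have [ab' <-] := admissible_ext aa ab; exact: lpt_ge.
Qed.

Lemma maximal_rcons v s : maximal om v s -> v = origin /\ s = [:: origin] \/
  exists u t, [/\ s = rcons t v, maximal om u t, admissible_step u v &
    lpt om v = lpt om u + step_weight om u v]%N.
Proof.
move=> [as_ ws]; case: (admissible_rcons as_) => [|[u [t [E au uv W]]]].
  by left.
right; exists u, t.
have ge1 := lpt_ge au; have ge2 := lpt_step uv.
have e : path_weight om t = lpt om u by lia.
by split => //; lia.
Qed.

Lemma lpt_pred (v : site) : v != origin ->
  exists2 u, admissible_step u v & lpt om v = (lpt om u + step_weight om u v)%N.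
Proof.
move=> v0; have [s ms] := lpt_attained v.
by case: (maximal_rcons ms) v0 => [[-> _]//|[u [t [_ _ uv E]]] _]; exists u.
Qed.

Lemma lpt_up i j : (lpt om (i, j.+1) <= (lpt om (i, j)).+1)%N.
Proof.
elim: i => [|i IH].
  have [//|[i' j']] := @lpt_pred (0, j.+1)%N; rewrite /admissible_step !inE.
  move=> /or3P[]/eqP[] // <- <- ->.
  by have := step_weight_le1 (0, j)%N (0, j.+1)%N; lia.
have [//|[i' j']] := @lpt_pred (i.+1, j.+1)%N; rewrite /admissible_step !inE.
have s1 : (lpt om (i, j) <= lpt om (i.+1, j))%N.
  have st : admissible_step (i, j) (i.+1, j).
    by rewrite /admissible_step !inE eqxx.
  by have := lpt_step st; lia.
move=> /or3P[]/eqP[] <- <- ->.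
- have -> : step_weight om (i, j.+1) (i.+1, j.+1) = 0%N.
    by rewrite /step_weight; case: ifP => //; rewrite xpair_eqE /=; lia.
  by lia.
- by have := step_weight_le1 (i.+1, j) (i.+1, j.+1); lia.
- by have := step_weight_le1 (i, j) (i.+1, j.+1); lia.
Qed.

Lemma back_stepP (v : site) : v != origin ->
  admissible_step (back_step om v) v /\
  lpt om v = (lpt om (back_step om v) + step_weight om (back_step om v) v)%N.
Proof.
case: v => [[|i] [|j]] // v0.
- have [[i' j']] := lpt_pred v0; rewrite /admissible_step !inE.
  by move=> /or3P[]/eqP[] // <- <- ->; rewrite !eqxx ?orbT.
- have [[i' j']] := lpt_pred v0; rewrite /admissible_step !inE.
  by move=> /or3P[]/eqP[] // <- <- ->; rewrite !eqxx ?orbT.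
have sd : admissible_step (i, j) (i.+1, j.+1).
  by rewrite /admissible_step !inE eqxx !orbT.
have sl : admissible_step (i, j.+1) (i.+1, j.+1).
  by rewrite /admissible_step !inE eqxx.
have sb : admissible_step (i, j) (i.+1, j).
  by rewrite /admissible_step !inE eqxx.
have su : admissible_step (i.+1, j) (i.+1, j.+1).
  by rewrite /admissible_step !inE eqxx !orbT.
have wd : step_weight om (i, j) (i.+1, j.+1) = om i.+1 j.+1.
  by rewrite /step_weight /= !eqxx !orbT.
have wl : step_weight om (i, j.+1) (i.+1, j.+1) = 0%N.
  by rewrite /step_weight; case: ifP => //; rewrite xpair_eqE /=; lia.
have wu : step_weight om (i.+1, j) (i.+1, j.+1) = 0%N.
  by rewrite /step_weight; case: ifP => //; rewrite xpair_eqE /=; lia.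
rewrite /back_step; case: eqP => [e|ne]; first by rewrite wu addn0 e.
have ld := lpt_step sd; have ll := lpt_step sl.
have lb := lpt_step sb; have lu := lpt_step su.
have up := lpt_up i j.
rewrite wd in ld; rewrite wl addn0 in ll; rewrite wu addn0 in lu.
have {}ne : lpt om (i.+1, j) != lpt om (i.+1, j.+1) by apply/eqP.
have [[i' j'] a] := lpt_pred v0; rewrite /admissible_step !inE in a.
move: ld ll lb lu up ne wd wl wu.
case: (om _ _); rewrite /= => ld ll lb lu up ne wd wl wu E; split => //.
- move: E; rewrite wd; case/or3P: a => /eqP[<- <-]; rewrite ?wd ?wl ?wu; lia.
- move: E; rewrite wl; case/or3P: a => /eqP[<- <-]; rewrite ?wd ?wl ?wu; lia.
Qed.

Lemma back_step_lt (v : site) : v != origin ->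
  ((back_step om v).1 + (back_step om v).2 < v.1 + v.2)%N.
Proof.
case/back_stepP => + _; case: (back_step om v) => i j; case: v => i' j'.
by rewrite /admissible_step !inE => /or3P[]/eqP[-> ->] /=; lia.
Qed.

Lemma back_path_fuel k v : (v.1 + v.2 <= k)%N ->
  back_path om k v = rightmost_path om v.
Proof.
rewrite /rightmost_path.
have [K vK] := ubnP (v.1 + v.2); elim: K v vK k => // K IH v vK k vk.
have [->|v0] := eqVneq v origin; first by case: k {vk}.
have lt := back_step_lt v0.
case V : (v.1 + v.2)%N => [|l]; first by lia.
case: k vk => [|k] vk; first by lia.
by rewrite /= (negbTE v0) !(IH (back_step om v)) //; lia.
Qed.

Lemma rightmost_pathE (v : site) : v != origin ->
  rightmost_path om v = rcons (rightmost_path om (back_step om v)) v.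
Proof.
move=> v0; have lt := back_step_lt v0.
rewrite {1}/rightmost_path; case V : (v.1 + v.2)%N => [|l]; first by lia.
by rewrite /= (negbTE v0) back_path_fuel //; lia.
Qed.

Lemma rightmost_path_maximal v : maximal om v (rightmost_path om v).
Proof.
have [K vK] := ubnP (v.1 + v.2); elim: K v vK => // K IH v vK.
have [->|v0] := eqVneq v origin.
  have [s ms] := lpt_attained origin.
  case: (maximal_rcons ms) => [[_ E]|[[i j] [t [_ _ + _]]]].
    by move: ms; rewrite E.
  by rewrite /admissible_step !inE => /or3P[]/eqP[].
have lt := back_step_lt v0.
have [ab wb] : maximal om (back_step om v) (rightmost_path om (back_step om v)).
  by apply: IH; lia.
have [st lE] := back_stepP v0.
have [av wv] := admissible_ext ab st.
by rewrite rightmost_pathE //; split => //; rewrite wv wb lE.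
Qed.

Lemma mem_rightmost_path v : v \in rightmost_path om v.
Proof.
have [->|v0] := eqVneq v origin; first by rewrite inE.
by rewrite rightmost_pathE // mem_rcons inE eqxx.
Qed.

Lemma sub_rightmost_path (v : site) : v != origin ->
  {subset rightmost_path om (back_step om v) <= rightmost_path om v}.
Proof.
by move=> v0 z zb; rewrite (rightmost_pathE v0) mem_rcons inE zb orbT.
Qed.

Lemma rightmost_path_below_aux v c s :
  maximal om v s -> c.1 = v.1 -> (c.2 <= v.2)%N ->
  forall z, z \in s ->
    exists2 j, (z.1, j) \in rightmost_path om c & (j <= z.2)%N.
Proof.
have [k vk] := ubnP (v.1 + v.2 + c.2).
elim: k v c vk s => // k IH v [c1 c2] vk s ms /= c1E c2v z zs.
have below : z = v -> exists2 j, (z.1, j) \in rightmost_path om (c1, c2) & (j <= z.2)%N.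
  by move=> ->; exists c2 => //; rewrite -c1E mem_rightmost_path.
case: (maximal_rcons ms) => [[v0 E]|[u [t [E mt uv lE]]]].
  by apply: below; move: zs; rewrite E v0 inE => /eqP.
move: (zs); rewrite E mem_rcons inE => /orP[/eqP//|zt].
have via c : c \in [:: (c1, c2); back_step om (c1, c2)] -> (c1, c2) != origin ->
    (u.1 + u.2 + c.2 < k)%N -> c.1 = u.1 -> (c.2 <= u.2)%N ->
    exists2 j, (z.1, j) \in rightmost_path om (c1, c2) & (j <= z.2)%N.
  move=> cc n0 lt e1 e2; have [j jc jz] := IH u c lt t mt e1 e2 z zt.
  exists j => //; move: cc jc; rewrite !inE => /orP[]/eqP-> //.
  exact: sub_rightmost_path.
have again c : c = back_step om (c1, c2) -> (c1, c2) != origin ->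
    (v.1 + v.2 + c.2 < k)%N -> c.1 = v.1 -> (c.2 <= v.2)%N ->
    exists2 j, (z.1, j) \in rightmost_path om (c1, c2) & (j <= z.2)%N.
  move=> cc n0 lt e1 e2; have [j jc jz] := IH v c lt s ms e1 e2 z zs.
  by exists j => //; move: jc; rewrite cc; exact: sub_rightmost_path.
clear below; case: u via mt uv lE => i j via mt uv lE.
case: v uv lE vk c1E c2v ms again E => v1 v2 uv lE vk c1E c2v ms again E.
move: uv; rewrite /admissible_step !inE => /or3P[]/eqP[] v1E v2E; subst v1 v2;
  rewrite /= in c1E c2v via again vk; subst c1.
- case: c2 via again vk c2v => [|l] via again vk c2v.
    by apply: (via (i, 0%N)); rewrite ?inE ?eqxx ?orbT //= ; lia.
  have n0 : (i.+1, l.+1)%N != origin by [].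
  move: (via) (again); rewrite /back_step; case: eqP => _.
    by move=> _ /(_ (i.+1, l)); apply => //=; lia.
  case: (om _ _) => + _.
    by move=> /(_ (i, l)); apply; rewrite ?inE ?eqxx ?orbT //=; lia.
  by move=> /(_ (i, l.+1)); apply; rewrite ?inE ?eqxx ?orbT //=; lia.
- have [cj|cj] := leqP c2 j.
    have [e0|n0] := eqVneq (i, c2) origin.
      have [j' jc jz] := IH (i, j) (i, c2) ltac:(rewrite /=; lia) t mt erefl cj z zt.
      by exists j'.
    by apply: (via (i, c2)); rewrite ?inE ?eqxx //=; lia.
  have c2E : c2 = j.+1 by lia.
  subst c2; have n0 : (i, j.+1)%N != origin by rewrite xpair_eqE andbF.
  have bE : back_step om (i, j.+1) = (i, j).
    case: i {via again mt vk E n0 ms} lE => //= i lE.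
    rewrite lE; have -> : step_weight om (i.+1, j) (i.+1, j.+1) = 0%N.
      by rewrite /step_weight; case: ifP => //; rewrite xpair_eqE /=; lia.
    by rewrite addn0 eqxx.
  apply: (via (i, j)) => //=; last by lia.
  by rewrite !inE; apply/orP; right; apply/eqP; exact: esym bE.
- case: c2 via again vk c2v => [|l] via again vk c2v.
    by apply: (via (i, 0%N)); rewrite ?inE ?eqxx ?orbT //= ; lia.
  have n0 : (i.+1, l.+1)%N != origin by [].
  move: (via) (again); rewrite /back_step; case: eqP => ne.
    by move=> _ /(_ (i.+1, l)); apply => //=; lia.
  case O : (om _ _) => + _.
    by move=> /(_ (i, l)); apply; rewrite ?inE ?eqxx ?orbT //=; lia.
  have [lj|lj] := ltnP l j.
    by move=> /(_ (i, l.+1)); apply; rewrite ?inE ?eqxx ?orbT //=; lia.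
  have lE' : l = j by lia.
  subst l; case: ne; apply/eqP; rewrite eqn_leq; apply/andP; split.
    have st : admissible_step (i.+1, j) (i.+1, j.+1).
      by rewrite /admissible_step !inE eqxx orbT.
    by have := lpt_step st; lia.
  have st : admissible_step (i, j) (i.+1, j).
    by rewrite /admissible_step !inE eqxx.
  rewrite lE; have -> : step_weight om (i, j) (i.+1, j.+1) = 0%N.
    by rewrite /step_weight O /= if_same.
  by have := lpt_step st; lia.
Qed.

(* No site of a maximal path lies strictly underneath rightmost_path. *)
Lemma rightmost_path_below v s z : maximal om v s -> z \in s ->
  exists2 j, (z.1, j) \in rightmost_path om v & (j <= z.2)%N.
Proof. by move=> ms; exact: (rightmost_path_below_aux ms). Qed.

End LastPassageFacts.

(* v0, v1, w0, w1 for the path to (m, n). Such a path meets every row j <= n and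
   every column i <= m of the rectangle, so the ranges below are nonempty and
   the default values m, 0, n, 0 play no role. *)
Definition row_first (om : nat -> nat -> bool) (m n j : nat) : nat :=
  (\big[minn/m]_(i < m.+1 | (i : nat, j) \in rightmost_path om (m, n)) i)%N.

Definition row_last (om : nat -> nat -> bool) (m n j : nat) : nat :=
  (\max_(i < m.+1 | (i : nat, j) \in rightmost_path om (m, n)) i)%N.

Definition col_first (om : nat -> nat -> bool) (m n i : nat) : nat :=
  (\big[minn/n]_(j < n.+1 | (i, j : nat) \in rightmost_path om (m, n)) j)%N.

Definition col_last (om : nat -> nat -> bool) (m n i : nat) : nat :=
  (\max_(j < n.+1 | (i, j : nat) \in rightmost_path om (m, n)) j)%N.

Local Open Scope ring_scope.

(* The product rule over every finite subfamily J. *)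
Definition mutually_independent (d d' : measure_display) (T : measurableType d)
    (T' : measurableType d') (R : realType) (P : probability T R)
    (I : eqType) (X : I -> {RV P >-> T'}) : Prop :=
  forall (J : seq I) (A : I -> set T'),
    uniq J -> (forall i, measurable (A i)) ->
    P (\big[setI/setT]_(i <- J) (X i @^-1` A i)) =
    (\prod_(i <- J) P (X i @^-1` A i))%E.

Record boundary_environment (d : measure_display) (T : measurableType d)
    (R : realType) (P : probability T R) (p u : R)
    (omega : nat -> nat -> {RV P >-> bool}) : Prop := BoundaryEnvironment {
  env_independent : mutually_independent (fun v : site => omega v.1 v.2);
  env_bulk : forall i j : nat, (0 < i)%N -> (0 < j)%N ->
    distribution P (omega i j) =1 bernoulli_prob p;
  env_horizontal : forall i : nat, (0 < i)%N ->
    distribution P (omega i 0%N) =1 bernoulli_prob u;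
  env_vertical : forall j : nat, (0 < j)%N ->
    distribution P (omega 0%N j) =1
      bernoulli_prob (p * (1 - u) / (u + p * (1 - u)));
  env_origin : forall x : T, omega 0%N 0%N x = false
}.

Definition m_u (N : nat) : nat := N.

(* Num.truncn is the floor, as a natural number, of a nonnegative real. *)
Definition n_u (R : realType) (p u : R) (N : nat) : nat :=
  Num.truncn (N%:R / p * (p + (1 - p) * u) ^+ 2).

Definition pow23 (R : realType) (N : nat) : R := N%:R `^ (2 / 3).

Definition horizontal_deviation (d : measure_display) (T : measurableType d)
    (R : realType) (P : probability T R) (p u : R)
    (omega : nat -> nat -> {RV P >-> bool}) (tau b : R) (N : nat) : set T :=
  [set x | let m := m_u N in let n := n_u p u N in
    let om := fun i j => omega i j x in
    let j := Num.truncn (tau * n%:R) in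
    (row_first om m n j)%:R < tau * m%:R - b * pow23 R N \/
    (row_last om m n j)%:R > tau * m%:R + b * pow23 R N].

Definition vertical_deviation (d : measure_display) (T : measurableType d)
    (R : realType) (P : probability T R) (p u : R)
    (omega : nat -> nat -> {RV P >-> bool}) (tau b : R) (N : nat) : set T :=
  [set x | let m := m_u N in let n := n_u p u N in
    let om := fun i j => omega i j x in
    let i := Num.truncn (tau * m%:R) in
    (col_first om m n i)%:R < tau * n%:R - b * pow23 R N \/
    (col_last om m n i)%:R > tau * n%:R + b * pow23 R N].

Definition close_passage (d : measure_display) (T : measurableType d)
    (R : realType) (P : probability T R) (p u : R)
    (omega : nat -> nat -> {RV P >-> bool}) (tau delta : R) (N : nat) : set T :=
  [set x | let m := m_u N in let n := n_u p u N in
    exists2 z : site, z \in rightmost_path (fun i j => omega i j x) (m, n) &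
      `|z.1%:R - tau * m%:R| + `|z.2%:R - tau * n%:R| <= delta * pow23 R N].

(* Main.v *)
Require Import Defs.
From mathcomp Require Import all_boot all_order all_algebra.
From mathcomp Require Import zify ring lra.
From mathcomp Require Import all_classical all_reals all_analysis.

(** If a b = p (1 - a) (1 - b), the increments of the last passage time along
    the axes through any site are again independent Ber(a) and Ber(b) variables
    (Burke), so the environment seen from that site is distributed like the
    original one.  Moreover the variance of G(m, n) is bounded by the expected
    length E of the part of the maximal paths on an axis.  A maximal path that
    stays on the axis up to k gains of order x k when u is raised by x; with x
    proportional to k / N this exceeds the change k^2 / N of the mean, and
    Chebyshev's inequality bounds the probability of such a path by
    C N^2 (E + k) / k^4.  Summing over k shows that E is of order N^(2/3) and
    that the tail beyond b N^(2/3) is at most C b^-3.  A deviation as in (a) is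
    a long stretch on an axis in the environment seen from a shifted origin.

    A path as in (b) leaves the axes within distance of order delta N^(2/3) in
    the environment seen from a suitable origin.  Rotate the bulk by a half
    turn: its last passage increments along the north side lie between those of
    the stationary environments with parameters u + r N^(-1/3) and
    u - r N^(-1/3), outside events of small probability.  Hence a random walk
    with drift of order N^(-1/3) nearly attains its maximum over N^(2/3) steps
    during the first delta N^(2/3) steps, which is unlikely for small delta. *)

Set Implicit Arguments.
Unset Strict Implicit.
Unset Printing Implicit Defensive.
Import Order.TTheory GRing.Theory Num.Theory.

Local Open Scope ring_scope.

(** * Expectations over finitely many independent Bernoulli variables *)

Section BernoulliExpectation.
Variables (R : realFieldType) (I : eqType).
Implicit Types (q : I -> R) (s : seq I) (f : (I -> bool) -> R).

(** All events concern finitely many weights, so the argument runs on finite expectations [Ex]: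
    Burke's property becomes an algebraic identity and couplings become maps of configurations. The
    measure [P] enters only through [boundary_environment_prob]. The obstacle in the variance step
    is a circularity: raising u pushes paths towards the horizontal axis, so the horizontal exit sum
    at the raised parameter is not controlled by the one at u. But the variance can be bounded from
    either axis, and the vertical exit sum decreases when u grows. Hence the tail of each exit sum
    is bounded by the other sum at u itself, and the pair of inequalities closes. The change of the
    mean is quadratic only near the direction [slope p u], where m u + n [vert_param p u] is
    stationary in u. In (b) the half turn converts passage times from an axis to the far corner into
    passage times from the origin, which can be compared with stationary environments; their
    boundary weights are drawn afresh, so the increments are independent of the original boundary
    weights. *)

Definition upd (x : I -> bool) i b : I -> bool :=
  fun j => if j == i then b else x j.

(* Expectation of [f] when the coordinates in [s] are independent Bernoulli
   variables with parameters [q] and all other coordinates are [false]. *)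
Fixpoint Ex q s f : R :=
  if s is i :: s' then
    q i * Ex q s' (fun x => f (upd x i true)) +
    (1 - q i) * Ex q s' (fun x => f (upd x i false))
  else f (fun=> false).

Definition supported s (T : Type) (f : (I -> bool) -> T) :=
  forall x y, {in s, x =1 y} -> f x = f y.

Lemma upd_same x i b c : upd (upd x i b) i c = upd x i c.
Proof. by apply/funext => j; rewrite /upd; case: eqP. Qed.

Lemma updC x i j b c : i != j -> upd (upd x i b) j c = upd (upd x j c) i b.
Proof.
move=> ij; apply/funext => k; rewrite /upd.
by case: (eqVneq k j) => // ->; rewrite eq_sym (negbTE ij).
Qed.

Lemma eq_Ex q s f g : (forall x, f x = g x) -> Ex q s f = Ex q s g.
Proof. by move=> fg; congr Ex; apply/funext. Qed.

Lemma eq_Ex_param q q' s f : {in s, q =1 q'} -> Ex q s f = Ex q' s f.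
Proof.
elim: s f => //= i s IH f qq; rewrite (qq i) ?mem_head //.
by rewrite !IH // => j js; apply: qq; rewrite inE js orbT.
Qed.

Lemma ExD q s f g : Ex q s (fun x => f x + g x) = Ex q s f + Ex q s g.
Proof. by elim: s f g => //= i s IH f g; rewrite !IH; ring. Qed.

Lemma ExZ q s c f : Ex q s (fun x => c * f x) = c * Ex q s f.
Proof. by elim: s f => //= i s IH f; rewrite !IH; ring. Qed.

Lemma Ex_cst q s c : Ex q s (fun=> c) = c.
Proof. by elim: s => //= i s ->; ring. Qed.

Lemma ExB q s f g : Ex q s (fun x => f x - g x) = Ex q s f - Ex q s g.
Proof.
have -> : (fun x => f x - g x) = (fun x => f x + -1 * g x).
  by apply/funext => x; ring.
by rewrite ExD ExZ; ring.
Qed.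

Lemma Ex_sum q s (J : Type) (r : seq J) (P : pred J) (F : J -> (I -> bool) -> R) :
  Ex q s (fun x => \sum_(k <- r | P k) F k x) = \sum_(k <- r | P k) Ex q s (F k).
Proof.
elim: r => [|k r IH].
  rewrite big_nil -[RHS](Ex_cst q s 0).
  by apply: eq_Ex => x; rewrite big_nil.
rewrite big_cons; case: ifP => Pk.
  by rewrite -IH -ExD; apply: eq_Ex => x; rewrite big_cons Pk.
by rewrite -IH; apply: eq_Ex => x; rewrite big_cons Pk.
Qed.

Lemma le_Ex q s f g : (forall i, 0 <= q i <= 1) ->
  (forall x, f x <= g x) -> Ex q s f <= Ex q s g.
Proof.
move=> q01; elim: s f g => //= i s IH f g fg.
have /andP[q0 q1] := q01 i.
by apply: lerD; apply: ler_wpM2l; rewrite ?subr_ge0 //; apply: IH.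
Qed.

Lemma Ex_ge0 q s f : (forall i, 0 <= q i <= 1) -> (forall x, 0 <= f x) ->
  0 <= Ex q s f.
Proof. by move=> q01 f0; rewrite -[leLHS](Ex_cst q s 0); apply: le_Ex. Qed.

(** Updates at distinct sites commute, and of two updates at the same site the later one wins; hence
    one may condition on any member of [s], even a repeated one. *)
Lemma Ex_split q s i f : i \in s -> Ex q s f =
  q i * Ex q s (fun x => f (upd x i true)) +
  (1 - q i) * Ex q s (fun x => f (upd x i false)).
Proof.
elim: s f => //= j s IH f; rewrite inE; have [<- _|ij /= is_] := eqVneq i j.
  have E b b' : Ex q s (fun x => f (upd (upd x i b) i b')) =
      Ex q s (fun x => f (upd x i b')).
    by apply: eq_Ex => x; rewrite upd_same.
  by rewrite !E; ring.
have E b b' : Ex q s (fun x => f (upd (upd x j b) i b')) =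
    Ex q s (fun x => f (upd (upd x i b') j b)).
  by apply: eq_Ex => x; rewrite updC // eq_sym.
by rewrite !E !(IH (fun x => f (upd x j _)) is_); ring.
Qed.

Lemma supported_upd s i b f :
  supported (i :: s) f -> supported s (fun x => f (upd x i b)).
Proof.
move=> sf x y xy; apply: sf => j; rewrite inE /upd.
by case: eqVneq => //= _ /xy.
Qed.

(** Allows a functional to be computed in any window that contains its support, so that rectangles
    of different sizes can be compared. *)
Lemma Ex_supported q s s' f : {subset s' <= s} -> supported s' f ->
  Ex q s f = Ex q s' f.
Proof.
elim: s' f => [|i s' IH] f ss sf.
  have -> : f = fun=> f (fun=> false) by apply/funext => x; apply: sf.
  by rewrite Ex_cst.
rewrite (Ex_split _ _ (ss i (mem_head _ _))) /=.
by rewrite !IH //; try exact: supported_upd; move=> j js; apply: ss; rewrite inE js orbT.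
Qed.

(** Parameters are changed one coordinate at a time: each change contributes (q' i - q i) times the
    difference of two conditional expectations, and these factors have the same sign. *)
Lemma le_Ex_param q q' s f : (forall i, 0 <= q i <= 1) ->
  (forall i, 0 <= q' i <= 1) ->
  (forall i x, i \in s -> [\/ q i = q' i,
     q i <= q' i /\ f (upd x i false) <= f (upd x i true) |
     q' i <= q i /\ f (upd x i true) <= f (upd x i false)]) ->
  uniq s -> Ex q s f <= Ex q' s f.
Proof.
move=> q01 q01'; elim: s f => //= i s IH f mono /andP[is_ us].
have IHb b : Ex q s (fun x => f (upd x i b)) <= Ex q' s (fun x => f (upd x i b)).
  apply: IH => // j x js; have ji : j != i by apply: contraNneq is_ => <-.
  have := mono j (upd x i b); rewrite inE js orbT => /(_ isT).
  by rewrite !(updC _ _ _ ji) // ![upd (upd x i b) j _]updC // eq_sym.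
have /andP[q0 q1] := q01 i; have /andP[q0' q1'] := q01' i.
have m := IHb true; have m' := IHb false.
set a := Ex q' s (fun x => f (upd x i true)) in m *.
set b := Ex q' s (fun x => f (upd x i false)) in m' *.
apply: (@le_trans _ _ (q i * a + (1 - q i) * b)).
  by apply: lerD; apply: ler_wpM2l; rewrite ?subr_ge0.
rewrite -subr_ge0.
have -> : q' i * a + (1 - q' i) * b - (q i * a + (1 - q i) * b) =
  (q' i - q i) * (a - b) by ring.
case: (eqVneq (q i) (q' i)) => [->|ne]; first by rewrite subrr mul0r.
have {mono} mono x := mono i x (mem_head _ _).
have [qq|qq] := leP (q i) (q' i).
  apply: mulr_ge0; rewrite subr_ge0 //; apply: le_Ex => // x.
  case: (mono x) => -[] //; first by move/eqP; rewrite (negbTE ne).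
  by move=> qq' _; move: ne; rewrite eq_le qq qq'.
rewrite -mulrNN; apply: mulr_ge0; rewrite oppr_ge0 subr_le0 ?(ltW qq) //.
apply: le_Ex => // x; case: (mono x) => -[] //.
  by move/eqP; rewrite (negbTE ne).
by move=> qq' _; have := lt_le_trans qq qq'; rewrite ltxx.
Qed.

End BernoulliExpectation.

(** * Relabelling and coupling of Bernoulli variables *)

Section BernoulliExpectationMaps.
Variable R : realFieldType.

Lemma Ex_map (I J : eqType) (q : I -> R) (sg : J -> I) (s : seq J)
    (f : (J -> bool) -> R) : injective sg ->
  Ex q (map sg s) (fun x => f (x \o sg)) = Ex (q \o sg) s f.
Proof.
move=> inj; elim: s f => [|j s IH] f //=.
have E b : Ex q (map sg s) (fun x => f (upd x (sg j) b \o sg)) =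
    Ex (q \o sg) s (fun x => f (upd x j b)).
  rewrite -IH; apply: eq_Ex => x; congr f; apply/funext => k.
  by rewrite /upd /= (inj_eq inj).
by rewrite !E.
Qed.

Lemma Ex_swap (I J : eqType) (q : I -> R) (q' : J -> R) s s'
    (f : (I -> bool) -> (J -> bool) -> R) :
  Ex q s (fun x => Ex q' s' (fun y => f x y)) =
  Ex q' s' (fun y => Ex q s (fun x => f x y)).
Proof. by elim: s f => //= i s IH f; rewrite !IH ExD !ExZ. Qed.

(* [phi i X Y] is Bernoulli([q'' i]) for independent X ~ Ber([q i]) and
   Y ~ Ber([q' i]). *)
Lemma Ex_comb (I : eqType) (q q' q'' : I -> R) (phi : I -> bool -> bool -> bool)
    s (f : (I -> bool) -> R) :
  (forall i, phi i false false = false) ->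
  (forall i, q'' i = q i * q' i * (phi i true true)%:R +
    q i * (1 - q' i) * (phi i true false)%:R +
    (1 - q i) * q' i * (phi i false true)%:R) ->
  Ex q s (fun x => Ex q' s (fun y => f (fun i => phi i (x i) (y i)))) =
  Ex q'' s f.
Proof.
move=> phi0 qE; elim: s f => [|i s IH] f /=.
  by congr f; apply/funext => i; apply: phi0.
have E b c : Ex q s (fun x => Ex q' s (fun y =>
    f (fun j => phi j (upd x i b j) (upd y i c j)))) =
    Ex q'' s (fun x => f (upd x i (phi i b c))).
  rewrite -IH; apply: eq_Ex => x; apply: eq_Ex => y; congr f.
  by apply/funext => j; rewrite /upd; case: eqP => [->|].
rewrite !ExD !ExZ !E qE phi0.
case: (phi i true true); case: (phi i true false); case: (phi i false true) => /=;
  set A := Ex q'' s _; set B := Ex q'' s _; ring.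
Qed.

End BernoulliExpectationMaps.

(** * Simple random walks *)

Section Walk.
Variables (R : realFieldType) (I : eqType).
Implicit Types (s : seq I) (h : nat).

(* The walk with steps [x i - y i], i in s, stays strictly below h. *)
Fixpoint below s h (x y : I -> bool) : bool :=
  if s is i :: s' then (0 < h)%N && below s' (h + y i - x i) x y else (0 < h)%N.

Lemma below_lt s h x y : below s h x y ->
  (\sum_(i <- s) x i < h + \sum_(i <- s) y i)%N.
Proof.
elim: s h => [|i s IH] h /=; first by rewrite !big_nil addn0.
by move=> /andP[h0 /IH]; rewrite !big_cons; case: (x i); case: (y i) => /=; lia.
Qed.

Lemma eq_below s h (x x' y y' : I -> bool) :
  {in s, x =1 x'} -> {in s, y =1 y'} -> below s h x y = below s h x' y'.
Proof.
elim: s h => //= i s IH h xx yy; rewrite xx ?yy ?mem_head //; congr (_ && _).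
by apply: IH => j js; [apply: xx | apply: yy]; rewrite inE js orbT.
Qed.

Lemma below_take s h x y k : below s h x y -> below (take k s) h x y.
Proof.
elim: s h k => [|i s IH] h [|k] //=; first by move=> /andP[].
by move=> /andP[-> /(IH _ k)] /=.
Qed.

Lemma not_below s h x y : ~~ below s h x y -> exists2 k, (k <= size s)%N &
  (h + \sum_(i <- take k s) y i <= \sum_(i <- take k s) x i)%N.
Proof.
elim: s h => [|i s IH] h /=; first by rewrite -eqn0Ngt => /eqP ->; exists 0%N; rewrite ?big_nil.
have [->|h0] := posnP h; first by exists 0%N; rewrite ?big_nil.
move=> /IH[k ks H]; exists k.+1 => //.
by move: H; rewrite /= !big_cons; case: (x i); case: (y i) => /=; lia.
Qed.

Lemma below_upd s h x y i b c : i \notin s ->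
  below s h (upd x i b) (upd y i c) = below s h x y.
Proof.
elim: s h => //= j s IH h; rewrite inE negb_or => /andP[ij js].
by rewrite /upd ![j == i]eq_sym (negbTE ij) IH.
Qed.

(** The distance to the barrier shrinks with probability [a (1 - a')] and grows with probability
    [(1 - a) a'], so [a' - a] is the drift away from the barrier. *)
Definition stay a a' s h : R := Ex (fun=> a) s (fun x => Ex (fun=> a') s
  (fun y => (below s h x y)%:R)).

Lemma stay_cons a a' i s h : i \notin s -> (0 < h)%N ->
  stay a a' (i :: s) h = (a * a' + (1 - a) * (1 - a')) * stay a a' s h +
    a * (1 - a') * stay a a' s h.-1 + (1 - a) * a' * stay a a' s h.+1.
Proof.
move=> is_ h0; rewrite /stay /= .
have e b c : Ex (fun=> a) s (fun x => Ex (fun=> a') s (fun y =>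
    ((0 < h)%N && below s (h + upd y i c i - upd x i b i)
       (upd x i b) (upd y i c))%:R)) =
    stay a a' s (h + c - b).
  apply: eq_Ex => x; apply: eq_Ex => y; rewrite h0 below_upd //.
  by rewrite /upd !eqxx.
rewrite !ExD !ExZ !e /= ?addn1 ?addn0 ?subn0 ?subn1 /=; rewrite /stay; ring.
Qed.

Lemma stay0 a a' s : stay a a' s 0 = 0.
Proof.
rewrite -[RHS](Ex_cst (fun=> a) s 0); apply: eq_Ex => x.
by rewrite -[RHS](Ex_cst (fun=> a') s 0); apply: eq_Ex => y; case: s.
Qed.

Lemma stay01 a a' s h : 0 <= a <= 1 -> 0 <= a' <= 1 -> 0 <= stay a a' s h <= 1.
Proof.
move=> a01 a01'; apply/andP; split.
  by apply: Ex_ge0 => // x; apply: Ex_ge0.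
rewrite -[leRHS](Ex_cst (fun=> a) s 1); apply: le_Ex => // x.
by rewrite -[leRHS](Ex_cst (fun=> a') s 1); apply: le_Ex => // y; case: below.
Qed.

(** A maximal inequality from a quadratic potential: one step raises the expectation of (H - h)^2 by
    at most C while |H - h| <= H, and outside this range the bound is at least 1. *)
Lemma hit_le a a' s (H C : R) h : 0 <= a <= 1 -> 0 <= a' <= 1 -> uniq s ->
  0 < H -> a * (1 - a') + (1 - a) * a' + 2 * H * `|a' - a| <= C ->
  1 - stay a a' s h <= ((H - h%:R) ^+ 2 + (size s)%:R * C) / H ^+ 2.
Proof.
move=> a01 a01' us H0 HC; have H2 : 0 < H ^+ 2 by rewrite exprn_gt0.
case/andP: (a01) => a0 a1; case/andP: (a01') => a0' a1'.
have p1 : 0 <= a * (1 - a') by rewrite mulr_ge0 ?subr_ge0.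
have p2 : 0 <= (1 - a) * a' by rewrite mulr_ge0 ?subr_ge0.
have p3 : 0 <= a * a' + (1 - a) * (1 - a').
  by rewrite addr_ge0 // mulr_ge0 ?subr_ge0.
have C0 : 0 <= C.
  by apply: le_trans HC; rewrite !addr_ge0 // mulr_ge0 // mulr_ge0 // ltW.
elim: s h us => [|i s IH] h /=.
  move=> _; case: h => [|h]; first by rewrite stay0 subr0 subr0 mul0r addr0 divff ?gt_eqF.
  by rewrite /stay /= subrr mul0r addr0 divr_ge0 ?sqr_ge0 // ltW.
move=> /andP[is_ us].
have [->|h0] := posnP h.
  rewrite stay0 subr0 subr0 ler_pdivlMr // mul1r lerDl mulr_ge0 //.
have [big|small] := leP (H ^+ 2) ((H - h%:R) ^+ 2).
  have /andP[w0 _] := stay01 (i :: s) h a01 a01'.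
  apply: (@le_trans _ _ 1); first lra.
  rewrite ler_pdivlMr // mul1r; apply: (le_trans big); rewrite lerDl mulr_ge0 //.
have bound : `|H - h%:R| <= H.
  by rewrite -ler_sqr ?nnegrE ?(ltW H0) // real_normK ?num_real // ltW.
rewrite stay_cons //.
have e1 := IH h us; have e2 := IH h.-1 us; have e3 := IH h.+1 us.
have hp : (h.-1%:R : R) = h%:R - 1 by rewrite -[in RHS](prednK h0) -natr1 addrK.
rewrite hp in e2; rewrite -(natr1 h) in e3; rewrite -(natr1 (size s)).
set x := (h%:R : R) in bound e1 e2 e3 *.
set k := (size s)%:R in e1 e2 e3 *.
rewrite ler_pdivlMr //; rewrite !ler_pdivlMr // in e1 e2 e3.
have f1 := ler_wpM2l p3 e1; have f2 := ler_wpM2l p1 e2; have f3 := ler_wpM2l p2 e3.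
have dr : - (2 * (H - x) * (a' - a)) <= 2 * H * `|a' - a|.
  apply: le_trans (ler_norm _) _; rewrite normrN !normrM normr_nat -!mulrA.
  by apply: ler_wpM2l => //; apply: ler_wpM2r.
move: f1 f2 f3; set W1 := stay _ _ _ h; set W2 := stay _ _ _ h.-1.
set W3 := stay _ _ _ h.+1 => f1 f2 f3.
have -> : (1 - ((a * a' + (1 - a) * (1 - a')) * W1 + a * (1 - a') * W2 +
    (1 - a) * a' * W3)) * H ^+ 2 =
  (a * a' + (1 - a) * (1 - a')) * ((1 - W1) * H ^+ 2) +
  a * (1 - a') * ((1 - W2) * H ^+ 2) + (1 - a) * a' * ((1 - W3) * H ^+ 2) by ring.
apply: (le_trans (lerD (lerD f1 f2) f3)).
have -> : (a * a' + (1 - a) * (1 - a')) * ((H - x) ^+ 2 + k * C) +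
  a * (1 - a') * ((H - (x - 1)) ^+ 2 + k * C) +
  (1 - a) * a' * ((H - (x + 1)) ^+ 2 + k * C) =
  (H - x) ^+ 2 + k * C + (a * (1 - a') + (1 - a) * a') - 2 * (H - x) * (a' - a) by ring.
by rewrite mulrDl mul1r; lra.
Qed.

(* [h (2 B - h)] is superharmonic for the walk killed at 0, as long as the
   drift is small compared to 1 / B. *)
Lemma stay_le a a' s (B : R) h : 0 <= a <= 1 -> 0 <= a' <= 1 -> uniq s ->
  2 <= B -> 0 < a * (1 - a') + (1 - a) * a' ->
  4 * B * `|a' - a| <= a * (1 - a') + (1 - a) * a' -> h%:R <= B + 1 ->
  stay a a' s h <= h%:R * (2 * B - h%:R) *
    ((B ^+ 2 - 1)^-1 + 2 / (a * (1 - a') + (1 - a) * a') / ((size s)%:R + 1)).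
Proof.
move=> a01 a01' us B2; have B1 : 1 < B by lra.
set sg := a * (1 - a') + _ => sg0 sgB hB.
case/andP: (a01) => a0 a1; case/andP: (a01') => a0' a1'.
have p1 : 0 <= a * (1 - a') by rewrite mulr_ge0 ?subr_ge0.
have p2 : 0 <= (1 - a) * a' by rewrite mulr_ge0 ?subr_ge0.
have p3 : 0 <= a * a' + (1 - a) * (1 - a').
  by rewrite addr_ge0 // mulr_ge0 ?subr_ge0.
have sg1 : sg <= 1 by rewrite /sg; nra.
have BB : 0 < B ^+ 2 - 1 by rewrite subr_gt0 exprn_egt1.
set be := (B ^+ 2 - 1)^-1; set c := 2 / sg.
have be0 : 0 < be by rewrite invr_gt0.
have c0 : 0 < c by rewrite divr_gt0.
have c2 : 2 <= c by rewrite /c ler_pdivlMr // -[leRHS]mulr1 ler_pM2l.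
have w1 s' h' := andP (stay01 s' h' a01 a01').
have m0 k : 0 < be + c / (k%:R + 1) by rewrite addr_gt0 // divr_gt0 // natr1.
have f0 j : (j%:R : R) <= B + 1 -> 0 <= j%:R * (2 * B - j%:R).
  by move=> jB; rewrite mulr_ge0 // subr_ge0; lra.
elim: s h us hB => [|i s IH] h /=.
  move=> _ hB; case: h hB => [|h] hB; first by rewrite stay0 mul0r mul0r.
  rewrite /stay /= add0r divr1.
  have h1 : (1 : R) <= h.+1%:R by rewrite ler1n.
  set x := h.+1%:R in hB h1 *.
  have : 1 <= x * (2 * B - x).
    have : 0 <= (x - 1) * (B + 1 - x) by rewrite mulr_ge0 // subr_ge0.
    have : 0 <= x * (B - 2) by rewrite mulr_ge0 ?subr_ge0 //; lra.
    lra.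
  set f := x * _ => f1.
  have : 1 * 1 <= f * (be + c) by apply: ler_pM => //; lra.
  by rewrite mulr1.
move=> /andP[is_ us] hB.
have [->|h0] := posnP h; first by rewrite stay0 mul0r mul0r.
set f := h%:R * _; have f00 : 0 <= f by apply: f0.
have [big|small] := leP 1 (f * (be + c / ((size s).+1%:R + 1))).
  by apply: le_trans big; have [_] := w1 (i :: s) h.
(* Otherwise f = B^2 - (B - h)^2 >= B^2 - 1, and the term [be] alone makes the bound at least 1. *)
have hB1 : h%:R + 1 <= B.
  rewrite leNgt; apply/negP => lt.
  have : B ^+ 2 - 1 <= f by rewrite /f; nra.
  rewrite -(ler_pM2r be0) divff ?gt_eqF // => fb.
  move: small; rewrite mulrDr; apply/negP; rewrite -leNgt.
  by apply: (le_trans fb); rewrite lerDl mulr_ge0 // divr_ge0 // ltW // natr1.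
rewrite stay_cons //.
have hp : (h.-1%:R : R) = h%:R - 1 by rewrite -[in RHS](prednK h0) -natr1 addrK.
have h1 : (1 : R) <= h%:R by rewrite ler1n.
have hp1 : (h.-1%:R : R) <= B + 1 by rewrite hp; clear -hB1; lra.
have hp2 : (h.+1%:R : R) <= B + 1 by rewrite -natr1; clear -hB1; lra.
have e1 := IH h us hB; have e2 := IH h.-1 us hp1.
have e3 := IH h.+1 us hp2.
rewrite hp in e2; rewrite -(natr1 h) in e3; rewrite -(natr1 (size s)).
have kk : 0 < ((size s)%:R + 1 : R) by rewrite natr1.
move: e1 e2 e3 small; rewrite -(natr1 (size s)).
set m1 := be + _; set m2 := be + _; rewrite /f; set x := (h%:R : R) in h1 hB1 *.
move=> e1 e2 e3 small.
have m10 : 0 < m1 by apply: m0.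
have f1 := ler_wpM2l p3 e1; have f2 := ler_wpM2l p1 e2; have f3 := ler_wpM2l p2 e3.
have dr : 2 * (B - x) * (a' - a) <= sg / 2.
  apply: le_trans (ler_norm _) _; rewrite !normrM normr_nat.
  have : 2 * `|B - x| * `|a' - a| <= 2 * B * `|a' - a|.
    by apply: ler_wpM2r => //; clear -h1 hB1; rewrite ger0_norm; lra.
  clear -sgB; lra.
apply: (le_trans (lerD (lerD f1 f2) f3)).
have -> : (a * a' + (1 - a) * (1 - a')) * (x * (2 * B - x) * m1) +
  a * (1 - a') * ((x - 1) * (2 * B - (x - 1)) * m1) +
  (1 - a) * a' * ((x + 1) * (2 * B - (x + 1)) * m1) =
  (x * (2 * B - x) + 2 * (B - x) * (a' - a) - sg) * m1 by rewrite /sg; ring.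
apply: (@le_trans _ _ ((x * (2 * B - x) - sg / 2) * m1)).
  by apply: ler_wpM2r; [exact: ltW | clear -dr; lra].
rewrite -/f in f00 *; move: small; rewrite -/f => small.
rewrite mulrBl lerBlDl -lerBlDr -mulrBr.
(* The potential drops by sg / 2 per step, which pays for the decrease of the time term from c / k
   to c / (k + 1). This balance fixes c = 2 / sg. *)
have gen (k : R) : 0 < k -> f * (be + c / (k + 1)) < 1 ->
    f * (be + c / k - (be + c / (k + 1))) <= sg / 2 * (be + c / k).
  move=> k0 sm; have -> : be + c / k - (be + c / (k + 1)) = c / (k + 1) / k.
    by field; rewrite !gt_eqF //; clear -k0; lra.
  have fk : f * (c / (k + 1)) <= 1.
    apply: le_trans (ltW sm); rewrite mulrDr lerDr mulr_ge0 //; exact: ltW.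
  apply: (@le_trans _ _ k^-1).
    rewrite mulrA -[leRHS]mul1r; apply: ler_wpM2r => //.
    by rewrite invr_ge0 ltW.
  apply: (@le_trans _ _ (sg / 2 * (c / k))).
    by rewrite le_eqVlt; apply/orP; left; apply/eqP; rewrite /c; field; rewrite !gt_eqF.
  by apply: ler_wpM2l; [exact: divr_ge0 (ltW sg0) _ | rewrite lerDr ltW].
exact: gen kk small.
Qed.

End Walk.

(** * Last passage times *)

Notation config := (site -> bool).
Implicit Types x y : config.

Section LastPassage.

Local Open Scope nat_scope.

Definition G x i j : nat := lpt (fun a b => x (a, b)) (i, j).

Lemma G00 x : G x 0 0 = 0.
Proof.
have [s [as_ ws]] := lpt_attained (fun a b => x (a, b)) (0, 0).
by have := path_weight_le (fun a b => x (a, b)) as_; rewrite ws /G /=; lia.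
Qed.

Lemma Gi0 x i : G x i.+1 0 = G x i 0 + x (i.+1, 0).
Proof.
rewrite /G; have [//|[a b]] := @lpt_pred (fun a b => x (a, b)) (i.+1, 0).
rewrite /admissible_step !inE => /or3P[]/eqP[] // <- <- ->.
by rewrite /step_weight /=.
Qed.

Lemma G0j x j : G x 0 j.+1 = G x 0 j + x (0, j.+1).
Proof.
rewrite /G; have [//|[a b]] := @lpt_pred (fun a b => x (a, b)) (0, j.+1).
rewrite /admissible_step !inE => /or3P[]/eqP[] // <- <- ->.
by rewrite /step_weight /= orbT.
Qed.

Lemma GSS x i j : G x i.+1 j.+1 =
  maxn (maxn (G x i j.+1) (G x i.+1 j)) (G x i j + x (i.+1, j.+1)).
Proof.
rewrite /G; set om := fun a b => x (a, b).
have wd : step_weight om (i, j) (i.+1, j.+1) = om i.+1 j.+1.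
  by rewrite /step_weight /= !eqxx !orbT.
have wl : step_weight om (i, j.+1) (i.+1, j.+1) = 0%N.
  by rewrite /step_weight; case: ifP => //; rewrite xpair_eqE /=; lia.
have wu : step_weight om (i.+1, j) (i.+1, j.+1) = 0%N.
  by rewrite /step_weight; case: ifP => //; rewrite xpair_eqE /=; lia.
have := @lpt_step om (i, j.+1) (i.+1, j.+1).
have := @lpt_step om (i.+1, j) (i.+1, j.+1).
have := @lpt_step om (i, j) (i.+1, j.+1).
rewrite /admissible_step !inE !eqxx !orbT wd wl wu /om => /(_ isT) h1 /(_ isT) h2 /(_ isT) h3.
have [//|[a b]] := @lpt_pred om (i.+1, j.+1).
rewrite /admissible_step !inE => /or3P[]/eqP[] <- <-; rewrite ?wd ?wl ?wu /om => h4; lia.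
Qed.

Lemma eq_G x y m n :
  (forall i j, i <= m -> j <= n -> 0 < i + j -> x (i, j) = y (i, j)) ->
  G x m n = G y m n.
Proof.
elim: n m => [|n IHn]; elim=> [|m IHm] xy.
- by rewrite !G00.
- by rewrite !Gi0 IHm ?xy // => *; apply: xy; lia.
- by rewrite !G0j IHn ?xy // => *; apply: xy; lia.
- by rewrite !GSS !IHn ?IHm ?xy // => *; apply: xy; lia.
Qed.

Lemma G_mono x y m n : (forall v, x v <= y v) -> G x m n <= G y m n.
Proof.
move=> xy; elim: n m => [|n IHn]; elim=> [|m IHm].
- by rewrite !G00.
- by rewrite !Gi0; have := xy (m.+1, 0); lia.
- by rewrite !G0j; have := xy (0, n.+1); have := IHn 0; lia.
- rewrite !GSS; have := xy (m.+1, n.+1); have := IHn m; have := IHn m.+1; lia.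
Qed.

Lemma G_right1 x i j : G x i j <= G x i.+1 j.
Proof. by case: j => [|j]; rewrite ?Gi0 ?GSS; lia. Qed.

Lemma G_up1 x i j : G x i j <= G x i j.+1.
Proof. by case: i => [|i]; rewrite ?G0j ?GSS; lia. Qed.

Lemma G_le x i j m n : i <= m -> j <= n -> G x i j <= G x m n.
Proof.
move=> im jn; apply: (@leq_trans (G x m j)).
  rewrite -(subnKC im); elim: (m - i) => [|k IH]; first by rewrite addn0.
  by rewrite addnS; apply: leq_trans IH (G_right1 _ _ _).
rewrite -(subnKC jn); elim: (n - j) => [|k IH]; first by rewrite addn0.
by rewrite addnS; apply: leq_trans IH (G_up1 _ _ _).
Qed.

Definition swapc x : config := fun v => x (v.2, v.1).

Lemma swapcK x : swapc (swapc x) = x.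
Proof. by apply/funext => -[i j]. Qed.

Lemma G_swap x i j : G (swapc x) j i = G x i j.
Proof.
elim: j i => [|j IHj]; elim=> [|i IHi].
- by rewrite !G00.
- by rewrite Gi0 G0j IHi.
- by rewrite Gi0 G0j IHj.
- by rewrite !GSS IHi !IHj (maxnC (G x i.+1 j)).
Qed.

Lemma G_incr1 x i j : G x i.+1 j <= (G x i j).+1 /\ G x i j.+1 <= (G x i j).+1.
Proof. by split; [rewrite -!(G_swap x)|]; exact: lpt_up. Qed.

(** The origin is left out because no step enters it. *)
Definition rect m n : seq site :=
  [seq v <- [seq (i, j) | i <- iota 0 m.+1, j <- iota 0 n.+1] | 0 < v.1 + v.2].

Lemma mem_rect v m n :
  (v \in rect m n) = [&& 0 < v.1 + v.2, v.1 <= m & v.2 <= n].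
Proof.
rewrite mem_filter; congr (_ && _).
case: v => i j; apply/allpairsP/idP => [[[a b] []]|/andP[im jn]].
  rewrite !mem_iota => ha hb [-> ->]; move: ha hb.
  by rewrite /= !add0n !ltnS => -> ->.
by exists (i, j); split; rewrite ?mem_iota.
Qed.

Lemma rect_uniq m n : uniq (rect m n).
Proof.
by apply: filter_uniq; apply: allpairs_uniq; rewrite ?iota_uniq // => -[a b] [c d] _ _.
Qed.

Lemma G_supported m n a b : m <= a -> n <= b ->
  supported (rect a b) (fun x => G x m n).
Proof.
by move=> ma nb x y xy; apply: eq_G => i j im jn ij; apply: xy; rewrite mem_rect /=; lia.
Qed.

(* The environment seen from (i0, j0): its boundary weights are the increments
   of the last passage time along the two axes through (i0, j0). *)
Definition shift i0 j0 x : config := fun v =>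
  match v with
  | (0, 0) => false
  | (k.+1, 0) => G x (i0 + k.+1) j0 != G x (i0 + k) j0
  | (0, l.+1) => G x i0 (j0 + l.+1) != G x i0 (j0 + l)
  | (k.+1, l.+1) => x (i0 + k.+1, j0 + l.+1)
  end.

(** The recursion [GSS] commutes with subtracting a constant, and increments of G are 0 or 1, so
    they can serve as boundary weights. *)
Lemma G_shift i0 j0 x k l :
  G (shift i0 j0 x) k l + G x i0 j0 = G x (i0 + k) (j0 + l).
Proof.
elim: l k => [|l IHl]; elim=> [|k IHk].
- by rewrite G00 !addn0.
- move: IHk; rewrite Gi0 addn0 /= addnS.
  by have := G_incr1 x (i0 + k) j0; have := G_right1 x (i0 + k) j0; case: eqP => /=; lia.
- have := IHl 0; rewrite G0j addn0 /= addnS.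
  by have := G_incr1 x i0 (j0 + l); have := G_up1 x i0 (j0 + l); case: eqP => /=; lia.
- have := IHl k; have := IHl k.+1; move: IHk.
  by rewrite !addnS !GSS /= !addnS; lia.
Qed.

Lemma shift_shift i0 j0 i1 j1 x :
  shift i1 j1 (shift i0 j0 x) = shift (i0 + i1) (j0 + j1) x.
Proof.
apply/funext => -[[|k] [|l]] //=; last by rewrite !addnS !addnA.
- have := G_shift i0 j0 x i1 (j1 + l.+1); have := G_shift i0 j0 x i1 (j1 + l).
  by rewrite -!addnA; do !case: eqP; lia.
- have := G_shift i0 j0 x (i1 + k.+1) j1; have := G_shift i0 j0 x (i1 + k) j1.
  by rewrite -!addnA; do !case: eqP; lia.
Qed.

Lemma swapc_shift i0 j0 x : swapc (shift i0 j0 x) = shift j0 i0 (swapc x).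
Proof.
by apply/funext => -[[|k] [|l]]; rewrite [LHS]/swapc /= ?G_swap.
Qed.

Lemma eq_shift i0 j0 m n x y : {in rect (i0 + m) (j0 + n), x =1 y} ->
  {in rect m n, shift i0 j0 x =1 shift i0 j0 y}.
Proof.
move=> xy [k l]; rewrite mem_rect /= => kl.
have E i j : i <= i0 + m -> j <= j0 + n -> G x i j = G y i j.
  by move=> im jn; apply: eq_G => a b *; apply: xy; rewrite mem_rect /=; lia.
by case: k l kl => [|k] [|l] kl //=; rewrite ?E ?xy ?mem_rect //=; lia.
Qed.

(* Only paths that follow the horizontal axis at least up to (k, 0) collect
   something in [cut k x]. *)
Definition cut k x : config := fun v => x v && ((v.2 == 0) || (k < v.1)).
Definition kill k x : config := fun v => x v && ~~ ((v.2 == 0) && (k <= v.1)).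

Lemma cutE k x i j : cut k x (i, j) = x (i, j) && ((j == 0) || (k < i)).
Proof. by []. Qed.

Lemma killE k x i j : kill k x (i, j) = x (i, j) && ~~ ((j == 0) && (k <= i)).
Proof. by []. Qed.

(* Some maximal path to (m, n) passes through (k, 0). *)
Definition through k x m n : bool := G (cut k x) m n == G x m n.

Lemma cut_le k x v : cut k x v <= x v.
Proof. by rewrite /cut; case: (x v) => //=; case: (_ || _). Qed.

Lemma G_cut_le k x m n : G (cut k x) m n <= G x m n.
Proof. exact: G_mono (cut_le k x). Qed.

Lemma through_ge k x m n : G x m n <= G (cut k x) m n -> through k x m n.
Proof. by move=> h; rewrite /through eqn_leq h G_cut_le. Qed.

Lemma through_le k k' x m n : k <= k' -> through k' x m n -> through k x m n.
Proof.
move=> kk /eqP T; apply: through_ge; rewrite -T; apply: G_mono => -[i j].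
by rewrite /cut /=; case: (x _) => //=; case: (j == 0) => //=; lia.
Qed.

Lemma G_i0_hor x y k : (forall i, 0 < i -> i <= k -> x (i, 0) = y (i, 0)) ->
  G x k 0 = G y k 0.
Proof. by move=> xy; apply: eq_G => i [|j] // *; apply: xy; lia. Qed.

Lemma G_cut_axis k x i j : i <= k -> G (cut k x) i j = G x i 0.
Proof.
elim: j i => [|j IHj].
  by move=> i ik; apply: G_i0_hor => a *; rewrite /cut /= andbT.
elim=> [|i IHi] ik; first by rewrite G0j IHj // /cut /= andbF addn0.
rewrite GSS IHi 1?ltnW // !IHj // 1?ltnW // /cut /=.
by rewrite ltnNge ik andbF addn0 Gi0; lia.
Qed.

(** Both environments are measured from (k, 0), beyond which [y] has the same bulk as [x] and at
    least its axis weights. *)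
Lemma cut_gain k x y i j : (forall a, k < a -> x (a, 0) <= y (a, 0)) ->
  (forall a b, k < a -> 0 < b -> x (a, b) = y (a, b)) -> k <= i ->
  G (cut k x) i j + G y k 0 <= G (cut k y) i j + G x k 0.
Proof.
move=> hor bulk; elim: j i => [|j IHj] i ki.
  rewrite -(subnKC ki); elim: (i - k) => [|a IH].
    by rewrite addn0 !G_cut_axis // addnC.
  rewrite addnS !Gi0 !cutE /= !andbT.
  by have := hor (k + a).+1 ltac:(lia); lia.
rewrite -(subnKC ki); elim: (i - k) => [|a IH].
  by rewrite addn0 !G_cut_axis // addnC.
rewrite addnS !GSS; have := IHj (k + a) ltac:(lia); have := IHj (k + a).+1 ltac:(lia).
by rewrite !cutE /= bulk //; lia.
Qed.

Lemma through_gain k x y m n : (forall a, x (a, 0) <= y (a, 0)) ->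
  (forall a b, 0 < a -> 0 < b -> x (a, b) = y (a, b)) -> k <= m ->
  through k x m n -> G x m n + G y k 0 <= G y m n + G x k 0.
Proof.
move=> hor bulk km /eqP <-; have := G_cut_le k y m n.
have := @cut_gain k x y m n (fun a _ => hor a) _ km.
by move=> /(_ (fun a b ka => bulk a b (leq_ltn_trans (leq0n k) ka))); lia.
Qed.

(** A path either visits (k, 0) or collects axis weights only before column k. The induction over
    cells replaces a case analysis on paths. *)
Lemma cut_or_kill k x m n : 0 < k ->
  G x m n <= maxn (G (cut k x) m n) (G (kill k x) m n).
Proof.
move=> k0.
have small i j : i < k -> G (kill k x) i j = G x i j.
  move=> ik; apply: eq_G => a b *; rewrite /kill /=.
  by rewrite (leqNgt k a) (leq_ltn_trans _ ik) // andbF andbT.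
elim: n m => [|n IHn]; elim=> [|m IHm].
- by rewrite !G00.
- have [mk|mk] := ltnP m.+1 k; first by rewrite small //; lia.
  have -> : G (cut k x) m.+1 0 = G x m.+1 0; last by lia.
  by apply: G_i0_hor => a *; rewrite /cut /= andbT.
- by rewrite small //; lia.
have := IHn m; have := IHn m.+1; move: IHm; rewrite !GSS.
have -> : kill k x (m.+1, n.+1) = x (m.+1, n.+1) by rewrite killE /= andbT.
have [mk|mk] := leqP m.+1 k.
  by rewrite !(small m) //; lia.
by rewrite cutE mk orbT andbT; lia.
Qed.

Lemma G_upd x c m n :
  G (upd x c true) m n <= (G (upd x c false) m n).+1.
Proof.
have far i j : (i < c.1) || (j < c.2) ->
    G (upd x c true) i j = G (upd x c false) i j.
  move=> ij; apply: eq_G => a b *; rewrite /upd.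
  by case: eqP => // E; move: ij; rewrite -E /=; lia.
have val v : upd x c true v <= upd x c false v + (v == c).
  by rewrite /upd; case: eqP => // _; lia.
elim: n m => [|n IHn]; elim=> [|m IHm].
- by rewrite !G00.
- rewrite !Gi0; have := val (m.+1, 0); case: eqP => [E|_] /=; last by lia.
  by rewrite far -?E /=; lia.
- rewrite !G0j; have := val (0, n.+1); have := IHn 0; case: eqP => [E|_] /=; last by lia.
  by rewrite far -?E /=; lia.
rewrite !GSS; have := val (m.+1, n.+1); have := IHn m; have := IHn m.+1; move: IHm.
case: eqP => [E|_] /=; last by lia.
by rewrite !far -?E /=; lia.
Qed.

Lemma upd_le x c (b b' : bool) v : b <= b' -> upd x c b v <= upd x c b' v.
Proof. by move=> bb; rewrite /upd; case: eqP. Qed.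

Lemma through_delta x k m n : 0 < k ->
  G (upd x (k, 0) false) m n < G (upd x (k, 0) true) m n ->
  through k (upd x (k, 0) true) m n.
Proof.
move=> k0 lt; apply: through_ge.
have := @cut_or_kill k (upd x (k, 0) true) m n k0.
have : G (kill k (upd x (k, 0) true)) m n <= G (upd x (k, 0) false) m n.
  apply: G_mono => v; rewrite /kill /upd; case: eqP => [->|_]; first by rewrite /= leqnn.
  by case: (x v) => //=; case: (~~ _).
by lia.
Qed.

Lemma G_upd_axis x i k b : 0 < i ->
  G (upd x (i, 0) b) k 0 + (i <= k) * ~~ b = G (upd x (i, 0) true) k 0.
Proof.
move=> i0; elim: k => [|k IH]; first by rewrite !G00; lia.
rewrite !Gi0 -IH {IH}; move: (G _ k 0) => g0.
rewrite /upd !xpair_eqE !andbT; case: (eqVneq k.+1 i) => [<-|ne].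
  by rewrite leqnn ltnn; case: b => /=; lia.
have -> : (i <= k.+1) = (i <= k) by lia.
by rewrite -!addnA; congr addn; rewrite addnC.
Qed.

(** If G does not change, [cut k] is squeezed between equal values. If it does, (i, 0) lies on a
    maximal path; this settles k <= i, and for i < k the value of [cut k] gains 1, which is the most
    that G can gain. *)
Lemma through_hor x i k m n : 0 < i -> k <= m ->
  through k (upd x (i, 0) false) m n -> through k (upd x (i, 0) true) m n.
Proof.
move=> i0 km T0; have le v := @upd_le x (i, 0) false true v isT.
have := G_mono m n le; rewrite leq_eqVlt => /orP[/eqP E|lt].
  apply: through_ge; rewrite -E -(eqP T0); apply: G_mono => v.
  by have := le v; rewrite /cut; case: (_ || _); rewrite ?andbT ?andbF.
have Ti := through_delta i0 lt.
have [ki|ik] := leqP k i; first exact: through_le Ti.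
apply: through_ge; have := G_upd x (i, 0) m n; rewrite -(eqP T0).
have := @cut_gain k (upd x (i, 0) false) (upd x (i, 0) true) m n.
have := @G_upd_axis x i k false i0; rewrite (ltnW ik) /=.
move=> h1 /(_ (fun a _ => le (a, 0))) h2 h3.
suff : forall a b, k < a -> 0 < b -> upd x (i, 0) false (a, b) = upd x (i, 0) true (a, b).
  by move=> /h2 /(_ km); lia.
by move=> a b _ b0; rewrite /upd xpair_eqE (gtn_eqF b0) andbF.
Qed.

(** [cut k] does not see the vertical axis, so lowering a weight there only weakens the
    competitors. *)
Lemma through_vert x j k m n :
  through k (upd x (0, j.+1) true) m n -> through k (upd x (0, j.+1) false) m n.
Proof.
move=> /eqP T; apply: through_ge.
have -> : cut k (upd x (0, j.+1) false) = cut k (upd x (0, j.+1) true).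
  by apply/funext => v; rewrite /cut /upd; case: eqP => [->|] //=; rewrite ltn0.
by rewrite T; apply: G_mono => v; apply: upd_le.
Qed.

Lemma through_supported k m n a b : m <= a -> n <= b ->
  supported (rect a b) (fun x => through k x m n).
Proof.
move=> ma nb x y xy; rewrite /through (G_supported ma nb xy).
congr (_ == _); apply: (G_supported ma nb) => v /xy; by rewrite /cut => ->.
Qed.

(** The comparison principle behind the sandwich of increments: the cell recursion carries larger
    horizontal and smaller vertical increments from the south and west sides to the north and east
    sides. *)
Lemma G_incr_mono x y i j : (forall a, 0 < a -> x (a, 0) <= y (a, 0)) ->
  (forall b, 0 < b -> y (0, b) <= x (0, b)) ->
  (forall a b, 0 < a -> 0 < b -> x (a, b) = y (a, b)) ->
  G x i.+1 j + G y i j <= G y i.+1 j + G x i j /\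
  G y i j.+1 + G x i j <= G x i j.+1 + G y i j.
Proof.
move=> hor ver bulk; elim: j i => [|j IHj]; elim=> [|i IHi].
- by rewrite !Gi0 !G0j; have := hor 1 isT; have := ver 1 isT; rewrite !G00; lia.
- move: IHi; have := hor i.+2 isT; have := hor i.+1 isT; rewrite !GSS !Gi0 (bulk i.+1 1) //; lia.
- have := IHj 0; have := ver j.+2 isT; have := ver j.+1 isT; rewrite !GSS !G0j (bulk 1 j.+1) //; lia.
- have := IHj i.+1; move: IHi; rewrite [G x i.+2 j.+1]GSS [G y i.+2 j.+1]GSS.
  by rewrite [G x i.+1 j.+2]GSS [G y i.+1 j.+2]GSS (bulk i.+2 j.+1) // (bulk i.+1 j.+2) //; lia.
Qed.

(* If the maximal paths avoid the vertical axis then increments dominate those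
   of the environment without boundary weights, and this persists to the right
   and below. *)
Lemma cut0_right x m m' n : m <= m' -> G x m n = G (cut 0 x) m n ->
  G x m' n = G (cut 0 x) m' n.
Proof.
move=> mm; rewrite -(subnKC mm); elim: (m' - m) => [|k IH] E; first by rewrite addn0.
rewrite addnS; apply/eqP; rewrite eqn_leq G_cut_le andbT.
have [] := @G_incr_mono x (cut 0 x) (m + k) n.
- by move=> a _; rewrite cutE /= andbT.
- by move=> b _; exact: cut_le.
- by move=> a b a0 b0; rewrite cutE a0 orbT andbT.
- by rewrite -(IH E); lia.
Qed.

Definition bulk x : config := fun v => [&& 0 < v.1, 0 < v.2 & x v].

Lemma bulk_cut0 x m n :
  (G (bulk x) m.+1 n + G (cut 0 x) m n <= G (cut 0 x) m.+1 n + G (bulk x) m n) /\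
  (G (cut 0 x) m n.+1 + G (bulk x) m n <= G (bulk x) m n.+1 + G (cut 0 x) m n).
Proof.
apply: G_incr_mono => [a _|b b0|a b a0 b0]; first by rewrite /bulk /= andbF.
  by rewrite cutE (gtn_eqF b0) andbF.
by rewrite cutE /bulk /= a0 b0 orbT andbT.
Qed.

(** After transposition [kill 1] erases the whole vertical axis, as [cut 0] does. *)
Lemma not_through_vert x m n : ~~ through 1 (swapc x) n m ->
  G x m n = G (cut 0 x) m n.
Proof.
move=> T; apply/eqP; rewrite eqn_leq G_cut_le andbT.
have := @cut_or_kill 1 (swapc x) n m isT.
have /leq_trans := G_cut_le 1 (swapc x) n m.
have -> : G (kill 1 (swapc x)) n m = G (cut 0 x) m n.
  rewrite -(G_swap (cut 0 x)); apply: eq_G => i j _ _ ij.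
  rewrite killE /swapc cutE /=; case: (x _) => //=.
  by case: i ij => [|i]; case: j.
move: T; rewrite /through => T _.
have := G_cut_le 1 (swapc x) n m; rewrite leq_eqVlt (negbTE T) /= G_swap; lia.
Qed.

Lemma bulk_incr_right x m m' m'' n : ~~ through 1 (swapc x) n m ->
  m <= m' -> m' <= m'' ->
  G (bulk x) m'' n + G x m' n <= G x m'' n + G (bulk x) m' n.
Proof.
move=> T mm mm'; have E k : m <= k -> G x k n = G (cut 0 x) k n.
  by move=> mk; apply: cut0_right mk (not_through_vert T).
rewrite -(subnKC mm'); elim: (m'' - m') => [|k IH]; first by rewrite addn0 addnC.
rewrite addnS; have := (bulk_cut0 x (m' + k) n).1.
by move: IH; rewrite !E //; lia.
Qed.

Lemma bulk_incr_up x m0 m l n : ~~ through 1 (swapc x) n m0 -> m0 <= m ->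
  l <= n -> G x m n + G (bulk x) m l <= G (bulk x) m n + G x m l.
Proof.
move=> /not_through_vert E mm ln; rewrite (cut0_right mm E).
apply: (@leq_trans (G (bulk x) m n + G (cut 0 x) m l)); last first.
  by rewrite leq_add2l G_cut_le.
rewrite -(subnKC ln); elim: (n - l) => [|k IH]; first by rewrite addn0 addnC.
rewrite addnS; have := (bulk_cut0 x m (l + k)).2; lia.
Qed.

Lemma swapc_bulk x : swapc (bulk x) = bulk (swapc x).
Proof. by apply/funext => -[i j]; rewrite /swapc /bulk /= andbCA. Qed.

(** The transpose of [bulk_incr_up]: avoiding the horizontal axis bounds horizontal bulk increments
    from below. *)
Lemma bulk_incr_left x m l n : ~~ through 1 x m n -> l <= m ->
  G x m n + G (bulk x) l n <= G (bulk x) m n + G x l n.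
Proof.
move=> T lm; rewrite -!(G_swap x) -!(G_swap (bulk x)) swapc_bulk.
by apply: bulk_incr_up (leqnn n) lm; rewrite swapcK.
Qed.

(** The axes keep their weights: a path is a stretch on an axis followed by a stretch in the bulk,
    and only the latter is read backwards. *)
Definition rev m n x : config := fun v =>
  if [&& 0 < v.1, 0 < v.2, v.1 <= m & v.2 <= n]
  then x (m.+1 - v.1, n.+1 - v.2) else x v.

Lemma revK m n x : rev m n (rev m n x) = x.
Proof.
apply/funext => -[i j]; rewrite /rev /=; case: ifP => ij; last by rewrite ij.
have -> : [&& 0 < m.+1 - i, 0 < n.+1 - j, m.+1 - i <= m & n.+1 - j <= n] by lia.
by congr (x (_, _)); lia.
Qed.

Lemma G_bulk_i0 x i : G (bulk x) i 0 = 0.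
Proof. by elim: i => [|i IH]; rewrite ?G00 // Gi0 IH. Qed.

Lemma G_bulk_0j x j : G (bulk x) 0 j = 0.
Proof. by elim: j => [|j IH]; rewrite ?G00 // G0j IH. Qed.

(* [G (bulk (rev m n x)) a b] is the last passage time of the bulk from
   (m - a, n - b) to (m, n). *)
Lemma G_concat x m n a b : a <= m -> b <= n ->
  G x (m - a) (n - b) + G (bulk (rev m n x)) a b <= G x m n.
Proof.
elim: b a => [|b IHb] a am bn.
  by rewrite G_bulk_i0 addn0; apply: G_le; lia.
elim: a am => [|a IHa] am.
  by rewrite G_bulk_0j addn0; apply: G_le; lia.
have h1 := IHb a.+1 am (ltnW bn); have h2 := IHa (ltnW am).
have h3 := IHb a (ltnW am) (ltnW bn).
have e1 : G x (m - a.+1) (n - b.+1) <= G x (m - a) (n - b.+1) by apply: G_le; lia.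
have e2 : G x (m - a.+1) (n - b.+1) <= G x (m - a.+1) (n - b) by apply: G_le; lia.
have e3 : G x (m - a.+1) (n - b.+1) + x (m - a, n - b) <= G x (m - a) (n - b).
  have -> : m - a = (m - a.+1).+1 by lia.
  have -> : n - b = (n - b.+1).+1 by lia.
  by rewrite GSS; lia.
have -> : G (bulk (rev m n x)) a.+1 b.+1 =
    maxn (maxn (G (bulk (rev m n x)) a b.+1) (G (bulk (rev m n x)) a.+1 b))
      (G (bulk (rev m n x)) a b + x (m - a, n - b)).
  rewrite GSS; congr (maxn _ (_ + nat_of_bool _)).
  by rewrite /bulk /rev /= am bn !subSS.
by lia.
Qed.

(** Backtracking: the splitting point moves to a predecessor that attains the maximum in [GSS] until
    it meets an axis. Coordinates only decrease, whence z <= i or z <= j. *)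
Lemma exit_point x m n i j (im : i <= m) (jn : j <= n)
    (H : G x m n <= G x i j + G (bulk (rev m n x)) (m - i) (n - j)) :
  exists z, (z <= i /\ G x m n <= G x z 0 + G (bulk (rev m n x)) (m - z) n) \/
    (z <= j /\ G x m n <= G x 0 z + G (bulk (rev m n x)) m (n - z)).
Proof.
move: im jn H; set K := bulk _.
elim: j i => [|j IHj]; elim=> [|i IHi] im jn H.
- by exists 0; left; move: H; rewrite !subn0.
- by exists i.+1; left; move: H; rewrite subn0.
- by exists j.+1; right; move: H; rewrite subn0.
have KE : G K (m - i) (n - j) = maxn (maxn (G K (m - i.+1) (n - j))
    (G K (m - i) (n - j.+1))) (G K (m - i.+1) (n - j.+1) + x (i.+1, j.+1)).
  have -> : m - i = (m - i.+1).+1 by lia.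
  have -> : n - j = (n - j.+1).+1 by lia.
  rewrite GSS; congr (maxn _ (_ + nat_of_bool _)).
  rewrite /K /bulk /rev /=.
  have -> : (m - i.+1 < m) && (n - j.+1 < n) by lia.
  by congr (x (_, _)); lia.
have k1 : G K (m - i.+1) (n - j.+1) <= G K (m - i) (n - j.+1) by apply: G_le; lia.
have k2 : G K (m - i.+1) (n - j.+1) <= G K (m - i.+1) (n - j) by apply: G_le; lia.
rewrite [G x i.+1 j.+1]GSS in H.
have [h|[h|h]] : G x m n <= G x i j.+1 + G K (m - i) (n - j.+1) \/
  G x m n <= G x i.+1 j + G K (m - i.+1) (n - j) \/
  G x m n <= G x i j + G K (m - i) (n - j) by lia.
- by have [z [] [z1 z2]] := IHi (ltnW im) jn h; exists z; [left|right]; split=> //; lia.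
- by have [z [] [z1 z2]] := IHj i.+1 im (ltnW jn) h; exists z; [left|right]; split=> //; lia.
- by have [z [] [z1 z2]] := IHj i (ltnW im) (ltnW jn) h; exists z; [left|right]; split=> //; lia.
Qed.

End LastPassage.

(** * Chains of optimal steps *)

Section MaximalPaths.

Local Open Scope nat_scope.

(** An optimal step realises the increment of G, so a chain of such steps is a piece of a maximal
    path. The estimates are proved for arbitrary chains, and [rightmost_oreach] transfers them to
    the right-most path. *)
Inductive ostep x : site -> site -> Prop :=
| OstepH i j : G x i.+1 j = G x i j + (j == 0) * x (i.+1, j) ->
    ostep x (i, j) (i.+1, j)
| OstepV i j : G x i j.+1 = G x i j + (i == 0) * x (i, j.+1) ->
    ostep x (i, j) (i, j.+1)
| OstepD i j : G x i.+1 j.+1 = G x i j + x (i.+1, j.+1) ->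
    ostep x (i, j) (i.+1, j.+1).

Inductive oreach x (q : site) : site -> Prop :=
| OreachRefl : oreach x q q
| OreachStep u v : oreach x q u -> ostep x u v -> oreach x q v.

Lemma back_step_ostep x (v : site) : v != origin ->
  ostep x (back_step (fun a b => x (a, b)) v) v.
Proof.
move=> v0; have [] := back_stepP (fun a b => x (a, b)) v0.
case: (back_step _ v) => i j {v0}; case: v => a b; rewrite /admissible_step !inE.
move=> /or3P[]/eqP[-> ->] E.
- constructor; rewrite /G E; congr addn; rewrite /step_weight /=.
  by case: j {E} => [|j] /=; rewrite ?mul1n // mul0n; case: ifP => //; rewrite xpair_eqE /=; lia.
- constructor; rewrite /G E; congr addn; rewrite /step_weight /=.
  rewrite andbF /=; case: i {E} => [|i] /=; rewrite ?mul1n // mul0n.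
  by case: ifP => //; rewrite xpair_eqE /=; lia.
- by constructor; rewrite /G E /step_weight /= !eqxx !orbT.
Qed.

Lemma rightmost_oreach x q v :
  q \in rightmost_path (fun a b => x (a, b)) v -> oreach x q v.
Proof.
have [K vK] := ubnP (v.1 + v.2); elim: K v vK => // K IH v vK.
have [->|v0] := eqVneq v origin; first by rewrite inE => /eqP ->; left.
rewrite rightmost_pathE // mem_rcons inE => /orP[/eqP ->|qb]; first by left.
apply: (OreachStep _ (back_step_ostep x v0)); apply: IH qb.
by have := back_step_lt (fun a b => x (a, b)) v0; lia.
Qed.

Lemma oreach_le x q v : oreach x q v -> q.1 <= v.1 /\ q.2 <= v.2.
Proof.
elim=> // u w _ [h1 h2] st; move: h1 h2.
by case: st => i j _ /=; lia.
Qed.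

Lemma oreach_col x q v i : oreach x q v -> q.1 <= i <= v.1 ->
  exists j, oreach x q (i, j) /\ oreach x (i, j) v.
Proof.
elim=> [|u w qu IH uw] /andP[qi iv].
  have -> : i = q.1 by lia.
  by exists q.2; rewrite -surjective_pairing; split; left.
have [iu|ui] := leqP i u.1.
  have [|j [h1 h2]] := IH; first by rewrite qi.
  by exists j; split=> //; apply: OreachStep h2 uw.
have -> : i = w.1 by move: ui iv; case: uw => a b _ /=; lia.
exists w.2; rewrite -surjective_pairing; split; last by left.
exact: OreachStep qu uw.
Qed.

Definition swap (v : site) : site := (v.2, v.1).

Lemma oreach_swap x q v : oreach x q v -> oreach (swapc x) (swap q) (swap v).
Proof.
elim=> [|u w _ IH st]; first by left.
apply: OreachStep IH _; case: st => i j E.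
- by constructor; rewrite !G_swap E.
- by constructor; rewrite !G_swap E.
- by constructor; rewrite !G_swap E.
Qed.

Lemma oreach_row x q v j : oreach x q v -> q.2 <= j <= v.2 ->
  exists i, oreach x q (i, j) /\ oreach x (i, j) v.
Proof.
move=> /oreach_swap r h; have [i [h1 h2]] := oreach_col r h.
exists i; have := oreach_swap h1; have := oreach_swap h2.
by rewrite swapcK /swap /= -!surjective_pairing.
Qed.

(** Optimality depends only on differences of G, which [G_shift] preserves; on the new axes the
    boundary weight is that difference itself. *)
Lemma oreach_shift x i0 j0 k l v : oreach x (i0 + k, j0 + l) v ->
  oreach (shift i0 j0 x) (k, l) (v.1 - i0, v.2 - j0).
Proof.
have le u : oreach x (i0 + k, j0 + l) u -> i0 <= u.1 /\ j0 <= u.2.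
  by move=> /oreach_le /=; lia.
elim=> [|u w qu IH st] /=; first by rewrite !addKn; left.
have [lu1 lu2] := le _ qu.
apply: OreachStep IH _; case: st lu1 lu2 => i j /= E iu ju.
- have -> : i.+1 - i0 = (i - i0).+1 by lia.
  have h1 := G_shift i0 j0 x (i - i0) (j - j0).
  have h2 := G_shift i0 j0 x (i - i0).+1 (j - j0).
  constructor; move: h1 h2; rewrite addnS !subnKC // E.
  case: (j - j0) (subnKC ju) => [|l'] jE; first by rewrite mul1n Gi0; lia.
  have -> : (j == 0) = false by lia.
  by rewrite !mul0n; lia.
- have -> : j.+1 - j0 = (j - j0).+1 by lia.
  have h1 := G_shift i0 j0 x (i - i0) (j - j0).
  have h2 := G_shift i0 j0 x (i - i0) (j - j0).+1.
  constructor; move: h1 h2; rewrite addnS !subnKC // E.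
  case: (i - i0) (subnKC iu) => [|l'] jE; first by rewrite mul1n G0j; lia.
  have -> : (i == 0) = false by lia.
  by rewrite !mul0n; lia.
- have -> : i.+1 - i0 = (i - i0).+1 by lia.
  have -> : j.+1 - j0 = (j - j0).+1 by lia.
  have h1 := G_shift i0 j0 x (i - i0) (j - j0).
  have h2 := G_shift i0 j0 x (i - i0).+1 (j - j0).+1.
  constructor; move: h1 h2; rewrite /= !addnS !subnKC // E; lia.
Qed.

(** The inequality G x <= G (cut k x) propagates along optimal steps, which stay in the columns from
    k on. *)
Lemma oreach_through x k m n : 0 < k -> oreach x (k, 0) (m, n) -> through k x m n.
Proof.
move=> k0 r; apply: through_ge.
suff : k <= m /\ G x m n <= G (cut k x) m n by case.
have -> : (m = (m, n).1)%type by []; have -> : (n = (m, n).2)%type by [].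
elim: r => [|u v _ IH st] /=; first by rewrite G_cut_axis.
case: st IH => i j E /= [ki le].
- split; first by lia.
  rewrite E; case: j {E} le => [|j] le /=.
    by rewrite Gi0 cutE mul1n andbT; lia.
  by rewrite mul0n addn0; apply: leq_trans le (G_right1 _ _ _).
- split=> //; rewrite E; have -> : (i == 0) = false by lia.
  by rewrite mul0n addn0; apply: leq_trans le (G_up1 _ _ _).
- split; first by lia.
  by rewrite E GSS cutE /= ltnS ki andbT; lia.
Qed.

(* Once a maximal path has left the axes, the rest of it only collects bulk
   weights. *)
Lemma oreach_bulk x q m n : 0 < q.1 -> 0 < q.2 -> oreach x q (m, n) ->
  G x m n <= G x q.1 q.2 + G (bulk (rev m n x)) (m - q.1) (n - q.2).
Proof.
move=> q1 q2; set K := bulk _.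
have H v : oreach x q v -> v.1 <= m -> v.2 <= n ->
    G x m n <= G x v.1 v.2 + G K (m - v.1) (n - v.2) ->
    G x m n <= G x q.1 q.2 + G K (m - q.1) (n - q.2).
  elim=> // u w qu IH st; have [/=] := oreach_le qu.
  case: st IH => i j E /= IH i1 j1 im jn h.
  - apply: IH; [lia|lia|]; move: h; rewrite E.
    have -> : (j == 0) = false by lia.
    have : G K (m - i.+1) (n - j) <= G K (m - i) (n - j) by apply: G_le; lia.
    by rewrite mul0n; lia.
  - apply: IH; [lia|lia|]; move: h; rewrite E.
    have -> : (i == 0) = false by lia.
    have : G K (m - i) (n - j.+1) <= G K (m - i) (n - j) by apply: G_le; lia.
    by rewrite mul0n; lia.
  apply: IH; [lia|lia|]; move: h; rewrite E.
  have -> : m - i = (m - i.+1).+1 by lia.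
  have -> : n - j = (n - j.+1).+1 by lia.
  rewrite GSS; have -> : K ((m - i.+1).+1, (n - j.+1).+1) = x (i.+1, j.+1).
    rewrite /K /bulk /rev /=.
    have -> : (m - i.+1 < m) && (n - j.+1 < n) by lia.
    by congr (x (_, _)); lia.
  by lia.
by move=> /H; apply => //=; rewrite !subnn; lia.
Qed.

End MaximalPaths.

(** * Burke property *)

Section Burke.
Variables (R : realFieldType) (p : R).
Implicit Types (a b : R).

Definition wprob a b (v : site) : R :=
  if v.2 == 0%N then a else if v.1 == 0%N then b else p.

Definition expect a b m n (f : config -> R) : R := Ex (wprob a b) (rect m n) f.

Definition stationary_pair a b : Prop := a * b = p * (1 - a) * (1 - b).

(* The update of the increments (I, J) on the south and west sides of the cell
   (1, l) into those on its north and east sides. *)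
Definition burke l x : config :=
  let g := [|| x (1, 0), x (0, l) | x (1, l)]%N in
  upd (upd x (0, l)%N (g && ~~ x (1, 0)%N)) (1, 0)%N (g && ~~ x (0, l)%N).

(** The update fixes the pairs (1, 0) and (0, 1), sends (1, 1) to (0, 0), and sends (0, 0) to (1, 1)
    exactly when the bulk weight is 1. Invariance of the product law thus amounts to a b = p (1 - a)
    (1 - b). *)
Lemma Ex_burke a b s l (f : config -> R) : stationary_pair a b -> (0 < l)%N ->
  {subset [:: (1, 0); (0, l); (1, l)]%N <= s} ->
  (forall x c, f (upd x (1, l)%N c) = f x) ->
  Ex (wprob a b) s (fun x => f (burke l x)) = Ex (wprob a b) s f.
Proof.
case: l => // l st _ ss fc; set h := (1, 0)%N in ss *.
set v := (0, l.+1)%N in ss *; set c := (1, l.+1)%N in ss fc *.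
have hs : h \in s by apply: ss; rewrite !inE eqxx.
have vs : v \in s by apply: ss; rewrite !inE eqxx !orbT.
have cs : c \in s by apply: ss; rewrite !inE eqxx !orbT.
pose F e d := Ex (wprob a b) s (fun x => f (upd (upd x v d) h e)).
have qh : wprob a b h = a by [].
have qv : wprob a b v = b by [].
have qc : wprob a b c = p by [].
have bE i j w : Ex (wprob a b) s (fun x => f (burke l.+1 (upd (upd (upd x v j) h i) c w))) =
    F ([|| i, j | w] && ~~ j) ([|| i, j | w] && ~~ i).
  apply: eq_Ex => x; rewrite -[RHS](fc _ w); congr f.
  have hv : (h == v) = false by [].
  have hc : (h == c) = false by [].
  have vc : (v == c) = false by [].
  apply/funext => u; rewrite /burke -/h -/v -/c /upd !eqxx.
  rewrite ![v == h]eq_sym hv hc vc.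
  have nhc : ~~ ((u == h) && (u == c)).
    by apply/negP => /andP[/eqP -> /eqP hc']; rewrite hc' eqxx in hc.
  have nhv : ~~ ((u == h) && (u == v)).
    by apply/negP => /andP[/eqP -> /eqP hv']; rewrite hv' eqxx in hv.
  have nvc : ~~ ((u == v) && (u == c)).
    by apply/negP => /andP[/eqP -> /eqP vc']; rewrite vc' eqxx in vc.
  by move: nhc nhv nvc; case: (u == h); case: (u == c); case: (u == v).
rewrite (Ex_split _ _ cs) !(Ex_split _ (fun x => f (burke _ (upd x c _))) hs).
rewrite !(Ex_split _ (fun x => f (burke _ (upd (upd x h _) c _))) vs) qc qh qv !bE.
rewrite [RHS](Ex_split _ _ hs) !(Ex_split _ (fun x => f (upd x h _)) vs) qh qv.
rewrite -!/(F _ _) /=; apply/eqP; rewrite -subr_eq0; apply/eqP.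
transitivity ((p * (1 - a) * (1 - b) - a * b) * (F true true - F false false)).
  by ring.
by rewrite st subrr mul0r.
Qed.

(** The cells of column 1 are processed upwards in place: (1, 0) carries the current horizontal
    increment and (0, j) receives the vertical increment along column 1. *)
Fixpoint sweep l x : config := if l is l'.+1 then burke l (sweep l' x) else x.

Lemma sweepE l x :
  [/\ forall j, (0 < j)%N -> sweep l x (0, j)%N =
        if (j <= l)%N then G x 1 j != G x 1 j.-1 else x (0, j)%N,
      sweep l x (1, 0)%N = (G x 1 l != G x 0 l) &
      forall v, v != (1, 0)%N -> (0 < v.1)%N || (v.2 == 0)%N -> sweep l x v = x v].
Proof.
elim: l => [|l [IHv IHh IHr]] /=.
  split=> // [[|j]//|]; rewrite Gi0 G00.
  by case: (x _).
have w : sweep l x (1, l.+1)%N = x (1, l.+1)%N by apply: IHr.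
have j : sweep l x (0, l.+1)%N = x (0, l.+1)%N by rewrite IHv // ltnn.
have := G_incr1 x 0 l; have := G_right1 x 0 l => Gr [Gi _].
split.
- move=> [|k] // _; rewrite /burke /upd xpair_eqE /=.
  rewrite (_ : ((0, k.+1) == (0, l.+1))%N = (k.+1 == l.+1)) //.
  have [[->]|ne] := eqVneq k.+1 l.+1.
    rewrite leqnn w j IHh /= GSS G0j.
    case: (x _); case: (x _); case: eqP => h1; case: eqP => h2 //=; exfalso; lia.
  by rewrite IHv // (_ : (k < l.+1)%N = (k < l)%N) //; lia.
- rewrite /burke /upd eqxx w j IHh GSS G0j.
  by case: (x _); case: (x _); case: eqP => h1; case: eqP => h2 //=; exfalso; lia.
- move=> v v1 v2; rewrite /burke /upd (negbTE v1).
  case: eqP => [E|_]; last exact: IHr.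
  by move: v2; rewrite E.
Qed.

Lemma burke_upd l x j c : (0 < j)%N -> j != l ->
  burke l (upd x (1, j)%N c) = upd (burke l x) (1, j)%N c.
Proof.
move=> j0 jl; apply/funext => v.
have e1 : ((1, 0) == (1, j))%N = false by case: j j0 jl.
have e2 : ((0, l) == (1, j))%N = false by [].
have e3 : ((1, l) == (1, j))%N = false by rewrite xpair_eqE eqxx eq_sym (negbTE jl).
rewrite /burke /upd e1 e2 e3.
case E: (v == (1, j)%N) => //; rewrite (eqP E).
by rewrite ![(1, j)%N == _]eq_sym e1 e2.
Qed.

Lemma Ex_sweep a b m n l (f : config -> R) : stationary_pair a b -> (0 < m)%N ->
  (l <= n)%N ->
  (forall x j c, (0 < j)%N -> (j <= l)%N -> f (upd x (1, j)%N c) = f x) ->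
  Ex (wprob a b) (rect m n) (fun x => f (sweep l x)) =
  Ex (wprob a b) (rect m n) f.
Proof.
move=> st m0; elim: l f => [|l IH] f ln fc //=.
rewrite (IH (fun x => f (burke l.+1 x))) ?(ltnW ln) //.
  apply: Ex_burke => //; last by move=> x c; apply: fc.
  by move=> v; rewrite !inE => /or3P[]/eqP->; rewrite mem_rect /=; lia.
move=> x j c j0 jl; rewrite burke_upd //; last by rewrite neq_ltn ltnS jl.
by rewrite fc // (leq_trans jl).
Qed.

Definition skip_col (v : site) : site := ((v.1 + (0 < v.1))%N, v.2).

Lemma skip_col_inj : injective skip_col.
Proof. by move=> [i j] [k l] [] /=; case: i; case: k => //= *; congr pair; lia. Qed.

(** After the sweep the vertical axis holds the increments along column 1. The bulk weights of that
    column are used up, and [skip_col] lets column i + 1 act as column i. *)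
Lemma expect_shift_col a b m n f : stationary_pair a b -> supported (rect m n) f ->
  expect a b m.+1 n (fun x => f (shift 1 0 x)) = expect a b m n f.
Proof.
move=> st fs; pose f' x := f (x \o skip_col).
have fE x : f (shift 1 0 x) = f' (sweep n x).
  apply: fs => -[i j]; rewrite mem_rect /= => ij.
  have [sv sh sr] := sweepE n x; rewrite /skip_col /=.
  case: i j ij => [|i] [|j] ij //=.
  - rewrite sv // add0n; have -> /= : (j < n)%N by lia.
    by rewrite ?addn1.
  - rewrite sr ?orbT ?xpair_eqE //; last by rewrite addn1.
    rewrite !add1n Gi0 addn1.
    by case: (x _); rewrite ?addn0 ?eqxx //; case: eqP => //; lia.
  - by rewrite sr // addn1.
rewrite /expect (eq_Ex _ _ fE) Ex_sweep //; last first.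
  move=> x j c j0 jl; congr f; apply/funext => -[[|i] k] //=.
  by rewrite /upd /skip_col /= xpair_eqE /= addn1.
have sub : {subset map skip_col (rect m n) <= rect m.+1 n}.
  by move=> v /mapP[[i j]]; rewrite !mem_rect /= => ij ->; rewrite /skip_col /=; lia.
rewrite (Ex_supported _ sub); last first.
  by move=> x y xy; apply: fs => v vr /=; apply: xy; apply: map_f.
rewrite (Ex_map _ _ _ skip_col_inj); apply: eq_Ex_param => -[[|i] [|j]] //.
Qed.

Lemma expect_swap a b m n f : supported (rect n m) f ->
  expect a b m n (fun x => f (swapc x)) = expect b a n m f.
Proof.
move=> fs; pose sw (v : site) : site := (v.2, v.1).
have swi : injective sw by move=> [i j] [k l] [-> ->].
have sub : {subset map sw (rect n m) <= rect m n}.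
  by move=> v /mapP[[i j]]; rewrite !mem_rect /= => ij ->; rewrite /sw /=; lia.
rewrite /expect (Ex_supported _ sub); last first.
  by move=> x y xy; apply: fs => v vr; apply: xy; apply: (map_f sw vr).
rewrite (Ex_map _ _ _ swi); apply: eq_Ex_param => -[[|i] [|j]] //.
by rewrite mem_rect.
Qed.

Lemma supported_swap m n (T : Type) (f : config -> T) :
  supported (rect m n) f -> supported (rect n m) (fun x => f (swapc x)).
Proof.
move=> fs x y xy; apply: fs => -[i j]; rewrite mem_rect /= => ij.
by apply: xy; rewrite mem_rect /=; lia.
Qed.

Lemma supported_shift i0 j0 m n (T : Type) (f : config -> T) :
  supported (rect m n) f ->
  supported (rect (i0 + m) (j0 + n)) (fun x => f (shift i0 j0 x)).
Proof. by move=> fs x y xy; apply: fs; apply: eq_shift. Qed.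

Lemma stationaryC a b : stationary_pair a b -> stationary_pair b a.
Proof. by rewrite /stationary_pair => H; rewrite mulrC H; ring. Qed.

Lemma expect_shift_row a b m n f : stationary_pair a b -> supported (rect m n) f ->
  expect a b m n.+1 (fun x => f (shift 0 1 x)) = expect a b m n f.
Proof.
move=> st fs.
pose h x := f (swapc x).
have hs : supported (rect n m) h by apply: supported_swap.
have -> : (fun x => f (shift 0 1 x)) = (fun x => (fun y => h (shift 1 0 y)) (swapc x)).
  by apply/funext => x; rewrite /h swapc_shift swapcK.
rewrite (@expect_swap a b m n.+1 (fun y => h (shift 1 0 y))); last exact: (@supported_shift 1 0 n m).
rewrite expect_shift_col //; last exact: stationaryC.
rewrite -(@expect_swap a b m n h) //; congr expect; apply/funext => x.
by rewrite /h swapcK.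
Qed.

Lemma expect_shift a b i0 j0 m n f : stationary_pair a b -> supported (rect m n) f ->
  expect a b (i0 + m) (j0 + n) (fun x => f (shift i0 j0 x)) = expect a b m n f.
Proof.
move=> st fs; elim: j0 => [|j0 IH].
  elim: i0 => [|i0 IH].
    apply: eq_Ex => x; apply: fs => -[[|i] [|j]]; rewrite mem_rect //= ?add0n => _.
    - by rewrite G0j; case: (x _); rewrite ?addn0 ?eqxx //; case: eqP => //; lia.
    - by rewrite Gi0; case: (x _); rewrite ?addn0 ?eqxx //; case: eqP => //; lia.
  have -> : (fun x => f (shift i0.+1 0 x)) =
      (fun x => (fun y => f (shift i0 0 y)) (shift 1 0 x)).
    by apply/funext => x; rewrite shift_shift.
  by rewrite addSn (@expect_shift_col a b _ _ (fun y => f (shift i0 0 y))) //; exact: supported_shift.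
have -> : (fun x => f (shift i0 j0.+1 x)) =
    (fun x => (fun y => f (shift i0 j0 y)) (shift 0 1 x)).
  by apply/funext => x; rewrite shift_shift.
by rewrite addSn (@expect_shift_row a b _ _ (fun y => f (shift i0 j0 y))) //; exact: supported_shift.
Qed.

End Burke.

(** * Variance of the last passage time *)

Section Variance.
Variables (R : realFieldType) (p : R).
Hypothesis hp : 0 < p < 1.
Implicit Types (a b : R).

Local Notation E := (expect p).
Local Notation stationary := (stationary_pair p).

Lemma wprob01 a b v : 0 <= a <= 1 -> 0 <= b <= 1 -> 0 <= wprob p a b v <= 1.
Proof.
move=> a01 b01; rewrite /wprob; do !case: ifP => // _.
by case/andP: hp => p0 p1; rewrite !ltW.
Qed.

(** For a stationary pair this is the exact expectation of [G x m n]: the south side contributes m a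
    and, by Burke, the east side n b. *)
Definition mean a b m n : R := m%:R * a + n%:R * b.

Definition G_var a b m n : R := E a b m n (fun x => ((G x m n)%:R - mean a b m n) ^+ 2).

Definition through_prob a b m n k : R := E a b m n (fun x => (through k x m n)%:R).

(* An upper bound for the expected length of the part of the horizontal axis
   that lies on a maximal path. *)
Definition exit_sum a b m n : R := \sum_(1 <= k < m.+1) through_prob a b m n k.

Lemma through_prob_ge0 a b m n k : 0 <= a <= 1 -> 0 <= b <= 1 -> 0 <= through_prob a b m n k.
Proof. by move=> a01 b01; apply: Ex_ge0 => // i; apply: wprob01. Qed.

Lemma through_prob_le1 a b m n k : 0 <= a <= 1 -> 0 <= b <= 1 -> through_prob a b m n k <= 1.
Proof.
move=> a01 b01; rewrite -[leRHS](Ex_cst (wprob p a b) (rect m n) 1).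
by apply: le_Ex => [i|x]; [apply: wprob01 | case: through].
Qed.

Lemma axis_var a b m n k : (k <= m)%N ->
  E a b m n (fun x => ((G x k 0)%:R - k%:R * a) ^+ 2) = k%:R * (a * (1 - a)).
Proof.
elim: k => [|k IH] km.
  rewrite [RHS]mul0r -[RHS](Ex_cst (wprob p a b) (rect m n) 0).
  by apply: eq_Ex => x; rewrite G00; ring.
rewrite /expect (@Ex_split _ _ _ _ (k.+1, 0)%N); last by rewrite mem_rect /=; lia.
have e c x : G (upd x (k.+1, 0)%N c) k.+1 0 = (G x k 0 + c)%N.
  rewrite Gi0 /upd eqxx; congr addn; apply: G_i0_hor => i _ ik.
  by rewrite xpair_eqE eqxx andbT (ltn_eqF (_ : (i < k.+1)%N)).
rewrite -!ExZ -ExD.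
transitivity (Ex (wprob p a b) (rect m n)
    (fun x => ((G x k 0)%:R - k%:R * a) ^+ 2 + a * (1 - a))).
  apply: eq_Ex => x; rewrite !e /wprob /= !natrD -[k.+1]addn1 natrD /=; ring.
rewrite ExD Ex_cst; have := IH (ltnW km); rewrite /expect => ->.
by rewrite -[k.+1]addn1 natrD; ring.
Qed.

Lemma vert_axis_var a b m n l : (l <= n)%N ->
  E a b m n (fun x => ((G x 0 l)%:R - l%:R * b) ^+ 2) = l%:R * (b * (1 - b)).
Proof.
move=> ln; rewrite -(@axis_var b a n m l) //.
rewrite -(@expect_swap _ _ _ _ _ _ (fun x => ((G x l 0)%:R - l%:R * b) ^+ 2)).
  by apply: eq_Ex => x; rewrite G_swap.
by move=> x y xy; rewrite (G_supported ln _ xy).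
Qed.

(** The increments on the east side form the vertical boundary of the environment seen from (m,
    0). *)
Lemma east_var a b m n : stationary a b ->
  E a b m n (fun x => ((G x m n)%:R - (G x m 0)%:R - n%:R * b) ^+ 2) =
  n%:R * (b * (1 - b)).
Proof.
move=> st; rewrite -(@vert_axis_var a b 0 n n) //.
rewrite -(@expect_shift _ _ _ _ m 0 0 n _ st).
  rewrite addn0 add0n; apply: eq_Ex => x; congr ((_ - _) ^+ 2).
  by have := G_shift m 0 x 0 n; rewrite addn0 add0n => <-; rewrite natrD addrK.
by move=> x y xy; rewrite (G_supported (leqnn 0) (leqnn n) xy).
Qed.

(** Averaging over the weight at (k, 0) leaves a (1 - a) (g1 - g0); c cancels. The jump is at most
    1, and by [through_delta] a nonzero jump forces a maximal path through (k, 0). *)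
Lemma cov_le a b m n k c : 0 <= a <= 1 -> 0 <= b <= 1 -> (0 < k)%N -> (k <= m)%N ->
  E a b m n (fun x => ((G x m n)%:R - c) * ((x (k, 0)%N)%:R - a)) <= through_prob a b m n k.
Proof.
move=> a01 b01 k0 km; rewrite /through_prob /expect.
have kr : (k, 0)%N \in rect m n by rewrite mem_rect /=; lia.
rewrite (Ex_split _ _ kr) [leRHS](Ex_split _ _ kr) -!ExZ -!ExD.
apply: le_Ex => [i|x]; first exact: wprob01.
rewrite /wprob /= /upd !eqxx -/(upd x (k, 0)%N _) -/(upd x (k, 0)%N _).
have := G_upd x (k, 0)%N m n; have := G_mono m n (fun v => @upd_le x (k, 0)%N false true v isT).
have := @through_delta x k m n k0.
set g1 := G (upd _ _ true) _ _; set g0 := G (upd _ _ false) _ _.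
case T0 : (through k (upd x (k, 0)%N false) m n);
case T1 : (through k (upd x (k, 0)%N true) m n) => /= D g01 g10.
- have -> : (g1%:R : R) = g0%:R + (g1 - g0)%:R by rewrite -natrD subnKC.
  have : (g1 - g0 <= 1)%N by lia.
  rewrite -(ler_nat R); move: (g1 - g0)%N => d d1; have := ler0n R d; nra.
- have -> : g1 = g0 by apply/eqP; rewrite eqn_leq g01 andbT leqNgt; apply/negP => /D.
  nra.
- have -> : (g1%:R : R) = g0%:R + (g1 - g0)%:R by rewrite -natrD subnKC.
  have : (g1 - g0 <= 1)%N by lia.
  rewrite -(ler_nat R); move: (g1 - g0)%N => d d1; have := ler0n R d; nra.
- have -> : g1 = g0 by apply/eqP; rewrite eqn_leq g01 andbT leqNgt; apply/negP => /D.
  nra.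
Qed.

Lemma G_axis_sum x m : ((G x m 0)%:R : R) = \sum_(1 <= k < m.+1) (x (k, 0)%N)%:R.
Proof.
elim: m => [|m IH]; first by rewrite G00 big_geq.
by rewrite big_nat_recr //= -IH Gi0 natrD.
Qed.

(** Expanding the square of G(m, n) - G(m, 0), centred, gives the variance of G as that of the east
    side minus that of the south side plus twice the covariance of G with the south side. *)
Lemma var_le a b m n : 0 <= a <= 1 -> 0 <= b <= 1 -> stationary a b ->
  G_var a b m n <= n%:R * (b * (1 - b)) - m%:R * (a * (1 - a)) + 2 * exit_sum a b m n.
Proof.
move=> a01 b01 st; rewrite -(east_var m n st) -(@axis_var a b m n m) //.
rewrite /exit_sum big_nat_cond.
have key : 2 * (\sum_(1 <= k < m.+1 | (1 <= k < m.+1)%N && true)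
    E a b m n (fun x => ((G x m n)%:R - mean a b m n) * ((x (k, 0)%N)%:R - a))) <=
  2 * \sum_(1 <= k < m.+1 | (1 <= k < m.+1)%N && true) through_prob a b m n k.
  apply: ler_wpM2l => //; apply: ler_sum => k; rewrite andbT => /andP[k1 km].
  exact: cov_le.
apply: le_trans (lerD (lexx _) key).
rewrite -big_nat_cond /G_var /expect -Ex_sum -ExZ -ExB -ExD.
rewrite le_eqVlt; apply/orP; left; apply/eqP; apply: eq_Ex => x.
rewrite -mulr_sumr big_split /= sumrN -G_axis_sum sumr_const_nat subn1 /=.
by rewrite /mean -[a *+ m]mulr_natl; ring.
Qed.

Lemma G_var_swap a b m n : G_var a b m n = G_var b a n m.
Proof.
rewrite /G_var -(@expect_swap _ _ _ _ _ _ (fun x => ((G x n m)%:R - mean b a n m) ^+ 2)).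
  by apply: eq_Ex => x; rewrite G_swap /mean [m%:R * a + _]addrC.
by move=> x y xy; rewrite (G_supported (leqnn n) (leqnn m) xy).
Qed.

Lemma through_prob_mono a b a' b' m n k : 0 <= a -> a <= a' -> a' <= 1 ->
  0 <= b' -> b' <= b -> b <= 1 -> (k <= m)%N ->
  through_prob a b m n k <= through_prob a' b' m n k.
Proof.
move=> a0 aa a1 b0 bb b1 km; apply: le_Ex_param.
- by move=> i; apply: wprob01; lra.
- by move=> i; apply: wprob01; lra.
- move=> [[|i] [|j]] x; rewrite mem_rect //= => ij.
  + constructor 3; split=> //; rewrite ler_nat.
    case T: (through _ _ _ _) => //; first by rewrite (through_vert T).
  + constructor 2; split=> //; rewrite ler_nat.
    by case T: (through _ _ _ _) => //; rewrite (through_hor _ _ T).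
  + by constructor 1.
- exact: rect_uniq.
Qed.

Lemma exit_sum_mono a b a' b' m n : 0 <= a -> a <= a' -> a' <= 1 ->
  0 <= b' -> b' <= b -> b <= 1 -> exit_sum a b m n <= exit_sum a' b' m n.
Proof.
move=> *; rewrite /exit_sum big_nat_cond [leRHS]big_nat_cond.
by apply: ler_sum => k; rewrite andbT => /andP[_ km]; apply: through_prob_mono.
Qed.

(* If [a <= a'], a maximal path through (k, 0) gains at least the increase of the
   weight of [0, k] when (a, b) is replaced by (a', b'). *)
Lemma exit_bound a b a' b' m n k : 0 <= a < 1 -> a <= a' -> a' <= 1 ->
  0 <= b <= 1 -> 0 <= b' <= 1 -> (k <= m)%N ->
  0 <= k%:R * (a' - a) - (mean a' b' m n - mean a b m n) ->
  through_prob a b m n k * (k%:R * (a' - a) - (mean a' b' m n - mean a b m n)) ^+ 2 <=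
  4 * (G_var a' b' m n + G_var a b m n + k%:R * (a' * (1 - a')) + k%:R * (a * (1 - a))).
Proof.
move=> /andP[a0 a1] aa a1' b01 b01' km; set gam := _ - (_ - _) => gam0.
(* A zero on the horizontal axis is switched on with probability c, so that a + (1 - a) c = a'. *)
pose c := (a' - a) / (1 - a).
have c01 : 0 <= c <= 1.
  by rewrite /c divr_ge0 ?subr_ge0 ?(ltW a1) //= ler_pdivrMr ?subr_gt0 // mul1r; lra.
(* The vertical weights are redrawn: a path through (k, 0) with k > 0 never collects them. *)
pose phi (v : site) (X Y : bool) :=
  if v.2 == 0%N then X || Y else if v.1 == 0%N then Y else X.
pose z x y : config := fun v => phi v (x v) (y v).
have comb f : Ex (wprob p a b) (rect m n) (fun x =>
    Ex (wprob p c b') (rect m n) (fun y => f (z x y))) = E a' b' m n f.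
  apply: Ex_comb => [v|v]; first by rewrite /phi; do !case: ifP.
  rewrite /wprob /phi; case: ifP => _ /=; last by case: ifP => _ /=; ring.
  have e : c * (1 - a) = a' - a by rewrite /c divfK // subr_eq0 gt_eqF.
  by rewrite -[LHS](subrK a) -e; ring.
have cst f : E a b m n f = Ex (wprob p a b) (rect m n) (fun x =>
    Ex (wprob p c b') (rect m n) (fun y => f x)).
  by apply: eq_Ex => x; rewrite Ex_cst.
rewrite -(@axis_var a b m n k km) -(@axis_var a' b' m n k km) /G_var -!comb [through_prob _ _ _ _ _]cst !cst.
rewrite mulrC -!ExZ -!ExD -ExZ; apply: le_Ex => [i|x]; first by apply: wprob01; lra.
rewrite -!ExZ -!ExD -ExZ; apply: le_Ex => [i|y]; first by apply: wprob01.
case T: (through k x m n); last first.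
  by rewrite mulr0; apply: mulr_ge0 => //; do !apply: addr_ge0; apply: sqr_ge0.
rewrite mulr1.
have h1 i : (x (i, 0)%N <= z x y (i, 0)%N)%N by rewrite /z /phi /=; case: (x _).
have h2 i j : (0 < i)%N -> (0 < j)%N -> x (i, j)%N = z x y (i, j)%N.
  by rewrite /z /phi /=; case: i j => [|i] [|j].
have := through_gain h1 h2 km T; rewrite -(ler_nat R) !natrD /gam.
move: gam0; rewrite /gam => gam0 h.
set u1 := (G (z x y) m n)%:R in h *; set u2 := (G x m n)%:R in h *.
set u3 := (G (z x y) k 0)%:R in h *; set u4 := (G x k 0)%:R in h *.
set s1 := u1 - mean a' b' m n; set s2 := u2 - mean a b m n.
set s3 := u3 - k%:R * a'; set s4 := u4 - k%:R * a.
(* On this event the four centred fluctuations add up to at least gam, and the square of a sum of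
   four terms is at most 4 times the sum of their squares. *)
apply: (@le_trans _ _ ((s1 - s2 - s3 + s4) ^+ 2)).
  rewrite ler_sqr ?nnegrE //; first by rewrite /s1 /s2 /s3 /s4; lra.
  by apply: (le_trans gam0); rewrite /s1 /s2 /s3 /s4; lra.
have := sqr_ge0 (s1 + s2); have := sqr_ge0 (s1 + s3); have := sqr_ge0 (s1 - s4).
have := sqr_ge0 (s2 - s3); have := sqr_ge0 (s2 + s4); have := sqr_ge0 (s3 + s4).
rewrite !expr2; lra.
Qed.

End Variance.

(** * Exit points of maximal paths *)

Section ExitPoint.
Variables (R : realType) (p : R).
Hypothesis hp : 0 < p < 1.
Implicit Types (u l D : R).

Local Notation stationary := (stationary_pair p).
Local Notation PT := (through_prob p).
Local Notation A := (exit_sum p).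
Local Notation V := (G_var p).

(** The solution b of the stationarity equation for a = u. *)
Definition vert_param u : R := p * (1 - u) / (u + p * (1 - u)).
(** The characteristic direction: the ratio n / m at which the derivative in u of m u + n
    [vert_param] u vanishes. *)
Definition slope u : R := (p + (1 - p) * u) ^+ 2 / p.

Let p0 : 0 < p. Proof. by case/andP: hp. Qed.
Let p1 : p < 1. Proof. by case/andP: hp. Qed.

Lemma den_gt u : 0 < u < 1 -> p < u + p * (1 - u) < 1.
Proof.
move=> /andP[u0 u1].
have h : 0 < u * (1 - p) by rewrite mulr_gt0 ?subr_gt0.
have h' : 0 < (1 - u) * (1 - p) by rewrite mulr_gt0 ?subr_gt0.
by apply/andP; split; lra.
Qed.

Lemma vert01 u : 0 < u < 1 -> 0 < vert_param u < 1.
Proof.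
move=> hu; have /andP[d0 d1] := den_gt hu; case/andP: hu => u0 u1.
have d : 0 < u + p * (1 - u) by have := p0; lra.
rewrite /vert_param divr_gt0 ?mulr_gt0 ?subr_gt0 //= ltr_pdivrMr // mul1r.
by lra.
Qed.

Lemma stationary_vert u : 0 < u < 1 -> stationary u (vert_param u).
Proof.
move=> hu; have /andP[d0 d1] := den_gt hu; rewrite /stationary_pair /vert_param.
by field; apply/eqP => d; move: d0; rewrite d; have := p0; lra.
Qed.

Lemma vertK u : 0 < u < 1 -> vert_param (vert_param u) = u.
Proof.
move=> hu; have /andP[d0 d1] := den_gt hu; rewrite /vert_param.
have dne : u + p * (1 - u) != 0 by apply/eqP => d; move: d0; rewrite d; have := p0; lra.
field; rewrite dne /=.
have -> : p * (1 - u) + p * (u + p * (1 - u) - p * (1 - u)) = p by ring.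
by rewrite gt_eqF.
Qed.

Lemma slope_gt0 u : 0 < u < 1 -> 0 < slope u.
Proof.
move=> /andP[u0 u1]; rewrite /slope divr_gt0 ?exprn_gt0 // ltr_wpDr //.
by rewrite mulr_ge0 ?subr_ge0 ?ltW.
Qed.

Lemma slope_vert u : 0 < u < 1 -> slope (vert_param u) = (slope u)^-1.
Proof.
move=> hu; have /andP[d0 d1] := den_gt hu; rewrite /slope /vert_param.
have dne : u + p * (1 - u) != 0 by apply/eqP => d; move: d0; rewrite d; have := p0; lra.
field; rewrite gt_eqF //=.
by apply/eqP => d; move/eqP: dne; apply; rewrite -d; ring.
Qed.

Lemma vert_anti u l : 0 < u < 1 -> 0 < l < 1 -> u <= l -> vert_param l <= vert_param u.
Proof.
move=> hu hl ul; have /andP[d0 d1] := den_gt hu; have /andP[e0 e1] := den_gt hl.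
rewrite /vert_param ler_pdivrMr; last by have := p0; lra.
rewrite mulrAC ler_pdivlMr; last by have := p0; lra.
rewrite -!mulrA ler_pM2l //; move: p0 p1 => *; nra.
Qed.

Section NearCharacteristic.
Variables (u D : R) (m n : nat).
Hypotheses (hu : 0 < u < 1) (hd : `|n%:R - slope u * m%:R| <= D).
Local Notation mn l := (mean l (vert_param l) m n).

Lemma mean_diffE l : 0 < l < 1 -> mn l - mn u =
  (l - u) * (m%:R * (1 - p) * (l - u) / (l + p * (1 - l)) -
    (n%:R - slope u * m%:R) * p / ((l + p * (1 - l)) * (u + p * (1 - u)))).
Proof.
move=> hl; have /andP[d0 d1] := den_gt hu; have /andP[e0 e1] := den_gt hl.
rewrite /mean /vert_param /slope; field.
by rewrite !gt_eqF //; have := p0; lra.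
Qed.

Let D0 : 0 <= D. Proof. by apply: le_trans hd. Qed.

Lemma den_inv l : 0 < l < 1 ->
  1 <= (l + p * (1 - l))^-1 /\ (l + p * (1 - l))^-1 <= p^-1.
Proof.
move=> hl; have /andP[e0 e1] := den_gt hl.
have e : 0 < l + p * (1 - l) by have := p0; lra.
by rewrite -[X in X <= _ /\ _]invr1 !lef_pV2 ?posrE // !ltW.
Qed.

Lemma drift_term l : 0 < l < 1 ->
  `|(n%:R - slope u * m%:R) * p / ((l + p * (1 - l)) * (u + p * (1 - u)))| <= D / p.
Proof.
move=> hl; have [e1 e2] := den_inv hl; have [d1 d2] := den_inv hu.
rewrite -mulrA normrM; apply: ler_pM => //.
rewrite ger0_norm; last first.
  by rewrite divr_ge0 ?(ltW p0) // -invr_ge0 invfM mulr_ge0 // (le_trans ler01).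
rewrite invfM; apply: (@le_trans _ _ (p * (p^-1 * p^-1))); last first.
  by rewrite mulrA divff ?gt_eqF // mul1r.
by rewrite ler_pM2l //; apply: ler_pM => //; apply: (le_trans ler01).
Qed.

Lemma mean_diff_le l : 0 < l < 1 ->
  mn l - mn u <= `|l - u| * (m%:R * `|l - u| / p + D / p).
Proof.
move=> hl; rewrite (mean_diffE hl).
have h := drift_term hl; have [e1 e2] := den_inv hl.
apply: (le_trans (ler_norm _)); rewrite normrM; apply: ler_wpM2l => //.
apply: (le_trans (ler_normB _ _)); apply: lerD => //.
rewrite !normrM normr_nat -!mulrA; apply: ler_wpM2l => //.
rewrite (ger0_norm (_ : 0 <= 1 - p)); last by rewrite subr_ge0 ltW.
rewrite (ger0_norm (le_trans ler01 e1)).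
have ha := normr_ge0 (l - u); have pi : 0 <= p^-1 by rewrite invr_ge0 ltW.
rewrite -[leRHS]mul1r; apply: ler_pM; rewrite ?mulr_ge0 ?subr_ge0 ?(ltW p1) //.
- exact: le_trans ler01 e1.
- by have := p0; lra.
- by apply: ler_wpM2l.
Qed.

Lemma mean_diff_ge l : 0 < l < 1 ->
  `|l - u| * (m%:R * (1 - p) * `|l - u| - D / p) <= mn l - mn u.
Proof.
move=> hl; rewrite (mean_diffE hl).
have h := drift_term hl; have [e1 e2] := den_inv hl.
move: h; set d := (_ * p / _) => h.
have h2 : m%:R * (1 - p) * `|l - u| * `|l - u| <=
    (l - u) * (m%:R * (1 - p) * (l - u) / (l + p * (1 - l))).
  rewrite -mulrA -normrM ger0_norm -?expr2 ?sqr_ge0 //.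
  have -> : (l - u) * (m%:R * (1 - p) * (l - u) / (l + p * (1 - l))) =
    m%:R * (1 - p) * (l - u) ^+ 2 * (l + p * (1 - l))^-1 by ring.
  rewrite -[leLHS]mulr1; apply: ler_wpM2l => //.
  by apply: mulr_ge0 (sqr_ge0 _); rewrite mulr_ge0 ?subr_ge0 ?(ltW p1).
have h3 : (l - u) * d <= `|l - u| * (D / p).
  by apply: (le_trans (ler_norm _)); rewrite normrM; apply: ler_wpM2l.
rewrite [leLHS]mulrBr [leRHS]mulrBr; apply: lerB h3.
by apply: le_trans h2; rewrite mulrC.
Qed.

(** On the characteristic, at l = u, the variances of the two axes coincide; so in [var_le] only the
    exit sum survives, up to this error. *)
Lemma axes_var_diff l : 0 < l < 1 ->
  `|m%:R * (l * (1 - l)) - n%:R * (vert_param l * (1 - vert_param l))| <=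
  (2 * m%:R * `|l - u| + D) / p ^+ 2.
Proof.
move=> hl; have [e1 e2] := den_inv hl; have /andP[d0 d1] := den_gt hu.
have /andP[c0 c1] := den_gt hl.
have -> : m%:R * (l * (1 - l)) - n%:R * (vert_param l * (1 - vert_param l)) =
  (l * (1 - l)) * ((l + p * (1 - l))^-1 ^+ 2) *
  (m%:R * ((1 - p) * (l - u) * ((l + p * (1 - l)) + (u + p * (1 - u)))) -
   (n%:R - slope u * m%:R) * p).
  by rewrite /vert_param /slope; field; rewrite !gt_eqF //; have := p0; lra.
set w := _^-1 in e1 e2 *; case/andP: hl => l0 l1.
have w1 : 0 <= w by exact: le_trans ler01 e1.
have w2 : w ^+ 2 <= (p ^+ 2)^-1 by rewrite -exprVn !expr2; apply: ler_pM.
have w0 : 0 <= w ^+ 2 by apply: sqr_ge0.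
have l2 : 0 <= l * (1 - l) <= 1 by rewrite mulr_ge0 ?subr_ge0 ?ltW //=; nra.
case/andP: l2 => l2 l3.
rewrite normrM [leRHS]mulrC; apply: ler_pM => //.
  rewrite (ger0_norm (mulr_ge0 l2 w0)).
  by apply: le_trans w2; rewrite -[leRHS]mul1r; apply: ler_wpM2r.
have ha := normr_ge0 (l - u); have hp0 := p0; have hp1 := p1.
apply: (le_trans (ler_normB _ _)); apply: lerD.
  have q0 : 0 <= 1 - p by lra.
  have s0 : 0 <= (l + p * (1 - l)) + (u + p * (1 - u)) by lra.
  rewrite !normrM normr_nat (ger0_norm q0) (ger0_norm s0).
  have -> : 2 * m%:R * `|l - u| = m%:R * (`|l - u| * 2) by ring.
  apply: ler_wpM2l => //; apply: ler_pM => //; [by rewrite mulr_ge0 | | lra].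
  by rewrite -[leRHS]mul1r; apply: ler_wpM2r => //; lra.
by rewrite normrM (gtr0_norm p0) -[leRHS]mulr1; apply: ler_pM => //; exact: ltW.
Qed.

End NearCharacteristic.
End ExitPoint.

(** The first K terms are at most 1 each; the others telescope, because 1 / (x + 1)^3 <= 1 / x^2 - 1
    / (x + 1)^2. *)
Lemma sum_tail (R : realFieldType) (f : nat -> R) (K m : nat) (c : R) : (0 < K)%N -> 0 <= c ->
  (forall k, f k <= 1) ->
  (forall k, (K < k <= m)%N -> f k <= c / k%:R ^+ 3) ->
  \sum_(1 <= k < m.+1) f k <= K%:R + c / K%:R ^+ 2.
Proof.
move=> K0 c0 f1 fc; have KR : 0 < (K%:R : R) by rewrite ltr0n.
have small j : \sum_(1 <= k < j.+1) f k <= j%:R.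
  apply: (@le_trans _ _ (\sum_(1 <= k < j.+1) 1)); first by apply: ler_sum.
  by rewrite sumr_const_nat subn1.
suff H j : (K <= j <= m)%N -> \sum_(1 <= k < j.+1) f k <=
    K%:R + c / K%:R ^+ 2 - c / j%:R ^+ 2.
  have [mK|Km] := leqP m K.
    apply: (le_trans (small m)); rewrite -[leLHS]addr0; apply: lerD.
      by rewrite ler_nat.
    by rewrite divr_ge0 // exprn_ge0 // ltW.
  apply: (le_trans (H m _)); first by rewrite ltnW //=.
  by rewrite gerBl divr_ge0 // exprn_ge0.
move=> /andP[Kj]; rewrite -(subnKC Kj); elim: (j - K)%N => [|i IH] ij.
  by rewrite addn0 addrK.
rewrite addnS big_nat_recr //=.
have := IH ltac:(lia); have := fc (K + i).+1 ltac:(lia).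
set s := \sum_(_ <= k < _) _; set q := (K + i)%N.
have q0 : 0 < (q%:R : R) by rewrite ltr0n /q; lia.
have -> : (q.+1%:R : R) = q%:R + 1 by rewrite -natr1.
set x : R := q%:R in q0 *.
suff : c / (x + 1) ^+ 3 <= c / x ^+ 2 - c / (x + 1) ^+ 2 by lra.
rewrite -mulrBr; apply: ler_wpM2l => //; rewrite -subr_ge0.
have -> : (x ^+ 2)^-1 - ((x + 1) ^+ 2)^-1 - ((x + 1) ^+ 3)^-1 =
  (x ^+ 2 + 3 * x + 1) / (x ^+ 2 * (x + 1) ^+ 3).
  by field; rewrite !gt_eqF //; lra.
apply: divr_ge0; first by have := sqr_ge0 x; lra.
by rewrite mulr_ge0 ?exprn_ge0 //; lra.
Qed.

(** * Tail bounds for exit points *)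

Section ExitTails.
Variables (R : realType) (p : R).
Hypothesis hp : 0 < p < 1.
Implicit Types (u l D : R).

Local Notation stationary := (stationary_pair p).
Local Notation PT := (through_prob p).
Local Notation A := (exit_sum p).
Local Notation V := (G_var p).
Local Notation vert := (vert_param p).
Local Notation slope := (slope p).

Lemma ltW01 u : 0 < u < 1 -> 0 <= u <= 1.
Proof. by move=> /andP[u0 u1]; rewrite !ltW. Qed.

(** The form for l >= u, where the vertical exit sum is at most its value at u. *)
Lemma G_var_le_vert u D m n l : 0 < u < 1 -> `|n%:R - slope u * m%:R| <= D ->
  0 < l < 1 ->
  V l (vert l) m n <= (2 * m%:R * `|l - u| + D) / p ^+ 2 + 2 * A (vert l) l n m.
Proof.
move=> hu hd hl; rewrite G_var_swap //.
have hv := vert01 hp hl.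
apply: le_trans (var_le hp _ _ (ltW01 hv) (ltW01 hl) _) _.
  by apply: stationaryC; apply: stationary_vert.
by rewrite lerD2r; apply: le_trans (axes_var_diff hp hu hd hl); apply: ler_norm.
Qed.

Lemma G_var_le_hor u D m n l : 0 < u < 1 -> `|n%:R - slope u * m%:R| <= D ->
  0 < l < 1 ->
  V l (vert l) m n <= (2 * m%:R * `|l - u| + D) / p ^+ 2 + 2 * A l (vert l) m n.
Proof.
move=> hu hd hl; have hv := vert01 hp hl.
apply: le_trans (var_le hp _ _ (ltW01 hl) (ltW01 hv) _) _.
  exact: stationary_vert.
rewrite lerD2r; apply: le_trans (axes_var_diff hp hu hd hl).
by rewrite distrC; apply: ler_norm.
Qed.

Definition exit_cst u : R := 64 / (p ^+ 2 * (p * (1 - u) / 4) ^+ 2).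

(** [exit_bound] from u to u + t with t = c k / m: the gain t k on the axis is at least twice the
    change of the mean, so t k / 2 remains for Chebyshev's inequality. *)
Lemma exit_hor u D m n k : 0 < u < 1 -> `|n%:R - slope u * m%:R| <= D ->
  (0 < k <= m)%N -> D <= p * k%:R / 4 ->
  PT u (vert u) m n k * k%:R ^+ 4 <=
  exit_cst u * m%:R ^+ 2 * (k%:R + A (vert u) u n m).
Proof.
move=> hu hd /andP[k0 km] Dk.
have hv := vert01 hp hu; have /andP[v0 v1] := hv; have /andP[u0 u1] := hu.
have /andP[p0 p1] := hp; have D0 : 0 <= D by apply: le_trans hd.
set K : R := k%:R in Dk *; set M : R := m%:R in hd *; set B := A _ _ _ _.
have K1 : 1 <= K by rewrite /K ler1n.
have KM : K <= M by rewrite /K /M ler_nat.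
have B0 : 0 <= B.
  by rewrite /B /exit_sum; apply: sumr_ge0 => i _; apply: through_prob_ge0 => //; apply: ltW01.
(* c <= p / 4 keeps the quadratic change of the mean below t k / 4, and c <= (1 - u) / 4 keeps u + t
   below 1. *)
rewrite /exit_cst; set c := p * (1 - u) / 4.
have c0 : 0 < c by rewrite /c divr_gt0 // mulr_gt0 // subr_gt0.
have cp : c <= p / 4 by rewrite /c -mulrA ler_pM2l //; lra.
have cu : c <= (1 - u) / 4.
  by rewrite /c ler_pM2r // -[leRHS]mul1r ler_pM2r ?subr_gt0 // ltW.
pose t := c * K / M.
have M0 : 0 < M by lra.
have tM : M * t = c * K by rewrite /t mulrC divfK // gt_eqF.
have t0 : 0 < t by rewrite /t divr_gt0 // mulr_gt0 //; lra.
have tc : t <= c by rewrite /t ler_pdivrMr // ler_pM2l.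
have hl : 0 < u + t < 1 by clear -u0 u1 t0 tc cu; apply/andP; split; lra.
have hvl := vert01 hp hl; have /andP[vl0 vl1] := hvl.
have lu : `|u + t - u| = t by rewrite addrAC subrr add0r gtr0_norm.
have gam : t * K / 2 <= K * (u + t - u) -
    (mean (u + t) (vert (u + t)) m n - mean u (vert u) m n).
  have := mean_diff_le hp hu hd hl; rewrite lu -/M tM => h.
  have h1 : c * K / p <= K / 4.
    by rewrite ler_pdivrMr //; rewrite mulrC -mulrA ler_pM2l; clear -cp K1; lra.
  have h2 : D / p <= K / 4 by rewrite ler_pdivrMr //; clear -Dk; lra.
  have h3 : t * (c * K / p + D / p) <= t * (K / 2) by clear -t0 h1 h2; apply: ler_wpM2l; lra.
  have -> : K * (u + t - u) = t * K by ring.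
  clear -h h3; lra.
have gam0 : 0 <= t * K / 2 by clear -t0 K1; apply: divr_ge0 => //; apply: mulr_ge0; lra.
have := @exit_bound _ p hp u (vert u) (u + t) (vert (u + t)) m n k.
move=> /(_ _ _ _ (ltW01 hv) (ltW01 hvl) km (le_trans gam0 gam)).
rewrite (ltW u0) u1 lerDl (ltW t0) -/K; move=> /(_ isT isT (ltW (proj2 (andP hl)))) main.
have VL : V (u + t) (vert (u + t)) m n <= K / p ^+ 2 + 2 * B.
  apply: le_trans (G_var_le_vert hu hd hl) _; apply: lerD.
    rewrite ler_pM2r ?invr_gt0 ?exprn_gt0 // lu -mulrA -/M tM.
    have : c * K <= K / 4 by clear -cp p1 K1; rewrite mulrC ler_pM2l; lra.
    have : p * K <= K by clear -p1 K1; rewrite -[leRHS]mul1r ler_pM2r; lra.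
    clear -Dk K1; lra.
  rewrite ler_pM2l //; apply: exit_sum_mono; rewrite ?(ltW vl0) ?(ltW v1) ?(ltW u0) ?lerDl ?(ltW t0) ?(ltW (proj2 (andP hl))) //.
  by apply: vert_anti => //; rewrite lerDl ltW.
have VU : V u (vert u) m n <= K / p ^+ 2 + 2 * B.
  apply: le_trans (G_var_le_vert hu hd hu) _; apply: lerD => //.
  rewrite ler_pM2r ?invr_gt0 ?exprn_gt0 // subrr normr0 mulr0 add0r.
  have : p * K <= K by clear -p1 K1; rewrite -[leRHS]mul1r ler_pM2r; lra.
  clear -Dk K1; lra.
have pK : K <= K / p ^+ 2.
  by rewrite ler_pdivlMr ?exprn_gt0 // -[leRHS]mulr1 ler_pM2l ?exprn_ile1 ?ltW //; clear -K1; lra.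
have bern z : 0 < z < 1 -> K * (z * (1 - z)) <= K / p ^+ 2.
  move=> /andP[z0 z1]; apply: le_trans pK; rewrite -[leRHS]mulr1 ler_pM2l; clear -z0 z1 K1; last lra.
  by nra.
have {main} : PT u (vert u) m n k * (t * K / 2) ^+ 2 <= 16 * (K + B) / p ^+ 2.
  apply: le_trans (le_trans main _).
    apply: ler_wpM2l; first by apply: through_prob_ge0 => //; apply: ltW01.
    by rewrite ler_sqr ?nnegrE // (le_trans gam0).
  have BB : B <= B / p ^+ 2.
    rewrite ler_pdivlMr ?exprn_gt0 // -[leRHS]mulr1; apply: ler_wpM2l => //.
    by rewrite exprn_ile1 // ltW.
  have := bern _ hl; have := bern _ hu.
  have -> : 16 * (K + B) / p ^+ 2 = 16 * (K / p ^+ 2) + 16 * (B / p ^+ 2) by ring.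
  clear -VL VU BB pK; lra.
have -> : (t * K / 2) ^+ 2 = K ^+ 4 * (c ^+ 2 / (4 * M ^+ 2)).
  by rewrite /t; field; rewrite gt_eqF.
rewrite [leLHS]mulrA -ler_pdivlMr; last first.
  by apply: divr_gt0; [exact: exprn_gt0 | apply: mulr_gt0 => //; exact: exprn_gt0].
move=> /le_trans; apply; rewrite le_eqVlt; apply/orP; left; apply/eqP.
by field; rewrite !gt_eqF.
Qed.

End ExitTails.

Section ExitEstimate.
Variables (R : realType) (p : R).
Hypothesis hp : 0 < p < 1.
Implicit Types (u l D : R).

Local Notation stationary := (stationary_pair p).
Local Notation PT := (through_prob p).
Local Notation A := (exit_sum p).
Local Notation V := (G_var p).
Local Notation vert := (vert_param p).
Local Notation slope := (slope p).

Lemma exit_cst_ge0 u : 0 <= exit_cst p u.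
Proof.
case/andP: hp => p0 p1.
by rewrite /exit_cst divr_ge0 // mulr_ge0 // ?sqr_ge0.
Qed.

Lemma exit_vert u D m n k : 0 < u < 1 -> `|n%:R - slope u * m%:R| <= D ->
  (0 < k <= n)%N -> D / slope u <= p * k%:R / 4 ->
  PT (vert u) u n m k * k%:R ^+ 4 <=
  exit_cst p (vert u) * n%:R ^+ 2 * (k%:R + A u (vert u) m n).
Proof.
move=> hu hd kn Dk; have hv := vert01 hp hu; have s0 := slope_gt0 hp hu.
have hd' : `|m%:R - slope (vert u) * n%:R| <= D / slope u.
  rewrite slope_vert // ler_pdivlMr // -[X in _ * X](gtr0_norm s0) -normrM.
  rewrite mulrBl mulrC [_^-1 * _]mulrC divfK ?gt_eqF // distrC.
  exact: hd.
by have := exit_hor hp hv hd' kn Dk; rewrite vertK.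
Qed.

(** From K on, c1 (k + B) / k^4 is at most (K^3 / 4) (1 + B / K) / k^3, and the sum of the latter
    beyond K is at most a quarter of K + B. *)
Lemma tail_sum_le a b m n (K : nat) (c1 B : R) : 0 <= a <= 1 -> 0 <= b <= 1 ->
  (0 < K)%N -> 0 <= B -> 4 * c1 <= K%:R ^+ 3 ->
  (forall k, (K <= k <= m)%N -> PT a b m n k * k%:R ^+ 4 <= c1 * (k%:R + B)) ->
  A a b m n <= K%:R + (K%:R + B) / 4.
Proof.
move=> a01 b01 K0 B0 KC H.
have KR : 0 < (K%:R : R) by rewrite ltr0n.
pose c := K%:R ^+ 3 / 4 * (1 + B / K%:R).
have BK : 0 <= B / K%:R by rewrite divr_ge0.
have c0 : 0 <= c by rewrite /c mulr_ge0 ?addr_ge0 // divr_ge0 // exprn_ge0.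
have -> : (K%:R + B) / 4 = c / K%:R ^+ 2 by rewrite /c; field; rewrite gt_eqF.
apply: sum_tail => // k; first exact: through_prob_le1.
move=> /andP[Kk km]; have kR : 0 < (k%:R : R) by rewrite ltr0n (leq_trans K0) // ltnW.
have KkR : (K%:R : R) <= k%:R by rewrite ler_nat ltnW.
rewrite ler_pdivlMr ?exprn_gt0 // -(ler_pM2r kR) -mulrA -exprSr.
apply: (le_trans (H k _)); first by rewrite km ltnW.
have -> : c * k%:R = (K%:R ^+ 3 / 4) * (k%:R + B * (k%:R / K%:R)).
  by rewrite /c; ring.
have kB : 0 <= k%:R + B by rewrite addr_ge0.
apply: (@le_trans _ _ (K%:R ^+ 3 / 4 * (k%:R + B))).
  by apply: ler_wpM2r => //; rewrite ler_pdivlMr // mulrC.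
apply: ler_wpM2l; first by rewrite divr_ge0 // exprn_ge0.
rewrite lerD2l -[leLHS]mulr1; apply: ler_wpM2l => //.
by rewrite ler_pdivlMr // mul1r.
Qed.

(* The two sums of exit probabilities bound each other's tails, with
   coefficient 1/4 beyond the scale K ~ m^(2/3); here s = m^(2/3). *)
Lemma exit_estimate u : 0 < u < 1 -> exists2 C : R, 1 <= C &
  forall m n (s D : R), (0 < m)%N -> 0 <= s -> s ^+ 3 = m%:R ^+ 2 ->
    `|n%:R - slope u * m%:R| <= D -> D <= m%:R ->
    [/\ A u (vert u) m n + A (vert u) u n m <= C * (s + D),
      forall k, C * (s + D) <= k%:R -> (0 < k <= m)%N ->
        PT u (vert u) m n k * k%:R ^+ 3 <= C * m%:R ^+ 2 &
      forall k, C * (s + D) <= k%:R -> (0 < k <= n)%N ->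
        PT (vert u) u n m k * k%:R ^+ 3 <= C * m%:R ^+ 2].
Proof.
move=> hu; have hv := vert01 hp hu; have ka0 := slope_gt0 hp hu.
have /andP[p0 p1] := hp; set ka := slope u in ka0 *.
have u01 := ltW01 hu; have v01 := ltW01 hv.
have e1 := exit_cst_ge0 u; have e2 := exit_cst_ge0 (vert u).
pose C1 := exit_cst p u + exit_cst p (vert u) * (ka + 1) ^+ 2 + 1.
have e3 : 0 <= exit_cst p (vert u) * (ka + 1) ^+ 2 by rewrite mulr_ge0 // sqr_ge0.
have C11 : 1 <= C1 by rewrite /C1; lra.
pose c2 := 4 / p * (1 + ka^-1).
have c20 : 0 <= c2 by rewrite /c2 mulr_ge0 ?addr_ge0 ?invr_ge0 ?ltW // divr_gt0.
exists (16 * C1 + 4 + 4 * c2); first by lra.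
move=> m n s D m0 s0 s3 hd Dm; have D0 : 0 <= D by apply: le_trans hd.
have M1 : 1 <= (m%:R : R) by rewrite ler1n.
have s1 : 1 <= s.
  rewrite leNgt; apply/negP => lt; have : s ^+ 3 < 1 by rewrite exprn_ilt1.
  by rewrite s3; apply/negP; rewrite -leNgt exprn_ege1.
have nle : n%:R <= (ka + 1) * m%:R.
  have := ler_norm (n%:R - ka * m%:R); rewrite mulrDl mul1r; lra.
(* The first term yields K^3 >= 4 C1 m^2, as [tail_sum_le] requires; the second makes D small enough
   for [exit_hor] and [exit_vert] from K on. *)
pose x := 4 * C1 * s + c2 * D.
have x0 : 0 <= x by rewrite /x addr_ge0 // mulr_ge0 //; lra.
pose K := (Num.truncn x).+1.
have xK : x <= K%:R by apply: ltW; rewrite /K truncnS_gt.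
have Kx : K%:R <= x + 1 by rewrite /K -natr1 lerD2r truncn_le.
have KR : 0 < (K%:R : R) by rewrite ltr0n.
have K4 : 4 * K%:R <= (16 * C1 + 4 + 4 * c2) * (s + D).
  apply: (@le_trans _ _ (4 * (x + s))); first lra.
  have h1 : 0 <= c2 * s by rewrite mulr_ge0.
  have h2 : 0 <= C1 * D by rewrite mulr_ge0 //; lra.
  by rewrite /x; lra.
have K3 : 4 * C1 * m%:R ^+ 2 <= K%:R ^+ 3.
  apply: (@le_trans _ _ ((4 * C1 * s) ^+ 3)).
    rewrite -s3 exprMn; apply: ler_wpM2r; first by rewrite exprn_ge0.
    clear -C11; rewrite exprS -[leLHS]mulr1.
    by apply: ler_wpM2l; [lra|rewrite exprn_ege1 //; lra].
  have h : 4 * C1 * s <= K%:R.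
    by apply: le_trans xK; rewrite /x lerDl mulr_ge0.
  by rewrite lerXn2r ?nnegrE // ?mulr_ge0 //; clear -C11; lra.
have DK : D <= p * K%:R / 4.
  rewrite ler_pdivlMr // mulrC -ler_pdivrMl //; apply: le_trans xK.
  rewrite /x /c2; have : 0 <= 4 / p * D / ka.
    by apply: (divr_ge0 _ (ltW ka0)); apply: (mulr_ge0 _ D0); apply: (divr_ge0 _ (ltW p0)).
  have : 0 <= C1 * s by rewrite mulr_ge0 //; lra.
  have -> : 4 / p * (1 + ka^-1) * D = 4 / p * D + 4 / p * D / ka by ring.
  have -> : p^-1 * (4 * D) = 4 / p * D by ring.
  lra.
have DK' : D / ka <= p * K%:R / 4.
  rewrite [leRHS]mulrC -ler_pdivrMl ?invr_gt0 // invrK.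
  rewrite -ler_pdivrMl //; apply: le_trans xK.
  rewrite /x /c2; have : 0 <= 4 / p * D.
    by rewrite mulr_ge0 // divr_ge0 // ltW.
  have : 0 <= C1 * s by rewrite mulr_ge0 //; lra.
  have -> : 4 / p * (1 + ka^-1) * D = 4 / p * D + 4 / p * D / ka by ring.
  have -> : p^-1 * (4 * (D / ka)) = 4 / p * D / ka by ring.
  lra.
set SA := A u (vert u) m n; set SB := A (vert u) u n m.
have SA0 : 0 <= SA by apply: sumr_ge0 => i _; apply: through_prob_ge0.
have SB0 : 0 <= SB by apply: sumr_ge0 => i _; apply: through_prob_ge0.
have bh k : (K <= k <= m)%N ->
    PT u (vert u) m n k * k%:R ^+ 4 <= C1 * m%:R ^+ 2 * (k%:R + SB).
  move=> /andP[Kk km]; have KkR : (K%:R : R) <= k%:R by rewrite ler_nat.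
  apply: (le_trans (@exit_hor _ p hp u D m n k hu hd _ _)).
  - by rewrite km andbT (leq_trans _ Kk).
  - by apply: (le_trans DK); rewrite ler_pM2r ?ler_pM2l.
  apply: ler_wpM2r; first by rewrite addr_ge0.
  by apply: ler_wpM2r; rewrite ?sqr_ge0 // /C1; clear -e1 e2 e3; lra.
have bv k : (K <= k <= n)%N ->
    PT (vert u) u n m k * k%:R ^+ 4 <= C1 * m%:R ^+ 2 * (k%:R + SA).
  move=> /andP[Kk kn]; have KkR : (K%:R : R) <= k%:R by rewrite ler_nat.
  apply: (le_trans (@exit_vert u D m n k hu hd _ _)).
  - by rewrite kn andbT (leq_trans _ Kk).
  - by apply: (le_trans DK'); rewrite ler_pM2r ?ler_pM2l.
  apply: ler_wpM2r; first by rewrite addr_ge0.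
  apply: (@le_trans _ _ (exit_cst p (vert u) * ((ka + 1) * m%:R) ^+ 2)).
    by apply: ler_wpM2l => //; rewrite lerXn2r ?nnegrE // mulr_ge0 //; clear -ka0; lra.
  by rewrite exprMn mulrA; apply: ler_wpM2r; rewrite ?sqr_ge0 // /C1; clear -e1; lra.
have tA : SA <= K%:R + (K%:R + SB) / 4.
  by apply: (tail_sum_le u01 v01 _ _ _ bh) => //; rewrite mulrA.
have tB : SB <= K%:R + (K%:R + SA) / 4.
  by apply: (tail_sum_le v01 u01 _ _ _ bv) => //; rewrite mulrA.
(* Here S <= 4 K <= k, so k + S <= 2 k and one power of k cancels. *)
have fin (k : nat) (P0 S : R) :
    (16 * C1 + 4 + 4 * c2) * (s + D) <= k%:R -> (0 < k)%N -> S <= 4 * K%:R ->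
    P0 * k%:R ^+ 4 <= C1 * m%:R ^+ 2 * (k%:R + S) ->
    P0 * k%:R ^+ 3 <= (16 * C1 + 4 + 4 * c2) * m%:R ^+ 2.
  move=> kC k0 SK h; have kR : 0 < (k%:R : R) by rewrite ltr0n.
  rewrite -(ler_pM2r kR) -mulrA -exprSr; apply: (le_trans h).
  rewrite -mulrA -[leRHS]mulrA.
  apply: (@le_trans _ _ (C1 * (m%:R ^+ 2 * (2 * k%:R)))).
    apply: ler_wpM2l; first by clear -C11; lra.
    by apply: ler_wpM2l; rewrite ?sqr_ge0 //; clear -kC SK K4; lra.
  have -> : C1 * (m%:R ^+ 2 * (2 * k%:R)) = 2 * C1 * (m%:R ^+ 2 * k%:R) by ring.
  by apply: ler_wpM2r; [rewrite mulr_ge0 ?sqr_ge0 // ltW | clear -C11 c20; lra].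
(* The two inequalities give SA + SB <= 10 K / 3. *)
split; first by clear -tA tB K4 KR; lra.
- move=> k kC /andP[k0 km]; apply: (fin k _ SB) => //; first by clear -tA tB KR; lra.
  by apply: bh; rewrite km andbT -(ler_nat R); clear -kC K4 KR; lra.
- move=> k kC /andP[k0 km]; apply: (fin k _ SA) => //; first by clear -tA tB KR; lra.
  by apply: bv; rewrite km andbT -(ler_nat R); clear -kC K4 KR; lra.
Qed.

End ExitEstimate.

(** * Probabilities of cylinder events *)

Section Cylinders.

Local Open Scope classical_set_scope.
Local Open Scope ring_scope.

Section Bridge.
Context (R : realType) (d : measure_display) (T : measurableType d).
Variables (P : probability T R) (I : eqType) (X : I -> {RV P >-> bool}).
Implicit Types (s : seq I) (f : (I -> bool) -> bool).

(** Indices outside [s] read false, as in the base case of [Ex]. *)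
Definition restr s (t : T) : I -> bool := fun i => (i \in s) && X i t.

Lemma measurable_eq_RV i b : measurable (X i @^-1` [set b]).
Proof. by rewrite -[X in measurable X]setTI; exact: measurable_funP. Qed.

Lemma event_split i s f :
  [set t | f (restr (i :: s) t)] =
  (X i @^-1` [set true] `&` [set t | f (upd (restr s t) i true)]) `|`
  (X i @^-1` [set false] `&` [set t | f (upd (restr s t) i false)]).
Proof.
have e t : restr (i :: s) t = upd (restr s t) i (X i t).
  by apply/funext => j; rewrite /restr /upd inE; case: eqVneq => [->|].
apply/seteqP; split => t /=; rewrite e.
  by case: (X i t) => h; [left|right].
by case=> -[->].
Qed.

Lemma measurable_event s f : measurable [set t | f (restr s t)].
Proof.
elim: s f => [|i s IH] f.
  have -> : [set t | f (restr [::] t)] = if f (fun=> false) then setT else set0.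
    have e t : restr [::] t = fun=> false by apply/funext.
    by apply/seteqP; split => t /=; rewrite e; case: (f _).
  by case: (f _); [exact: measurableT|exact: measurable0].
by rewrite event_split; apply: measurableU; apply: measurableI;
  [exact: measurable_eq_RV | exact: (IH (fun c => f (upd c i true))) |
   exact: measurable_eq_RV | exact: (IH (fun c => f (upd c i false)))].
Qed.

Hypothesis indep : mutually_independent X.

(** Independence concerns intersections of single-site events, so the induction moves sites from [s]
    to [J] and keeps the intersection over [J] explicit. *)
Lemma independent_Ex (q : I -> R) s J (a : I -> bool) f :
  (forall i, i \in s -> P (X i @^-1` [set true]) = (q i)%:E) ->
  uniq (s ++ J) ->
  P ((\big[setI/setT]_(i <- J) (X i @^-1` [set a i])) `&`
     [set t | f (restr s t)]) =
  ((\prod_(i <- J) P (X i @^-1` [set a i])) *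
   (Ex q s (fun c => (f c)%:R))%:E)%E.
Proof.
elim: s J a f => [|i s IH] J a f qE /=.
  move=> uJ; have -> : [set t | f (restr [::] t)] = if f (fun=> false) then setT else set0.
    have e t : restr [::] t = fun=> false by apply/funext.
    by apply/seteqP; split => t /=; rewrite e; case: (f _).
  have := @indep J (fun i => [set a i]) uJ (fun i => _) => <-; last by [].
  by case: (f _); rewrite ?setIT ?setI0 ?mule1 ?mule0 ?measure0.
move=> /andP[iN us]; have iJ : i \notin J.
  by apply: contra iN; rewrite mem_cat => ->; rewrite orbT.
have is_ : i \notin s by apply: contra iN; rewrite mem_cat => ->.
have {}IH b := IH (i :: J) (fun j => if j == i then b else a j)
  (fun c => f (upd c i b)).
have usJ : uniq (s ++ i :: J) by rewrite -cat_rcons -cats1 -catA uniq_catCA /= iN.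
have bigE b : \big[setI/setT]_(j <- i :: J) (X j @^-1` [set (if j == i then b else a j)])
   = X i @^-1` [set b] `&` \big[setI/setT]_(j <- J) (X j @^-1` [set a j]).
  rewrite big_cons eqxx; congr (_ `&` _); apply: eq_big_seq => j jJ.
  by case: eqP => // E; move: iJ; rewrite -E jJ.
have prodE b : (\prod_(j <- i :: J) P (X j @^-1` [set (if j == i then b else a j)])
   = P (X i @^-1` [set b]) * \prod_(j <- J) P (X j @^-1` [set a j]))%E.
  rewrite big_cons eqxx; congr (_ * _)%E; apply: eq_big_seq => j jJ.
  by case: eqP => // E; move: iJ; rewrite -E jJ.
have qs j : j \in s -> P (X j @^-1` [set true]) = (q j)%:E.
  by move=> js; apply: qE; rewrite inE js orbT.
have pT : P (X i @^-1` [set true]) = (q i)%:E by apply: qE; rewrite mem_head.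
have pF : P (X i @^-1` [set false]) = (1 - q i)%:E.
  have -> : X i @^-1` [set false] = ~` (X i @^-1` [set true]).
    by apply/seteqP; split => t /=; case: (X i t).
  by rewrite probability_setC ?pT //; exact: measurable_eq_RV.
rewrite event_split setIUr measureU; first last.
- apply/seteqP; split => t //= -[[_ [-> _]] [_ [+ _]]]; done.
- apply: measurableI; first by apply: bigsetI_measurable => j _; exact: measurable_eq_RV.
  by apply: measurableI; [exact: measurable_eq_RV|exact: (measurable_event s (fun c => f (upd c i false)))].
- apply: measurableI; first by apply: bigsetI_measurable => j _; exact: measurable_eq_RV.
  by apply: measurableI; [exact: measurable_eq_RV|exact: (measurable_event s (fun c => f (upd c i true)))].
have := IH true qs usJ; have := IH false qs usJ; rewrite !bigE !prodE pT pF -!setIA => hF hT.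
rewrite ![\big[setI/setT]_(_ <- _) _ `&` (_ `&` _)]setICA.
apply: (etrans (congr2 (fun v w => v + w)%E hT hF)).
set Q := (\prod_(_ <- J) _)%E.
have Qfin : Q \is a fin_num.
  apply: (big_ind (fun z : \bar R => z \is a fin_num)) => // [z w|j _].
    exact: fin_numM.
  by apply: fin_num_measure; exact: measurable_eq_RV.
rewrite -(fineK Qfin) -!EFinM -EFinD; congr EFin; ring.
Qed.

Lemma probability_Ex (q : I -> R) s f :
  (forall i, i \in s -> P (X i @^-1` [set true]) = (q i)%:E) ->
  uniq s -> supported s f ->
  P [set t | f (fun i => X i t)] = (Ex q s (fun c => (f c)%:R))%:E.
Proof.
move=> qE us fs; have := @independent_Ex q s [::] (fun=> false) f qE.
rewrite cats0 !big_nil setTI mul1e => <- //; congr (P _).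
apply/seteqP; split => t /=; rewrite (@fs _ (fun i => X i t)) // => i is_;
  by rewrite /restr is_.
Qed.

End Bridge.

Section BoundaryEnvironment.
Context (R : realType) (d : measure_display) (T : measurableType d).
Variables (P : probability T R) (p u : R) (omega : nat -> nat -> {RV P >-> bool}).
Hypotheses (hp : 0 < p < 1) (hu : 0 < u < 1).
Hypothesis homega : boundary_environment p u omega.

Lemma boundary_environment_prob m n (f : config -> bool) :
  supported (rect m n) f ->
  P [set t | f (fun v => omega v.1 v.2 t)] =
  (expect p u (vert_param p u) m n (fun c => (f c)%:R))%:E.
Proof.
move=> fs; apply: (@probability_Ex _ _ _ P _ (fun v : site => omega v.1 v.2)) => //.
- exact: env_independent homega.
- move=> [i j]; rewrite mem_rect /= => ij.
  have -> : P (omega i j @^-1` [set true]) = distribution P (omega i j) [set true] by [].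
  have bern r : 0 < r < 1 -> bernoulli_prob r [set true] = r%:E :> \bar R.
    move=> /andP[r0 r1]; rewrite bernoulli_probE; last by rewrite !ltW.
    by rewrite !diracE mem_set // memNset //= mule1 mule0 adde0.
  rewrite /wprob /=; case: i j ij => [|i] [|j] //= ij.
  + by rewrite (env_vertical homega) // bern //; apply: vert01.
  + by rewrite (env_horizontal homega) // bern.
  + by rewrite (env_bulk homega) // bern.
- exact: rect_uniq.
Qed.

End BoundaryEnvironment.

End Cylinders.

(** * Deviations from the characteristic line *)

Implicit Types c : config.

Lemma eq_rightmost_path x y m n (v : site) : {in rect m n, x =1 y} ->
  (v.1 <= m)%N -> (v.2 <= n)%N ->
  rightmost_path (fun i j => x (i, j)) v = rightmost_path (fun i j => y (i, j)) v.
Proof.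
move=> xy; have [K vK] := ubnP (v.1 + v.2)%N; elim: K v vK => // K IH v vK vm vn.
have [->//|v0] := eqVneq v origin.
have gE i j : (i <= m)%N -> (j <= n)%N -> G x i j = G y i j.
  by move=> im jn; rewrite (G_supported im jn xy).
have sE : back_step (fun i j => x (i, j)) v = back_step (fun i j => y (i, j)) v.
  case: v {vK v0} vm vn => [[|i] [|j]] //= vm vn.
  have := gE i.+1 j vm (ltnW vn); have := gE i.+1 j.+1 vm vn.
  by rewrite /G => -> ->; rewrite xy // mem_rect /=; lia.
rewrite [LHS]rightmost_pathE // [RHS]rightmost_pathE // sE; congr rcons; apply: IH.
- by have := back_step_lt (fun i j => y (i, j)) v0; lia.
- have [+ _] := back_stepP (fun i j => y (i, j)) v0.
  case: (back_step _ v) => i j; case: v vm vn {vK v0 sE} => a b /= vm vn.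
  by rewrite /admissible_step !inE => /or3P[]/eqP[] *; lia.
- have [+ _] := back_stepP (fun i j => y (i, j)) v0.
  case: (back_step _ v) => i j; case: v vm vn {vK v0 sE} => a b /= vm vn.
  by rewrite /admissible_step !inE => /or3P[]/eqP[] *; lia.
Qed.

Lemma bigminn_attained (I : Type) (r : seq I) (Q : pred I) (F : I -> nat) m :
  \big[minn/m]_(i <- r | Q i) F i = m \/
  exists2 i, Q i & \big[minn/m]_(i <- r | Q i) F i = F i.
Proof.
elim/big_rec: _ => [|i w Qi [->|[k Qk ->]]]; first by left.
  by case: (leqP (F i) m) => _; [right; exists i | left].
by case: (leqP (F i) (F k)) => _; right; [exists i | exists k].
Qed.

Lemma bigmaxn_attained (I : Type) (r : seq I) (Q : pred I) (F : I -> nat) :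
  (\max_(i <- r | Q i) F i = 0)%N \/
  exists2 i, Q i & (\max_(i <- r | Q i) F i = F i)%N.
Proof.
elim/big_rec: _ => [|i w Qi [->|[k Qk ->]]]; first by left.
  by rewrite maxn0; right; exists i.
by case: (leqP (F i) (F k)) => _; right; [exists k | exists i].
Qed.

Lemma shifted_hor c i0 j0 M n k k' : (0 < k <= k')%N ->
  oreach c (i0 + k', j0)%N (i0 + M, j0 + n)%N ->
  (k <= M)%N && through k (shift i0 j0 c) M n.
Proof.
move=> /andP[k0 kk] r; have [/= le _] := oreach_le r.
have kM : (k' <= M)%N by lia.
rewrite (leq_trans kk kM) /=; apply: (through_le kk).
have r' : oreach c (i0 + k', j0 + 0)%N (i0 + M, j0 + n)%N by rewrite addn0.
have := oreach_shift r'; rewrite /= !addKn.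
exact: oreach_through (leq_trans k0 kk).
Qed.

Lemma shifted_ver c i0 j0 M n k k' : (0 < k <= k')%N ->
  oreach c (i0, j0 + k')%N (i0 + M, j0 + n)%N ->
  (k <= n)%N && through k (swapc (shift i0 j0 c)) n M.
Proof. by move=> kk /oreach_swap /(shifted_hor kk); rewrite swapc_shift. Qed.

Section PathFluctuations.
Variables (R : realType) (p u : R).
Hypotheses (hp : 0 < p < 1) (hu : 0 < u < 1).
Local Notation kap := (slope p u).
Local Notation E0 := (expect p u (vert_param p u)).

Let v01 := vert01 hp hu.
Let u01' := ltW01 hu.
Let v01' := ltW01 v01.
Let st := stationary_vert hp hu.

Lemma expect_le m n (f g : config -> R) : (forall c, f c <= g c) -> E0 m n f <= E0 m n g.
Proof. by move=> fg; apply: le_Ex => // i; apply: wprob01. Qed.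

Lemma expect_through_hor i0 j0 M n k :
  E0 (i0 + M) (j0 + n) (fun c => ((k <= M)%N && through k (shift i0 j0 c) M n)%:R) =
  (k <= M)%:R * through_prob p u (vert_param p u) M n k.
Proof.
case: leqP => kM /=; last by rewrite mul0r /expect Ex_cst.
rewrite mul1r /through_prob -(@expect_shift _ _ _ _ i0 j0 M n _ st) //.
by move=> x y xy; rewrite (through_supported k (leqnn M) (leqnn n) xy).
Qed.

Lemma expect_through_ver i0 j0 M n k :
  E0 (i0 + M) (j0 + n)
    (fun c => ((k <= n)%N && through k (swapc (shift i0 j0 c)) n M)%:R) =
  (k <= n)%:R * through_prob p (vert_param p u) u n M k.
Proof.
case: leqP => kM /=; last by rewrite mul0r /expect Ex_cst.
have sup : supported (rect n M) (fun x => (through k x n M)%:R : R).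
  by move=> x y xy; rewrite (through_supported k (leqnn n) (leqnn M) xy).
rewrite mul1r /through_prob -(@expect_swap _ _ _ _ M n) //.
rewrite -(@expect_shift _ _ _ _ i0 j0 M n _ st) //.
exact: (supported_swap sup).
Qed.
Lemma pow23_cube N : pow23 R N ^+ 3 = N%:R ^+ 2.
Proof.
rewrite /pow23 -powR_mulrn ?powR_ge0 // -powRrM mulrC mulrCA divff ?mulr1 //.
by rewrite powR_mulrn.
Qed.

Lemma pow23_ge0 N : 0 <= pow23 R N. Proof. exact: powR_ge0. Qed.

Lemma pow23_le M N : (M <= N)%N -> pow23 R M <= pow23 R N.
Proof.
move=> MN; apply: ge0_ler_powR; rewrite ?nnegrE ?ler_nat //.
Qed.

Lemma pow23_ge1 N : (0 < N)%N -> 1 <= pow23 R N.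
Proof. by move=> /pow23_le; rewrite {1}/pow23 powR1. Qed.

(* By the Burke property the exit point estimates hold in the environment seen
   from (i0, j0). *)
Lemma path_estimate : exists2 C : R, 1 <= C & forall D i0 j0 M n N (x : R) (f : config -> bool),
  (0 < M <= N)%N -> `|n%:R - kap * M%:R| <= D -> D <= M%:R ->
  2 <= x -> C * (pow23 R N + D) <= x ->
  (forall c, f c -> exists2 k', x <= k'%:R &
    oreach c (i0 + k', j0)%N (i0 + M, j0 + n)%N \/
    oreach c (i0, j0 + k')%N (i0 + M, j0 + n)%N) ->
  E0 (i0 + M) (j0 + n) (fun c => (f c)%:R) <= C * N%:R ^+ 2 / x ^+ 3.
Proof.
have [C C1 H] := exit_estimate hp hu.
(* Rounding x down to k >= x / 2 costs a factor 8, and the two axes double it. *)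
exists (16 * C); first lra.
move=> D i0 j0 M n N x f /andP[M0 MN] hd DM x2 xC hf.
have D0 : 0 <= D by apply: le_trans hd.
have [_ Hh Hv] := H M n (pow23 R M) D M0 (pow23_ge0 M) (pow23_cube M) hd DM.
pose k := Num.truncn x.
have x0 : 0 <= x by lra.
have kx : k%:R <= x by rewrite /k truncn_le.
have xk : x < k%:R + 1 by rewrite natr1 truncnS_gt.
have kx2 : x / 2 <= k%:R by lra.
have k0 : (0 < k)%N by rewrite -(ltr0n R); lra.
have kC : C * (pow23 R M + D) <= k%:R.
  have h1 : C * (pow23 R M + D) <= C * (pow23 R N + D).
    by apply: ler_wpM2l; [lra | rewrite lerD2r pow23_le].
  have h2 : 0 <= C * (pow23 R N + D).
    by rewrite mulr_ge0 ?addr_ge0 ?pow23_ge0 //; lra.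
  lra.
have bnd (q : R) (b : bool) : 0 <= q -> (b -> q * k%:R ^+ 3 <= C * M%:R ^+ 2) ->
    b%:R * q <= 8 * C * N%:R ^+ 2 / x ^+ 3.
  move=> q0; have r0 : 0 <= 8 * C * N%:R ^+ 2 / x ^+ 3.
    by rewrite divr_ge0 ?exprn_ge0 // mulr_ge0 ?sqr_ge0 //; lra.
  case: b => [/(_ isT) h|_]; last by rewrite mul0r.
  rewrite mul1r ler_pdivlMr; last by rewrite exprn_gt0 //; lra.
  have h1 : x ^+ 3 <= 8 * k%:R ^+ 3.
    have -> : 8 * k%:R ^+ 3 = (2 * k%:R) ^+ 3 :> R by rewrite exprMn; congr (_ * _); ring.
    by rewrite lerXn2r ?nnegrE //; lra.
  have h2 : (M%:R : R) ^+ 2 <= N%:R ^+ 2 by rewrite lerXn2r ?nnegrE ?ler_nat.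
  have h3 : q * x ^+ 3 <= q * (8 * k%:R ^+ 3) by apply: ler_wpM2l.
  have h4 : C * M%:R ^+ 2 <= C * N%:R ^+ 2 by apply: ler_wpM2l => //; lra.
  by rewrite -mulrA; lra.
apply: (@le_trans _ _ (E0 (i0 + M) (j0 + n) (fun c =>
   ((k <= M)%N && through k (shift i0 j0 c) M n)%:R +
   ((k <= n)%N && through k (swapc (shift i0 j0 c)) n M)%:R))).
  apply: expect_le => c; case fc: (f c); last by rewrite addr_ge0.
  have [k' xk' r] := hf c fc.
  have kk : (0 < k <= k')%N by rewrite k0 -(ler_nat R); lra.
  by case: r => [/(shifted_hor kk)|/(shifted_ver kk)] -> /=; rewrite ?lerDl ?lerDr.
rewrite /expect ExD.
have := expect_through_hor i0 j0 M n k; have := expect_through_ver i0 j0 M n k.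
rewrite /expect => -> ->.
have -> : 16 * C * N%:R ^+ 2 / x ^+ 3 =
  8 * C * N%:R ^+ 2 / x ^+ 3 + 8 * C * N%:R ^+ 2 / x ^+ 3 by ring.
apply: lerD; apply: bnd; try by apply: through_prob_ge0.
- by move=> kM; apply: Hh; rewrite ?k0.
- by move=> kM; apply: Hv; rewrite ?k0.
Qed.

End PathFluctuations.

Section Deviation.

Local Open Scope classical_set_scope.
Local Open Scope ring_scope.

Lemma le_truncn_nat (R : realType) (n : nat) (x : R) : n%:R <= x -> (n <= Num.truncn x)%N.
Proof. by move=> h; rewrite -ltnS -(ltr_nat R); apply: le_lt_trans h (truncnS_gt _). Qed.

Section Attained.
Variables (om : nat -> nat -> bool) (m n : nat).

Lemma row_last_attained j : row_last om m n j = 0%N \/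
  (row_last om m n j, j) \in rightmost_path om (m, n).
Proof.
rewrite /row_last; set Q := fun i : 'I_m.+1 => (i : nat, j) \in rightmost_path om (m, n).
by have [->|[i Qi ->]] := @bigmaxn_attained _ (index_enum _) Q (@nat_of_ord _); [left|right].
Qed.

Lemma col_last_attained i : col_last om m n i = 0%N \/
  (i, col_last om m n i) \in rightmost_path om (m, n).
Proof.
rewrite /col_last; set Q := fun j : 'I_n.+1 => (i, j : nat) \in rightmost_path om (m, n).
by have [->|[j Qj ->]] := @bigmaxn_attained _ (index_enum _) Q (@nat_of_ord _); [left|right].
Qed.

Lemma row_first_attained j : row_first om m n j = m \/
  (row_first om m n j, j) \in rightmost_path om (m, n).
Proof.
rewrite /row_first; set Q := fun i : 'I_m.+1 => (i : nat, j) \in rightmost_path om (m, n).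
by have [->|[i Qi ->]] := @bigminn_attained _ (index_enum _) Q (@nat_of_ord _) m; [left|right].
Qed.

Lemma col_first_attained i : col_first om m n i = n \/
  (i, col_first om m n i) \in rightmost_path om (m, n).
Proof.
rewrite /col_first; set Q := fun j : 'I_n.+1 => (i, j : nat) \in rightmost_path om (m, n).
by have [->|[j Qj ->]] := @bigminn_attained _ (index_enum _) Q (@nat_of_ord _) n; [left|right].
Qed.

End Attained.

(** * Reduction of the four deviations to long stretches on an axis *)

Section DeviationEstimate.
Variables (R : realType) (p u : R).
Hypotheses (hp : 0 < p < 1) (hu : 0 < u < 1).
Local Notation kap := (slope p u).
Local Notation E0 := (expect p u (vert_param p u)).
Local Notation s := (pow23 R).
Local Notation n_ := (n_u p u).

Lemma n_u_bounds N : (n_ N)%:R <= kap * N%:R < (n_ N)%:R + 1.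
Proof.
have k0 := slope_gt0 hp hu.
have e : N%:R / p * (p + (1 - p) * u) ^+ 2 = kap * N%:R by rewrite /slope; ring.
by rewrite /n_u e truncn_le ?natr1 ?truncnS_gt // mulr_ge0 // ltW.
Qed.

(** At most 1 / 2, kap / 2 and 1 / (2 kap), so that one lower bound covers the axis stretches of all
    four deviations, see [scaled_ge]. *)
Let cc := kap / (2 * (1 + kap) ^+ 2).
(** Covers the distance from the characteristic caused by rounding the corners to integers. *)
Let D := 4 + kap.

Let cc_gt0 : 0 < cc.
Proof.
have k0 := slope_gt0 hp hu; rewrite /cc divr_gt0 // mulr_gt0 // exprn_gt0 //.
by rewrite addr_gt0.
Qed.

Let cc_le : [/\ cc <= 1 / 2, cc <= kap / 2 & cc <= kap^-1 / 2].
Proof.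
have k0 := slope_gt0 hp hu; have k1 : 0 < 1 + kap by lra.
rewrite /cc invfM mulrA; split.
- rewrite mul1r -mulrA mulrC -mulrA -[leRHS]mulr1; apply: ler_wpM2l => //.
  by rewrite mulrC ler_pdivrMr ?exprn_gt0 // mul1r; nra.
- rewrite -[leRHS]mulr1; apply: ler_wpM2l; first by rewrite divr_ge0 // ltW.
  by rewrite invf_le1 ?exprn_gt0 // exprn_ege1 //; lra.
- rewrite -mulrA mulrCA [leRHS]mulrC; apply: ler_wpM2l => //.
  rewrite ler_pdivrMr ?exprn_gt0 // mulrC ler_pdivlMr //.
  by rewrite -expr2 lerXn2r ?nnegrE //; lra.
Qed.

(** [path_estimate] at x = cc b N^(2/3): the factor N^2 in x^3 cancels and b^-3 is left. *)
Lemma corner_estimate tau : 0 <= tau < 1 ->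
  exists2 B : R, 0 < B & forall N (b : R) i0 j0 (f : config -> bool),
    (0 < N)%N -> B <= b -> i0%:R <= tau * N%:R -> (j0 <= n_ N)%N ->
    D <= (1 - tau) * N%:R ->
    `|(n_ N - j0)%:R - kap * (N - i0)%:R| <= D ->
    (forall c, f c -> exists2 k', cc * b * s N <= k'%:R &
      oreach c (i0 + k', j0)%N (N, n_ N) \/ oreach c (i0, j0 + k')%N (N, n_ N)) ->
    E0 N (n_ N) (fun c => (f c)%:R) <= B * b ^- 3.
Proof.
move=> /andP[t0 t1]; have [C C1 H] := path_estimate hp hu.
have k0 := slope_gt0 hp hu; have D4 : 4 < D by rewrite /D; lra.
have c0 := cc_gt0; have [c1 _ _] := cc_le.
have B10 : 0 < C * (1 + D) / cc by rewrite divr_gt0 // mulr_gt0 //; lra.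
have B20 : 0 < C / cc ^+ 3 by rewrite divr_gt0 ?exprn_gt0 //; lra.
exists (C * (1 + D) / cc + C / cc ^+ 3); first by rewrite addr_gt0.
move=> N b i0 j0 f N0 Bb i0t j0n DN hd hf.
have s1 := pow23_ge1 R N0.
have N1 : 1 <= (N%:R : R) by rewrite ler1n.
have b0 : 0 < b by lra.
have iN : (i0 < N)%N by rewrite -(ltr_nat R); apply: (le_lt_trans i0t); rewrite -[ltRHS]mul1r ltr_pM2r; lra.
have bC : C * (1 + D) <= cc * b by rewrite [leRHS]mulrC -ler_pdivrMr //; lra.
have xs : C * (1 + D) * s N <= cc * b * s N by apply: ler_wpM2r => //; lra.
have xC : C * (s N + D) <= cc * b * s N.
  apply: le_trans xs; rewrite -mulrA; apply: ler_wpM2l; first lra.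
  by rewrite mulrDl mul1r lerD2l -[leLHS]mulr1; apply: ler_wpM2l; lra.
have x2 : 2 <= cc * b * s N.
  apply: le_trans xC; have h : 0 <= s N + D by lra.
  have : 1 * (s N + D) <= C * (s N + D) by apply: ler_wpM2r.
  lra.
have := H D i0 j0 (N - i0)%N (n_ N - j0)%N N (cc * b * s N) f.
rewrite (subnKC (ltnW iN)) (subnKC j0n) subn_gt0 iN leq_subr; move=> /(_ isT hd).
have DM : D <= (N - i0)%:R.
  by rewrite natrB 1?ltnW //; apply: (le_trans DN); rewrite mulrBl mul1r lerD2l lerN2.
move=> /(_ DM x2 xC hf) /le_trans; apply.
have E (z M : R) : 0 < z -> 0 < M -> s N ^+ 3 = M ^+ 2 ->
    C * M ^+ 2 / (z * b * s N) ^+ 3 = C / z ^+ 3 * b ^- 3.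
  move=> z0 M0 sM; rewrite !exprMn sM; field.
  by rewrite !gt_eqF.
rewrite (E _ _ c0 _ (pow23_cube _ N)) ?ltr0n //.
by apply: ler_wpM2r; [rewrite invr_ge0 exprn_ge0 // ltW | lra].
Qed.

Definition path_of c N := rightmost_path (fun i j => c (i, j)) (N, n_ N).

Lemma path_ofP c N i j : (i, j) \in path_of c N -> oreach c (i, j) (N, n_ N).
Proof. exact: rightmost_oreach. Qed.

Section Deviations.
Variables (tau b : R) (N : nat).
Hypotheses (htau : 0 <= tau < 1) (N0 : (0 < N)%N).
Hypothesis hb : 4 + 4 / kap + 4 * kap <= b.
Local Notation X := (b * s N).
Local Notation n := ((n_ N)%:R : R).
Local Notation i0 := (Num.truncn (tau * N%:R)).
Local Notation j0 := (Num.truncn (tau * n)).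

Lemma scaled_ge : [/\ 0 < b, cc * b * s N <= X,
  cc * b * s N <= kap * X - 2 & cc * b * s N <= kap^-1 * X - 2].
Proof.
have k0 := slope_gt0 hp hu; have s1 := pow23_ge1 R N0; have [c1 c2 c3] := cc_le.
have ki : 0 < kap^-1 by rewrite invr_gt0.
have hb' := hb; have b0 : 0 < b by lra.
have bX : b <= X by rewrite -[leLHS]mulr1; apply: ler_wpM2l => //; exact: ltW.
have X0 : 0 <= X by lra.
rewrite -mulrA; have e1 := ler_wpM2r X0 c1; have e2 := ler_wpM2r X0 c2.
have e3 := ler_wpM2r X0 c3.
have f1 : kap * (4 * kap^-1) <= kap * X by apply: ler_wpM2l; lra.
have f2 : kap^-1 * (4 * kap) <= kap^-1 * X by apply: ler_wpM2l; lra.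
have g1 : kap * (4 * kap^-1) = 4 by field; rewrite gt_eqF.
have g2 : kap^-1 * (4 * kap) = 4 by field; rewrite gt_eqF.
by split; lra.
Qed.

Let basics : [/\ [/\ 0 < kap, 0 <= n, n <= kap * N%:R & kap * N%:R <= n + 1],
  [/\ i0%:R <= tau * N%:R, tau * N%:R <= i0%:R + 1, j0%:R <= tau * n
    & tau * n <= j0%:R + 1] &
  [/\ tau * n <= kap * (tau * N%:R), kap * (tau * N%:R) <= tau * n + 1,
     kap * i0%:R <= kap * (tau * N%:R), kap * (tau * N%:R) <= kap * i0%:R + kap
     & tau * n <= n]].
Proof.
have k0 := slope_gt0 hp hu; have /andP[n1 n2] := n_u_bounds N; case/andP: htau => t0 t1.
have iN : 0 <= tau * N%:R by rewrite mulr_ge0.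
have jN : 0 <= tau * n by rewrite mulr_ge0.
have i1 : i0%:R <= tau * N%:R by rewrite truncn_le.
have i2 : tau * N%:R <= i0%:R + 1 by rewrite ltW // natr1 truncnS_gt.
split; split=> //; rewrite ?truncn_le ?natr1 ?(ltW (truncnS_gt _)) //.
- by rewrite -natr1 ltW.
- by rewrite mulrCA; apply: ler_wpM2l.
- rewrite mulrCA; apply: (@le_trans _ _ (tau * (n + 1))); last lra.
  by apply: ler_wpM2l => //; exact: ltW.
- by apply: ler_wpM2l => //; exact: ltW.
- by rewrite -[X in _ + X]mulr1 -mulrDr; apply: ler_wpM2l => //; exact: ltW.
- by rewrite -[leRHS]mul1r; apply: ler_wpM2r => //; exact: ltW.
Qed.

Let nat_le (a c : nat) : (a%:R : R) < c%:R + 1 -> (a <= c)%N.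
Proof. by rewrite natr1 ltr_nat. Qed.

Lemma corner_dist i j : (i <= N)%N -> (j <= n_ N)%N ->
  - 1 - kap <= kap * i%:R - j%:R <= 2 + kap ->
  `|(n_ N - j)%:R - kap * (N - i)%:R| <= D.
Proof.
move=> iN jn /andP[h1 h2]; have [[k0 n0 n1 n2] _ _] := basics.
rewrite !natrB // ler_norml /D; apply/andP; split; lra.
Qed.

Lemma row_last_reach c : tau * N%:R + X <
    (row_last (fun i j => c (i, j)) N (n_ N) j0)%:R ->
  exists2 k', X <= k'%:R & oreach c (i0 + k', j0)%N (N, n_ N).
Proof.
have [[k0 n0 n1 n2] [i1 i2 j1 j2] [t1 t2 t3 t4 t5]] := basics.
have [b0 _ _ _] := scaled_ge; have X0 : 0 <= X by rewrite mulr_ge0 ?pow23_ge0 ?ltW.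
have iN : 0 <= tau * N%:R by case/andP: htau => *; rewrite mulr_ge0.
have [->|] := row_last_attained (fun i j => c (i, j)) N (n_ N) j0; first by move=> h; exfalso; lra.
set i := row_last _ _ _ _ => iP h.
have ii : (i0 <= i)%N by apply: nat_le; lra.
exists (i - i0)%N; first by rewrite natrB //; lra.
by rewrite subnKC //; apply: path_ofP.
Qed.

Lemma col_last_reach c : tau * n + X <
    (col_last (fun i j => c (i, j)) N (n_ N) i0)%:R ->
  exists2 k', X <= k'%:R & oreach c (i0, j0 + k')%N (N, n_ N).
Proof.
have [[k0 n0 n1 n2] [i1 i2 j1 j2] [t1 t2 t3 t4 t5]] := basics.
have [b0 _ _ _] := scaled_ge; have X0 : 0 <= X by rewrite mulr_ge0 ?pow23_ge0 ?ltW.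
have iN : 0 <= tau * n by case/andP: htau => *; rewrite mulr_ge0.
have [->|] := col_last_attained (fun i j => c (i, j)) N (n_ N) i0; first by move=> h; exfalso; lra.
set i := col_last _ _ _ _ => iP h.
have ii : (j0 <= i)%N by apply: nat_le; lra.
exists (i - j0)%N; first by rewrite natrB //; lra.
by rewrite subnKC //; apply: path_ofP.
Qed.

(** When X > tau N the deviation to the left is empty, and 0 keeps the corner in the rectangle. *)
Let i1 := Num.truncn (Num.max (tau * N%:R - X) 0).
Let j1 := Num.truncn (kap * i1%:R).

(** A path too far to the left on row j0 is at or above this row when it reaches column i1, whereas
    the characteristic crosses that column about kap X lower. Seen from (i1, j1) it thus visits the
    vertical axis at height about kap X. *)
Lemma row_first_reach c :
  (row_first (fun i j => c (i, j)) N (n_ N) j0)%:R < tau * N%:R - X ->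
  exists2 k', kap * X - 2 <= k'%:R & oreach c (i1, j1 + k')%N (N, n_ N).
Proof.
have [[k0 n0 n1 n2] [a1 a2 b1 b2] [t1 t2 t3 t4 t5]] := basics.
have [b0 _ bX _] := scaled_ge; have X0 : 0 <= X by rewrite mulr_ge0 ?pow23_ge0 ?ltW.
have tN : tau * N%:R <= N%:R by case/andP: htau => *; rewrite -[leRHS]mul1r; apply: ler_wpM2r => //; exact: ltW.
have [->|] := row_first_attained (fun i j => c (i, j)) N (n_ N) j0; first by move=> h; exfalso; lra.
set i := row_first _ _ _ _ => iP h.
have y0 : 0 <= tau * N%:R - X by apply: le_trans (ltW h).
have i1E : i1 = Num.truncn (tau * N%:R - X) by rewrite /i1 max_l.
have i1y : i1%:R <= tau * N%:R - X by rewrite i1E truncn_le.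
have ii : (i <= i1)%N by rewrite i1E le_truncn_nat // ltW.
have iN : (i1 <= N)%N by rewrite -(ler_nat R); lra.
have ij : ((i, j0).1 <= i1 <= (N, n_ N).1)%N by rewrite /= ii.
have [j [r1 r2]] := oreach_col (path_ofP iP) ij.
have [_ /= jj] := oreach_le r1.
have j1y : j1%:R <= kap * i1%:R by rewrite /j1 truncn_le // mulr_ge0 // ltW.
have h2 : kap * i1%:R <= kap * (tau * N%:R - X) by apply: ler_wpM2l => //; exact: ltW.
have jjR : (j0%:R : R) <= j%:R by rewrite ler_nat.
have cX : 0 <= cc * b * s N by rewrite mulr_ge0 ?pow23_ge0 // mulr_ge0 // ltW.
have jj1 : (j1 <= j)%N by rewrite -(ler_nat R); lra.
exists (j - j1)%N; first by rewrite natrB //; lra.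
by rewrite subnKC.
Qed.

Let j2 := Num.truncn (Num.max (tau * n - X) 0).
Let i2 := Num.truncn (j2%:R / kap).

Lemma col_first_reach c :
  (col_first (fun i j => c (i, j)) N (n_ N) i0)%:R < tau * n - X ->
  exists2 k', kap^-1 * X - 2 <= k'%:R & oreach c (i2 + k', j2)%N (N, n_ N).
Proof.
have [[k0 n0 n1 n2] [a1 a2 b1 b2] [t1 t2 t3 t4 t5]] := basics.
have [b0 _ _ bX] := scaled_ge; have X0 : 0 <= X by rewrite mulr_ge0 ?pow23_ge0 ?ltW.
have [->|] := col_first_attained (fun i j => c (i, j)) N (n_ N) i0; first by move=> h; exfalso; lra.
set j := col_first _ _ _ _ => jP h.
have y0 : 0 <= tau * n - X by apply: le_trans (ltW h).
have j2E : j2 = Num.truncn (tau * n - X) by rewrite /j2 max_l.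
have j2y : j2%:R <= tau * n - X by rewrite j2E truncn_le.
have jj : (j <= j2)%N by rewrite j2E le_truncn_nat // ltW.
have jN : (j2 <= n_ N)%N by rewrite -(ler_nat R); lra.
have ij : ((i0, j).2 <= j2 <= (N, n_ N).2)%N by rewrite /= jj.
have [i [r1 r2]] := oreach_row (path_ofP jP) ij.
have [/= ii _] := oreach_le r1.
have i2y : i2%:R <= j2%:R / kap by rewrite /i2 truncn_le // divr_ge0 // ltW.
have h2 : j2%:R / kap <= (tau * n - X) / kap by apply: ler_wpM2r => //; rewrite invr_ge0 ltW.
have h3 : (tau * n - X) / kap <= tau * N%:R - kap^-1 * X.
  by rewrite mulrBl [X / kap]mulrC lerD2r ler_pdivrMr // [leRHS]mulrC.
have iiR : (i0%:R : R) <= i%:R by rewrite ler_nat.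
have cX : 0 <= cc * b * s N by rewrite mulr_ge0 ?pow23_ge0 // mulr_ge0 // ltW.
have ii1 : (i2 <= i)%N by rewrite -(ler_nat R); lra.
exists (i - i2)%N; first by rewrite natrB //; lra.
by rewrite subnKC.
Qed.

Lemma corners : [/\ (i0 <= N)%N /\ (j0 <= n_ N)%N,
  [/\ (i1%:R : R) <= tau * N%:R, (j1 <= n_ N)%N &
    `|(n_ N - j1)%:R - kap * (N - i1)%:R| <= D],
  [/\ (i2%:R : R) <= tau * N%:R, (j2 <= n_ N)%N &
    `|(n_ N - j2)%:R - kap * (N - i2)%:R| <= D] &
  `|(n_ N - j0)%:R - kap * (N - i0)%:R| <= D].
Proof.
have [[k0 n0 n1 n2] [a1 a2 b1 b2] [t1 t2 t3 t4 t5]] := basics.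
have [b0 _ _ bX] := scaled_ge; have X0 : 0 <= X by rewrite mulr_ge0 ?pow23_ge0 ?ltW.
have tN : tau * N%:R <= N%:R by case/andP: htau => *; rewrite -[leRHS]mul1r; apply: ler_wpM2r => //; exact: ltW.
have tN0 : 0 <= tau * N%:R by case/andP: htau => *; rewrite mulr_ge0.
have tn0 : 0 <= tau * n by case/andP: htau => *; rewrite mulr_ge0.
have i1t : (i1%:R : R) <= tau * N%:R.
  apply: (@le_trans _ _ (Num.max (tau * N%:R - X) 0)).
    by rewrite truncn_le // le_max lexx orbT.
  by rewrite ge_max tN0 andbT; lra.
have j2t : (j2%:R : R) <= tau * n.
  apply: (@le_trans _ _ (Num.max (tau * n - X) 0)).
    by rewrite truncn_le // le_max lexx orbT.
  by rewrite ge_max tn0 andbT; lra.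
have j1y : j1%:R <= kap * i1%:R by rewrite /j1 truncn_le // mulr_ge0 // ltW.
have j1z : kap * i1%:R <= j1%:R + 1 by rewrite ltW // natr1 truncnS_gt.
have k1 : kap * i1%:R <= kap * N%:R by apply: ler_wpM2l; lra.
have i2y : i2%:R <= j2%:R / kap by rewrite /i2 truncn_le // divr_ge0 // ltW.
have i2z : j2%:R / kap <= i2%:R + 1 by rewrite ltW // natr1 truncnS_gt.
have i2y' : kap * i2%:R <= j2%:R by rewrite mulrC -ler_pdivlMr.
have i2z' : j2%:R <= kap * i2%:R + kap by move: i2z; rewrite ler_pdivrMr // mulrDl mul1r mulrC.
have i2t : (i2%:R : R) <= tau * N%:R.
  apply: (le_trans i2y); rewrite ler_pdivrMr // [leRHS]mulrC; lra.
have i0N : (i0 <= N)%N by rewrite -(ler_nat R); lra.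
have j0n : (j0 <= n_ N)%N by rewrite -(ler_nat R); lra.
have i1N : (i1 <= N)%N by rewrite -(ler_nat R); lra.
have i2N : (i2 <= N)%N by rewrite -(ler_nat R); lra.
have j2n : (j2 <= n_ N)%N by rewrite -(ler_nat R); lra.
have j1n : (j1 <= n_ N)%N.
  have [_ ] := andP (n_u_bounds N) => h; apply: nat_le; lra.
have dist := corner_dist.
clear -dist i0N j0n i1N j1n i2N j2n i1t i2t j1y j1z i2y' i2z' a1 a2 b1 b2 t1 t2 t3 t4 k0.
split=> //; [split=> //|split=> //|]; apply: dist => //; lra.
Qed.

End Deviations.

Definition hor_dev tau b N c : bool :=
  let j := Num.truncn (tau * (n_ N)%:R) in
  ((row_first (fun i j => c (i, j)) N (n_ N) j)%:R < tau * N%:R - b * s N) ||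
  (tau * N%:R + b * s N < (row_last (fun i j => c (i, j)) N (n_ N) j)%:R).

Definition ver_dev tau b N c : bool :=
  let i := Num.truncn (tau * N%:R) in
  ((col_first (fun i j => c (i, j)) N (n_ N) i)%:R < tau * (n_ N)%:R - b * s N) ||
  (tau * (n_ N)%:R + b * s N < (col_last (fun i j => c (i, j)) N (n_ N) i)%:R).

Lemma path_supported N : supported (rect N (n_ N)) (fun c => path_of c N).
Proof. by move=> x y xy; apply: eq_rightmost_path xy _ _. Qed.

Lemma hor_dev_supported tau b N : supported (rect N (n_ N)) (hor_dev tau b N).
Proof.
move=> x y /path_supported; rewrite /hor_dev /row_first /row_last /path_of.
by move=> ->.
Qed.

Lemma ver_dev_supported tau b N : supported (rect N (n_ N)) (ver_dev tau b N).
Proof.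
move=> x y /path_supported; rewrite /ver_dev /col_first /col_last /path_of.
by move=> ->.
Qed.

Lemma expect_or m n (f g : config -> bool) :
  E0 m n (fun c => (f c || g c)%:R) <=
  E0 m n (fun c => (f c)%:R) + E0 m n (fun c => (g c)%:R).
Proof.
rewrite /expect -ExD; apply: (expect_le hp hu) => c.
by case: (f c); case: (g c); rewrite /= ?addr0 ?add0r // lerDl.
Qed.

(** Handles the small N with (1 - tau) N < D: for b large the allowed window contains the whole
    rectangle. *)
Lemma no_dev tau b N c : 0 <= tau < 1 -> N%:R <= b * s N ->
  (n_ N)%:R <= b * s N -> hor_dev tau b N c = false /\ ver_dev tau b N c = false.
Proof.
move=> /andP[t0 t1] NX nX; have tN : 0 <= tau * N%:R by rewrite mulr_ge0.
have tn : 0 <= tau * (n_ N)%:R by rewrite mulr_ge0.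
have tN1 : tau * N%:R <= N%:R by rewrite -[leRHS]mul1r; apply: ler_wpM2r => //; exact: ltW.
have tn1 : tau * (n_ N)%:R <= (n_ N)%:R.
  by rewrite -[leRHS]mul1r; apply: ler_wpM2r => //; exact: ltW.
split; apply/negbTE; rewrite negb_or -!leNgt; apply/andP; split.
- by apply: le_trans (ler0n _ _); lra.
- have [->|/path_ofP/oreach_le[/= rN _]] :=
    row_last_attained (fun i j => c (i, j)) N (n_ N) (Num.truncn (tau * (n_ N)%:R)).
    by lra.
  by move: rN; rewrite -(ler_nat R); lra.
- by apply: le_trans (ler0n _ _); lra.
- have [->|/path_ofP/oreach_le[/= _ rN]] :=
    col_last_attained (fun i j => c (i, j)) N (n_ N) (Num.truncn (tau * N%:R)).
    by lra.
  by move: rN; rewrite -(ler_nat R); lra.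
Qed.

Lemma deviation_estimate tau : 0 <= tau < 1 ->
  exists C1 C2 : R, forall N b, (0 < N)%N -> C1 <= b ->
    E0 N (n_ N) (fun c => (hor_dev tau b N c)%:R) <= C2 * b ^- 3 /\
    E0 N (n_ N) (fun c => (ver_dev tau b N c)%:R) <= C2 * b ^- 3.
Proof.
move=> ht; have [B B0 H] := corner_estimate ht.
have k0 := slope_gt0 hp hu; have /andP[t0 t1] := ht.
have B2 : 0 <= (1 + kap) * (D / (1 - tau)).
  by rewrite mulr_ge0 ?divr_ge0 ?subr_ge0 ?(ltW t1) // /D; lra.
have B1 : 0 <= 4 + 4 / kap + 4 * kap.
  have : 0 < 4 / kap by rewrite divr_gt0.
  by lra.
exists (B + (4 + 4 / kap + 4 * kap) + (1 + kap) * (D / (1 - tau))), (2 * B).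
move=> N b N0 Cb; have hb : 4 + 4 / kap + 4 * kap <= b by lra.
have s1 := pow23_ge1 R N0; have [b0 x1 x2 x3] := scaled_ge N0 hb.
have bX : b <= b * s N by rewrite -[leLHS]mulr1; apply: ler_wpM2l => //; exact: ltW.
have /andP[n1 n2] := n_u_bounds N.
have [DN|DN] := leP D ((1 - tau) * N%:R); last first.
  have ND : N%:R < D / (1 - tau) by rewrite ltr_pdivlMr ?subr_gt0 // mulrC.
  have h : kap * N%:R <= kap * (D / (1 - tau)) by apply: ler_wpM2l; apply: ltW.
  have h0 : 0 <= kap * N%:R by rewrite mulr_ge0 // ltW.
  have h1 := ler0n R N; move: ND h Cb B1 B0; set Q := D / _ => ND h Cb B1' B0'.
  have nd c : hor_dev tau b N c = false /\ ver_dev tau b N c = false.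
    by apply: no_dev => //; lra.
  have z (f : config -> bool) : (forall c, f c = false) ->
      E0 N (n_ N) (fun c => (f c)%:R) <= 2 * B * b ^- 3.
    move=> f0; rewrite /expect -(@eq_Ex _ _ _ _ (fun=> 0)) ?Ex_cst => [|c]; last by rewrite f0.
    by rewrite !mulr_ge0 ?invr_ge0 ?exprn_ge0 // ltW.
  by split; apply: z => c; have [] := nd c.
have [[i0N j0n] [i1t j1n d1] [i2t j2n d2] d0] := corners ht N0 hb.
have i0t : (Num.truncn (tau * N%:R))%:R <= tau * N%:R by rewrite truncn_le // mulr_ge0.
have -> : 2 * B * b ^- 3 = B * b ^- 3 + B * b ^- 3 by ring.
have Bb : B <= b by clear -Cb B1 B2; lra.
split; apply: (le_trans (expect_or _ _ _ _)); apply: lerD.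
- apply: (H N b _ _ _ N0 Bb i1t j1n DN d1) => c /(row_first_reach ht N0 hb)[k' kk r].
  by exists k'; [clear -kk x1 x2 x3; lra | right].
- apply: (H N b _ _ _ N0 Bb i0t j0n DN d0) => c /(row_last_reach ht N0 hb)[k' kk r].
  by exists k'; [clear -kk x1 x2 x3; lra | left].
- apply: (H N b _ _ _ N0 Bb i2t j2n DN d2) => c /(col_first_reach ht N0 hb)[k' kk r].
  by exists k'; [clear -kk x1 x2 x3; lra | left].
- apply: (H N b _ _ _ N0 Bb i0t j0n DN d0) => c /(col_last_reach ht N0 hb)[k' kk r].
  by exists k'; [clear -kk x1 x2 x3; lra | right].
Qed.

End DeviationEstimate.

Section DeviationProbability.
Context (R : realType) (d : measure_display) (T : measurableType d).
Variables (P : probability T R) (p u : R) (omega : nat -> nat -> {RV P >-> bool}).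
Hypotheses (hp : 0 < p < 1) (hu : 0 < u < 1).
Hypothesis homega : boundary_environment p u omega.

Lemma deviation_probability tau : 0 <= tau < 1 ->
  exists C1 C2 : R, forall (N : nat) (b : R), (1 <= N)%N -> C1 <= b ->
    (P (horizontal_deviation p u omega tau b N) <= (C2 * b ^- 3)%:E)%E /\
    (P (vertical_deviation p u omega tau b N) <= (C2 * b ^- 3)%:E)%E.
Proof.
move=> ht; have [C1 [C2 H]] := deviation_estimate hp hu ht.
exists C1, C2 => N b N0 Cb; have [h1 h2] := H N b N0 Cb.
have -> : horizontal_deviation p u omega tau b N =
    [set t | hor_dev p u tau b N (fun v => omega v.1 v.2 t)].
  by apply/seteqP; split=> t /=; rewrite /hor_dev => /orP.
have -> : vertical_deviation p u omega tau b N =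
    [set t | ver_dev p u tau b N (fun v => omega v.1 v.2 t)].
  by apply/seteqP; split=> t /=; rewrite /ver_dev => /orP.
rewrite (@boundary_environment_prob _ _ _ _ _ _ _ hp hu homega N (n_u p u N)); last exact: hor_dev_supported.
rewrite (@boundary_environment_prob _ _ _ _ _ _ _ hp hu homega N (n_u p u N)); last exact: ver_dev_supported.
by rewrite !lee_fin.
Qed.

End DeviationProbability.

End Deviation.

(** * Passage near a point *)

Definition axis k : seq site := [seq (i, 0)%N | i <- iota 1 k].

Lemma axis_uniq k : uniq (axis k).
Proof. by rewrite map_inj_uniq ?iota_uniq // => i j []. Qed.

Lemma size_axis k : size (axis k) = k.
Proof. by rewrite size_map size_iota. Qed.

Lemma mem_axis v k : (v \in axis k) = [&& (0 < v.1)%N, (v.1 <= k)%N & v.2 == 0%N].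
Proof.
apply/mapP/idP => [[i]|]; first by rewrite mem_iota => ik ->; rewrite /= eqxx; lia.
by case: v => i j /= /and3P[i0 ik /eqP ->]; exists i; rewrite // mem_iota; lia.
Qed.

Lemma axis_rect k M n : (k <= M)%N -> {subset axis k <= rect M n}.
Proof. by move=> kM [i j]; rewrite mem_axis mem_rect /= => /and3P[i0 ik /eqP ->]; lia. Qed.

Lemma take_axis j k : (j <= k)%N -> take j (axis k) = axis j.
Proof. by move=> jk; rewrite -map_take take_iota (minn_idPl jk). Qed.

Lemma sum_axis x k : (\sum_(v <- axis k) x v = G x k 0)%N.
Proof.
elim: k => [|k IH]; first by rewrite big_nil G00.
rewrite Gi0 -IH /axis -[k.+1]addn1 iotaD map_cat big_cat /= add1n.
by rewrite big_cons big_nil addn0 addn1.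
Qed.

(** Increments along row n read from right to left: index 1 is the step into (M, n). *)
Definition north M n y : config :=
  fun v => G y (M.+1 - v.1) n != G y (M - v.1) n.

Lemma eq_north M n k y y' : {in rect M n, y =1 y'} ->
  {in axis k, north M n y =1 north M n y'}.
Proof.
move=> yy [i j]; rewrite mem_axis /= => /and3P[i0 ik /eqP ->].
by rewrite /north !(@G_supported _ _ M n _ _ y y' yy) //=; lia.
Qed.

Lemma sum_north M n y k : (k <= M)%N ->
  (\sum_(v <- axis k) north M n y v + G y (M - k) n = G y M n)%N.
Proof.
elim: k => [|k IH] kM; first by rewrite big_nil subn0.
rewrite -(IH (ltnW kM)) /axis -[k.+1]addn1 iotaD map_cat big_cat /= add1n.
rewrite big_cons big_nil addn0 -addnA; congr addn.
rewrite /north /= addn1 subSS; have -> : (M - k = (M - k.+1).+1)%N by lia.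
have := (G_incr1 y (M - k.+1) n).1; have := G_right1 y (M - k.+1) n.
by case: eqP => /=; lia.
Qed.

Definition on_axes (v : site) : bool := (v.1 == 0%N) || (v.2 == 0%N).

Definition mix x y : config := fun v => if on_axes v then x v else y v.

Lemma bulk_mix x y : bulk (mix x y) = bulk y.
Proof. by apply/funext => -[[|i] [|j]]. Qed.

(* In the environment [rev M n x], some maximal path leaves the axes at
   distance at most k from the origin. *)
Definition near_exit M n k x : bool :=
  has (fun z => (G (rev M n x) M n <= G x z 0 + G (bulk x) (M - z) n)%N ||
     (G (rev M n x) M n <= G x 0 z + G (bulk x) M (n - z))%N) (iota 0 k.+1).

Lemma rev_axes M n x : (forall i, G (rev M n x) i 0 = G x i 0) /\
  (forall j, G (rev M n x) 0 j = G x 0 j).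
Proof.
split=> k; first by apply: G_i0_hor => i *; rewrite /rev /= andbF.
by apply: eq_G => i j; rewrite leqn0 => /eqP -> *; rewrite /rev.
Qed.

(* The bulk increments along the north side are sandwiched between those of
   two stationary environments [mix yp x] and [mix ym x], unless one of these
   has a maximal path that uses the wrong axis.  An exit near the origin then
   means that a walk built from the boundary weights of [x] and from these
   increments is almost maximal near its start. *)
Lemma near_exit_walks M n k z0 h x yp ym : (z0 <= M)%N -> (k <= M)%N -> (k <= n)%N ->
  near_exit M n k x ->
  [|| through 1 (swapc (mix yp x)) n (M - z0), through 1 (mix ym x) M n,
      below (axis z0) h x (north M n (mix yp x)),
      ~~ below (axis k) h x (north M n (mix ym x)) |
      ~~ below (axis k) h (swapc x) (north n M (swapc (mix yp x)))].
Proof.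
move=> z0M kM kn /hasP[z]; rewrite mem_iota add0n ltnS => /= zk near.
case Tp: (through _ (swapc _) _ _) => //=; move/negbT in Tp.
case Tm: (through _ _ _ _) => //=; move/negbT in Tm.
case bp: (below _ _ _ _) => //=; move/negbT in bp.
apply/negPn; rewrite negb_or !negbK; apply/negP => /andP[bm bv].
have [axh axv] := rev_axes M n x.
(* The walk for [yp] reaches h at some j <= z0. By [G_concat] the path along the axis to (j, 0) then
   beats an exit at distance z <= k, where the other walks are still below h. *)
have [j jz] := not_below bp; rewrite size_axis in jz.
have jM := leq_trans jz z0M.
rewrite take_axis // (sum_axis x) => hj.
have sj := sum_north n (mix yp x) jM.
have Ij := bulk_incr_right Tp (leq_sub2l M jz) (leq_subr j M).
rewrite bulk_mix in Ij.
have Gj := @G_concat (rev M n x) M n (M - j) n (leq_subr _ _) (leqnn _).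
rewrite revK subKn // subnn axh in Gj.
have zM := leq_trans zk kM; have zn := leq_trans zk kn.
have sm := sum_north n (mix ym x) zM.
have Im := bulk_incr_left Tm (leq_subr z M); rewrite bulk_mix in Im.
have hm := below_lt (below_take z bm); rewrite take_axis // sum_axis in hm.
have sv := sum_north M (swapc (mix yp x)) zn; rewrite !G_swap in sv.
have Iv := bulk_incr_up Tp (leq_subr z0 M) (leq_subr z n); rewrite bulk_mix in Iv.
have hv := below_lt (below_take z bv); rewrite take_axis // sum_axis G_swap in hv.
case/orP: near => near.
  move: hj sj Ij Gj sm Im hm near.
  set S1 := (\sum_(_ <- axis j) _)%N; set S2 := (\sum_(_ <- axis z) _)%N.
  lia.
move: hj sj Ij Gj sv Iv hv near.
set S1 := (\sum_(_ <- axis j) _)%N; set S2 := (\sum_(_ <- axis z) _)%N.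
lia.
Qed.

Lemma near_exit_supported M n k : (k <= M)%N -> (k <= n)%N ->
  supported (rect M n) (near_exit M n k).
Proof.
move=> kM kn x y xy; rewrite /near_exit; apply: eq_in_has => z.
rewrite mem_iota /= add0n ltnS => zk.
have e i j : (i <= M)%N -> (j <= n)%N -> G x i j = G y i j.
  by move=> iM jn; rewrite (G_supported iM jn xy).
have e' i j : (i <= M)%N -> (j <= n)%N -> G (bulk x) i j = G (bulk y) i j.
  move=> iM jn; apply: eq_G => a b aM bn ab; rewrite /bulk xy // mem_rect /=; lia.
have e'' : G (rev M n x) M n = G (rev M n y) M n.
  apply: eq_G => a b aM bn ab; rewrite /rev /=; case: ifP => h; apply: xy; rewrite mem_rect /=; lia.
rewrite e'' !e ?e' //; lia.
Qed.

Section NearExit.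
Variables (R : realFieldType) (p : R).
Local Notation E := (expect p).
Local Notation PT := (through_prob p).
Local Notation stationary := (stationary_pair p).

Lemma expect_mix a b a' b' M n (f : config -> R) :
  Ex (wprob p a' b') (rect M n) (fun x => E a b M n (fun y => f (mix y x))) =
  E a b M n f.
Proof.
rewrite /expect -(@Ex_comb _ _ (wprob p a' b') (wprob p a b) (wprob p a b)
  (fun v X Y => if on_axes v then Y else X)).
- by apply: eq_Ex => x; apply: eq_Ex => y; congr f; apply/funext => v.
- by move=> v; case: ifP.
- move=> v; case: ifP => av /=; first by ring.
  have -> : wprob p a b v = wprob p a' b' v.
    by move: av; rewrite /wprob /on_axes orbC => /norP[/negbTE -> /negbTE ->].
  by ring.
Qed.

(** As [g] reads only the axes of its first argument, the bulk of [x] can serve as the bulk of the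
    second environment without creating dependence. *)
Lemma expect_mix_pair a b a' b' M n (g : config -> config -> R) :
  (forall x w y, g (mix x w) y = g x y) ->
  E a b M n (fun x => E a' b' M n (fun y => g x (mix y x))) =
  E a b M n (fun x => E a' b' M n (fun y => g x y)).
Proof.
move=> gm; rewrite -[LHS](expect_mix a b a b).
have mm x w y : mix y (mix x w) = mix y w.
  by apply/funext => v; rewrite /mix; case: ifP => // ->.
transitivity (Ex (wprob p a b) (rect M n) (fun w => E a b M n (fun x =>
    E a' b' M n (fun y => g x (mix y w))))).
  by apply: eq_Ex => w; apply: eq_Ex => x; apply: eq_Ex => y; rewrite gm mm.
rewrite /expect Ex_swap; apply: eq_Ex => x.
exact: (expect_mix a' b' a b).
Qed.

Lemma expect_rev a b M n (f : config -> R) : supported (rect M n) f ->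
  E a b M n (fun x => f (rev M n x)) = E a b M n f.
Proof.
move=> fs; pose sg (v : site) : site :=
  if [&& (0 < v.1)%N, (0 < v.2)%N, (v.1 <= M)%N & (v.2 <= n)%N]
  then (M.+1 - v.1, n.+1 - v.2)%N else v.
have sgK : involutive sg.
  move=> [i j]; rewrite /sg /=.
  case ij: [&& (0 < i)%N, (0 < j)%N, (i <= M)%N & (j <= n)%N] => /=; last by rewrite ij.
  have -> : [&& (0 < M.+1 - i)%N, (0 < n.+1 - j)%N, (M.+1 - i <= M)%N & (n.+1 - j <= n)%N] by lia.
  by congr pair; lia.
have e x : rev M n x = x \o sg by apply/funext => v; rewrite /rev /sg /=; case: ifP.
have sgr v : v \in rect M n -> sg v \in rect M n.
  by case: v => i j; rewrite !mem_rect /sg /=; case: ifP => /=; lia.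
have sub : {subset map sg (rect M n) <= rect M n}.
  by move=> v /mapP[w wr ->]; apply: sgr.
rewrite /expect (Ex_supported _ sub); last first.
  move=> x y xy; rewrite !e; apply: fs => v vr /=; apply: xy; exact: map_f.
rewrite (@eq_Ex _ _ _ _ _ (fun x => f (x \o sg))) => [|x]; last by rewrite e.
rewrite (Ex_map _ _ _ (can_inj sgK)); apply: eq_Ex_param => -[[|i] [|j]] //= _.
rewrite /sg /=; case: ifP => // ij; rewrite /wprob /=.
have -> : (n.+1 - j.+1 == 0)%N = false by lia.
by have -> : (M.+1 - i.+1 == 0)%N = false by lia.
Qed.

(** By Burke the north side carries independent Ber(a') increments; the involution [sg] reverses
    their order to match [north]. *)
Lemma north_walk a b a' b' M n k h : stationary a' b' -> (k <= M)%N ->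
  E a b M n (fun x => E a' b' M n (fun y =>
    (below (axis k) h x (north M n y))%:R)) = stay a a' (axis k) h.
Proof.
move=> st kM.
pose sg (v : site) : site :=
  if [&& (0 < v.1)%N, (v.1 <= M)%N & v.2 == 0%N] then (M.+1 - v.1, 0)%N else v.
have sgK : involutive sg.
  move=> [i j]; rewrite /sg /=.
  case ij: [&& (0 < i)%N, (i <= M)%N & j == 0%N] => /=; last by rewrite ij.
  have -> : [&& (0 < M.+1 - i)%N, (M.+1 - i <= M)%N & 0%N == 0%N] by rewrite eqxx; lia.
  by move/and3P: ij => [i0 iM /eqP ->]; congr pair; lia.
have sub0 := axis_rect n kM.
rewrite /expect (Ex_supported _ sub0); last first.
  move=> x x' xx; apply: eq_Ex => y; congr (nat_of_bool _)%:R.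
  by apply: eq_below => // v vk; apply: xx.
rewrite /stay (@eq_Ex_param _ _ (wprob p a b) (fun=> a)); last first.
  by move=> [i j]; rewrite mem_axis /wprob /= => /and3P[_ _ ->].
apply: eq_Ex => x.
pose f y : R := (below (axis k) h x (y \o sg))%:R.
have sgM v : v \in axis k -> sg v \in rect M 0.
  case: v => i j; rewrite mem_axis mem_rect /sg /= => /and3P[i0 ik /eqP ->].
  by rewrite i0 (leq_trans ik kM) eqxx /=; lia.
have fs : supported (rect M 0) f.
  move=> y y' yy; congr (nat_of_bool _)%:R; apply: eq_below => // v vk /=.
  by apply: yy; apply: sgM.
have := @expect_shift _ _ a' b' 0 n M 0 f st fs; rewrite !add0n addn0 /expect => e.
rewrite (@eq_Ex _ _ _ _ _ (fun y => f (shift 0 n y))) => [|y]; last first.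
  congr (nat_of_bool _)%:R; apply: eq_below => // -[i j].
  rewrite mem_axis /= => /and3P[i0 ik /eqP ->].
  rewrite /sg /= i0 (leq_trans ik kM) eqxx /= /north /=.
  have -> : (M.+1 - i = (M - i).+1)%N by lia.
  by rewrite /= !add0n.
rewrite e; have sub : {subset map sg (axis k) <= rect M 0}.
  by move=> v /mapP[w wr ->]; apply: sgM.
rewrite (Ex_supported _ sub); last first.
  move=> y y' yy; congr (nat_of_bool _)%:R; apply: eq_below => // v vk /=.
  by apply: yy; apply: map_f.
rewrite /f (@Ex_map _ _ _ _ sg (axis k) (fun y => (below (axis k) h x y)%:R)); last exact: can_inj.
apply: eq_Ex_param => -[i j]; rewrite mem_axis /= => /and3P[i0 ik /eqP ->].
by rewrite /sg /wprob /= i0 (leq_trans ik kM) eqxx.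
Qed.

Lemma through_rect a b M n m' k : (m' <= M)%N ->
  E a b M n (fun x => (through k (swapc x) n m')%:R) = PT b a n m' k.
Proof.
move=> mM; pose f x : R := (through k x n m')%:R.
have fs : supported (rect n M) f.
  by move=> x y xy; rewrite /f (through_supported k (leqnn n) mM xy).
rewrite (@expect_swap _ _ a b M n f fs) /PT /expect.
apply: Ex_supported => [v|x y xy]; first by rewrite !mem_rect; lia.
by rewrite /f (through_supported k (leqnn n) (leqnn m') xy).
Qed.

Hypothesis hp : 0 < p < 1.

(** A union bound over the five alternatives of [near_exit_walks]. *)
Lemma near_exit_bound a b ap bp am bm M n k z0 h :
  0 <= a <= 1 -> 0 <= b <= 1 -> 0 <= ap <= 1 -> 0 <= bp <= 1 ->
  0 <= am <= 1 -> 0 <= bm <= 1 -> stationary ap bp -> stationary am bm ->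
  (z0 <= M)%N -> (k <= M)%N -> (k <= n)%N ->
  E a b M n (fun x => (near_exit M n k x)%:R) <=
  PT bp ap n (M - z0) 1 + PT am bm M n 1 + stay a ap (axis z0) h +
  (1 - stay a am (axis k) h) + (1 - stay b bp (axis k) h).
Proof.
move=> a01 b01 ap01 bp01 am01 bm01 stp stm z0M kM kn.
have cst2 (f : config -> R) : E a b M n f =
    E a b M n (fun x => E ap bp M n (fun yp => E am bm M n (fun ym => f x))).
  by rewrite /expect; apply: eq_Ex => x; rewrite !Ex_cst.
pose t1 x yp : R := (through 1 (swapc (mix yp x)) n (M - z0))%:R.
pose t2 x ym : R := (through 1 (mix ym x) M n)%:R.
pose t3 x yp : R := (below (axis z0) h x (north M n (mix yp x)))%:R.
pose t4 x ym : R := (below (axis k) h x (north M n (mix ym x)))%:R.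
pose t5 x yp : R := (below (axis k) h (swapc x) (north n M (swapc (mix yp x))))%:R.
rewrite cst2; apply: (@le_trans _ _ (E a b M n (fun x => E ap bp M n (fun yp =>
    E am bm M n (fun ym => t1 x yp + t2 x ym + t3 x yp + (1 - t4 x ym) + (1 - t5 x yp)))))).
  apply: le_Ex => [v|x]; first exact: wprob01.
  apply: le_Ex => [v|yp]; first exact: wprob01.
  apply: le_Ex => [v|ym]; first exact: wprob01.
  have := @near_exit_walks M n k z0 h x yp ym z0M kM kn.
  rewrite /t1 /t2 /t3 /t4 /t5.
  have neg (c : bool) : 1 - c%:R = (~~ c)%:R :> R by case: c; rewrite ?subrr ?subr0.
  rewrite !neg -!natrD ler_nat.
  case: (near_exit M n k x) => [/(_ isT)|//].
  by case: (through _ (swapc _) _ _); case: (through _ _ _ _);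
    case: (below (axis z0) _ _ _); case: (below _ _ _ _); case: (below _ _ _ _).
have E1 : E a b M n (fun x => E ap bp M n (fun yp => t1 x yp)) = PT bp ap n (M - z0) 1.
  rewrite -(through_rect ap bp _ _ (leq_subr z0 M)).
  exact: (expect_mix ap bp a b M n (fun y => (through 1 (swapc y) n (M - z0))%:R)).
have E2 : E a b M n (fun x => E am bm M n (fun ym => t2 x ym)) = PT am bm M n 1.
  exact: (expect_mix am bm a b M n (fun y => (through 1 y M n)%:R)).
have E3 : E a b M n (fun x => E ap bp M n (fun yp => t3 x yp)) =
    stay a ap (axis z0) h.
  rewrite -(@north_walk a b ap bp M n) // /t3.
  rewrite (@expect_mix_pair a b ap bp M n (fun x y =>
    (below (axis z0) h x (north M n y))%:R)) // => x w y.
  congr (nat_of_bool _)%:R; apply: eq_below => // -[i j].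
  by rewrite mem_axis /mix /on_axes /= => /and3P[_ _ ->]; rewrite orbT.
have E4 : E a b M n (fun x => E am bm M n (fun ym => t4 x ym)) =
    stay a am (axis k) h.
  rewrite -(@north_walk a b am bm M n) // /t4.
  rewrite (@expect_mix_pair a b am bm M n (fun x y =>
    (below (axis k) h x (north M n y))%:R)) // => x w y.
  congr (nat_of_bool _)%:R; apply: eq_below => // -[i j].
  by rewrite mem_axis /mix /on_axes /= => /and3P[_ _ ->]; rewrite orbT.
have E5 : E a b M n (fun x => E ap bp M n (fun yp => t5 x yp)) =
    stay b bp (axis k) h.
  rewrite -(@north_walk b a bp ap n M) //; last exact: stationaryC.
  rewrite /t5 (@expect_mix_pair a b ap bp M n (fun x y =>
    (below (axis k) h (swapc x) (north n M (swapc y)))%:R)); last first.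
    move=> x w y; congr (nat_of_bool _)%:R; apply: eq_below => // -[i j].
    by rewrite mem_axis /swapc /mix /on_axes /= => /and3P[_ _ /eqP ->].
  rewrite -(@expect_swap _ _ a b M n (fun x => E bp ap n M (fun y =>
    (below (axis k) h x (north n M y))%:R))); last first.
    move=> x x' xx; apply: eq_Ex => y; congr (nat_of_bool _)%:R.
    by apply: eq_below => // v /(axis_rect M kn); apply: xx.
  apply: eq_Ex => x.
  rewrite -(@expect_swap _ _ ap bp M n (fun y => (below (axis k) h (swapc x) (north n M y))%:R)) //.
  move=> y y' yy; congr (nat_of_bool _)%:R; apply: eq_below => //.
  exact: eq_north.
pose T3 F := E a b M n (fun x => E ap bp M n (fun yp => E am bm M n (F x yp))).
have T3D F F' : T3 (fun x yp ym => F x yp ym + F' x yp ym) = T3 F + T3 F'.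
  rewrite /T3 /expect -ExD; apply: eq_Ex => x; rewrite -ExD; apply: eq_Ex => yp.
  exact: ExD.
have T3N F : T3 (fun x yp ym => 1 - F x yp ym) = 1 - T3 F.
  transitivity (T3 (fun _ _ _ => 1) - T3 F); last first.
    by rewrite {1}/T3 /expect !Ex_cst.
  rewrite /T3 /expect -ExB; apply: eq_Ex => x; rewrite -ExB; apply: eq_Ex => yp.
  exact: ExB.
have T3p f : T3 (fun x yp _ => f x yp) = E a b M n (fun x => E ap bp M n (fun yp => f x yp)).
  by rewrite /T3 /expect; apply: eq_Ex => x; apply: eq_Ex => yp; rewrite Ex_cst.
have T3m f : T3 (fun x _ ym => f x ym) = E a b M n (fun x => E am bm M n (fun ym => f x ym)).
  by rewrite /T3 /expect; apply: eq_Ex => x; rewrite Ex_cst.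
rewrite -E1 -E2 -E3 -E4 -E5 -(T3p t1) -(T3m t2) -(T3p t3) -(T3m t4) -(T3p t5).
rewrite -(T3N (fun x _ ym => t4 x ym)) -(T3N (fun x yp _ => t5 x yp)).
by rewrite -!T3D.
Qed.

End NearExit.

(** * Use of the wrong axis at perturbed parameters *)

Section NearExitAsymptotics.
Variables (R : realType) (p u : R).
Hypotheses (hp : 0 < p < 1) (hu : 0 < u < 1).
Implicit Types (l D S : R).

Local Notation PT := (through_prob p).
Local Notation A := (exit_sum p).
Local Notation V := (G_var p).
Local Notation vert := (vert_param p).
Local Notation kap := (slope p u).

(** Uses the axis whose exit sum at l is at most its value at u: the vertical one for l >= u, the
    horizontal one for l < u. *)
Lemma G_var_bound D S m n l : `|n%:R - kap * m%:R| <= D -> 0 < l < 1 ->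
  A u (vert u) m n + A (vert u) u n m <= S ->
  V l (vert l) m n <= (2 * m%:R * `|l - u| + D) / p ^+ 2 + 2 * S.
Proof.
move=> hd hl hS; have hv := vert01 hp hu; have hvl := vert01 hp hl.
have a0 : 0 <= A u (vert u) m n by apply: sumr_ge0 => i _; apply: through_prob_ge0 => //; apply: ltW01.
have b0 : 0 <= A (vert u) u n m by apply: sumr_ge0 => i _; apply: through_prob_ge0 => //; apply: ltW01.
have /andP[u0 u1] := hu; have /andP[l0 l1] := hl; have /andP[v0 v1] := hv.
have /andP[w0 w1] := hvl.
have [ul|lu] := leP u l.
  apply: le_trans (G_var_le_vert hp hu hd hl) _; rewrite lerD2l ler_pM2l //.
  apply: (@le_trans _ _ (A (vert u) u n m)); last by lra.
  exact: (exit_sum_mono hp n m (ltW w0) (vert_anti hp hu hl ul) (ltW v1) (ltW u0) ul (ltW l1)).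
apply: le_trans (G_var_le_hor hp hu hd hl) _; rewrite lerD2l ler_pM2l //.
apply: (@le_trans _ _ (A u (vert u) m n)); last by lra.
exact: (exit_sum_mono hp m n (ltW l0) (ltW lu) (ltW u1) (ltW v0) (vert_anti hp hl hu (ltW lu)) (ltW w1)).
Qed.

(** Moving l back to u raises the weights of the axis in question, so G does not decrease if some
    maximal path uses that axis, whereas the mean drops by at least g. Chebyshev's inequality,
    through [exit_bound] with k = 1, makes this unlikely. *)
Lemma exit_off D S (g : R) m n l : `|n%:R - kap * m%:R| <= D -> 0 < l < 1 ->
  A u (vert u) m n + A (vert u) u n m <= S ->
  0 <= g -> g <= `|l - u| * (m%:R * (1 - p) * `|l - u| - D / p) ->
  (u <= l -> (0 < n)%N -> PT (vert l) l n m 1 * g ^+ 2 <=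
     4 * (2 * ((2 * m%:R * `|l - u| + D) / p ^+ 2 + 2 * S) + 2)) /\
  (l <= u -> (0 < m)%N -> PT l (vert l) m n 1 * g ^+ 2 <=
     4 * (2 * ((2 * m%:R * `|l - u| + D) / p ^+ 2 + 2 * S) + 2)).
Proof.
move=> hd hl hS g0 hg; have hv := vert01 hp hu; have hvl := vert01 hp hl.
have /andP[u0 u1] := hu; have /andP[l0 l1] := hl; have /andP[v0 v1] := hv.
have /andP[w0 w1] := hvl.
have D0 : 0 <= D by apply: le_trans hd.
have Vl := G_var_bound hd hl hS; have Vu := G_var_bound hd hu hS.
have mg := le_trans hg (mean_diff_ge hp hu hd hl).
have p2 : 0 <= (p ^+ 2)^-1 by rewrite invr_ge0 sqr_ge0.
have Vu' : V u (vert u) m n <= (2 * m%:R * `|l - u| + D) / p ^+ 2 + 2 * S.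
  apply: (le_trans Vu); rewrite lerD2r; apply: ler_wpM2r => //.
  by rewrite lerD2r subrr normr0 mulr0 mulr_ge0 // mulr_ge0.
have bern (z : R) : 0 < z < 1 -> 1 * (z * (1 - z)) <= 1.
  by move=> /andP[z0 z1]; rewrite mul1r; nra.
have PTm a b i j : 0 < a < 1 -> 0 < b < 1 -> 0 <= PT a b i j 1.
  by move=> ha hb; apply: through_prob_ge0 => //; apply: ltW01.
split=> lu k0.
- have := @exit_bound _ p hp (vert l) l (vert u) u n m 1.
  have vv : vert l <= vert u by apply: vert_anti.
  rewrite (ltW w0) w1 vv (ltW v1) (ltW01 hl) (ltW01 hu).
  have me : mean (vert u) u n m - mean (vert l) l n m =
      - (mean l (vert l) m n - mean u (vert u) m n) by rewrite /mean; ring.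
  rewrite me opprK !(G_var_swap p (vert _)) => /(_ isT isT isT isT isT k0).
  have gg : g <= 1 * (vert u - vert l) + (mean l (vert l) m n - mean u (vert u) m n).
    by lra.
  move=> /(_ (le_trans g0 gg)) main.
  apply: le_trans (le_trans main _).
    by apply: ler_wpM2l; [apply: PTm | rewrite lerXn2r ?nnegrE // (le_trans g0)].
  have := bern _ hv; have := bern _ hvl; lra.
- have := @exit_bound _ p hp l (vert l) u (vert u) m n 1.
  rewrite (ltW l0) l1 lu (ltW u1) (ltW01 hvl) (ltW01 hv).
  have me : mean u (vert u) m n - mean l (vert l) m n =
      - (mean l (vert l) m n - mean u (vert u) m n) by ring.
  rewrite me opprK => /(_ isT isT isT isT isT k0).
  have gg : g <= 1 * (u - l) + (mean l (vert l) m n - mean u (vert u) m n).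
    by lra.
  move=> /(_ (le_trans g0 gg)) main.
  apply: le_trans (le_trans main _).
    by apply: ler_wpM2l; [apply: PTm | rewrite lerXn2r ?nnegrE // (le_trans g0)].
  have := bern _ hu; have := bern _ hl; lra.
Qed.

Lemma vert_lip l : 0 < l < 1 -> `|vert l - vert u| <= `|l - u| / p.
Proof.
move=> hl; have [e1 e2] := den_inv hp hl; have [d1 d2] := den_inv hp hu.
have /andP[d3 _] := den_gt hp hu; have /andP[e3 _] := den_gt hp hl.
have /andP[p0 p1] := hp.
have -> : vert l - vert u =
    (l - u) * - (p * (l + p * (1 - l))^-1 * (u + p * (1 - u))^-1).
  by rewrite /vert_param; field; rewrite !gt_eqF //; lra.
rewrite normrM normrN; apply: ler_wpM2l => //.
rewrite ger0_norm; last by rewrite !mulr_ge0 // ?(ltW p0) // (le_trans ler01).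
apply: (@le_trans _ _ (p * p^-1 * p^-1)); last by rewrite divff ?gt_eqF // mul1r.
apply: ler_pM => //; rewrite ?mulr_ge0 // ?(ltW p0) ?(le_trans ler01) //.
by apply: ler_wpM2l => //; exact: ltW.
Qed.

(** With L = N^(1/3) and |l - u| = r / L the mean moves by order r^2 L, while the standard deviation
    is at most of order r^(1/2) L; the probability is of order r^-3. *)
Lemma exit_off_scale (th e : R) : 0 < th -> 0 < e -> exists2 r : R, 1 <= r &
  exists Lam : R, forall (L : R) N m n l, Lam <= L -> L ^+ 3 = N%:R ->
    L ^+ 2 = pow23 R N -> (m <= N)%N -> th * N%:R <= m%:R ->
    `|n%:R - kap * m%:R| <= (1 + kap) * L ^+ 2 -> `|l - u| = r / L -> 0 < l < 1 ->
    (u <= l -> PT (vert l) l n m 1 <= e) /\ (l <= u -> PT l (vert l) m n 1 <= e).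
Proof.
move=> th0 e0; have [C C1 H] := exit_estimate hp hu.
have k0 := slope_gt0 hp hu; have /andP[p0 p1] := hp.
pose K1 := 1 + kap; have K10 : 0 < K1 by rewrite /K1; lra.
pose K2 := (2 + K1) / p ^+ 2 + 2 * (C * (1 + K1)).
have K20 : 0 < K2.
  by rewrite addr_gt0 // ?divr_gt0 ?exprn_gt0 // ?mulr_gt0 //; lra.
pose q := 1 - p; have q0 : 0 < q by rewrite /q; lra.
pose K3 := 32 * (K2 + 1) / (th * q) ^+ 2.
have tq : 0 < th * q by rewrite mulr_gt0.
have K30 : 0 < K3 by rewrite divr_gt0 ?exprn_gt0 // mulr_gt0 //; lra.
(* The second term keeps the linear part of the drift below half of the quadratic part; the third
   gives K3 / r^3 <= e. *)
pose r := 1 + 2 * K1 / (p * (th * q)) + K3 / e.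
have h1 : 0 < 2 * K1 / (p * (th * q)) by rewrite divr_gt0 // mulr_gt0.
have h2 : 0 < K3 / e by rewrite divr_gt0.
have r1 : 1 <= r by rewrite /r; lra.
exists r => //; exists (1 + K1 / th + (K1 + 1) / (kap * th)).
move=> L N m n l LL L3 L2 mN thm hd hl hl01.
have g1 : 0 < K1 / th by rewrite divr_gt0.
have g2 : 0 < (K1 + 1) / (kap * th) by apply: divr_gt0; [apply: addr_gt0 | exact: mulr_gt0].
have L1 : 1 <= L by clear -LL g1 g2; lra.
have L0 : 0 < L by apply: lt_le_trans L1.
have LL2 : 0 < L ^+ 2 by rewrite exprn_gt0.
have M1 : th * L ^+ 3 <= m%:R by rewrite L3.
have KM : K1 * L ^+ 2 <= m%:R.
  apply: le_trans M1; rewrite [L ^+ 3]exprS mulrA; apply: ler_wpM2r; first exact: ltW.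
  by rewrite mulrC -ler_pdivrMr //; clear -LL g1 g2; lra.
have m0 : (0 < m)%N by rewrite -(ltr0n R); apply: lt_le_trans KM; rewrite mulr_gt0.
have n0 : (0 < n)%N.
  rewrite -(ltr0n R).
  have : (K1 + 1) * L ^+ 2 <= kap * m%:R.
    apply: (@le_trans _ _ (kap * (th * L ^+ 3))); last by rewrite ler_pM2l.
    have -> : kap * (th * L ^+ 3) = kap * th * L * L ^+ 2 by ring.
    apply: ler_wpM2r; first exact: ltW.
    by rewrite [leRHS]mulrC -ler_pdivrMr; [clear -LL g1 g2; lra | exact: mulr_gt0].
  have := ler_norm (kap * m%:R - n%:R); rewrite distrC => n1 n2.
  by rewrite mulrDl mul1r in n2; move: hd; rewrite -/K1 => hd; clear -hd n1 n2 LL2; lra.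
have [HA _ _] := H m n (pow23 R m) (K1 * L ^+ 2) m0 (pow23_ge0 R m) (pow23_cube R m) hd KM.
have HA' : A u (vert u) m n + A (vert u) u n m <= C * (1 + K1) * L ^+ 2.
  have ss : pow23 R m <= L ^+ 2 by rewrite L2; apply: pow23_le.
  by apply: (le_trans HA); rewrite -[leRHS]mulrA; clear -C1 ss; apply: ler_wpM2l; lra.
have r0 : 0 < r by apply: lt_le_trans r1.
have rL : 0 < r / L by rewrite divr_gt0.
pose g := r ^+ 2 * L * (th * q / 2).
have g0 : 0 <= g.
  by apply: mulr_ge0; [apply: mulr_ge0; [exact: sqr_ge0 | exact: ltW] | exact: divr_ge0 (ltW tq) _].
have gl : g <= `|l - u| * (m%:R * (1 - p) * `|l - u| - K1 * L ^+ 2 / p).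
  rewrite hl.
  have e1 : th * L ^+ 3 * q * (r / L) <= m%:R * (1 - p) * (r / L).
    by apply: ler_wpM2r; [exact: ltW | apply: ler_wpM2r => //; exact: ltW].
  have e2 : K1 * L ^+ 2 / p <= th * q / 2 * r * L ^+ 2.
    have -> : K1 * L ^+ 2 / p = K1 / p * L ^+ 2 by ring.
    apply: ler_wpM2r; first exact: ltW.
    have : 2 * K1 / (p * (th * q)) <= r by rewrite /r; clear -h1 h2; lra.
    rewrite ler_pdivrMr ?mulr_gt0 // ler_pdivrMr //.
    by clear; lra.
  have e3 : th * L ^+ 3 * q * (r / L) = th * q * r * L ^+ 2.
    by field; rewrite gt_eqF.
  have -> : g = r / L * (th * q * r * L ^+ 2 - th * q / 2 * r * L ^+ 2).
    by rewrite /g; field; rewrite gt_eqF.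
  by apply: ler_wpM2l; [exact: ltW | clear -e1 e2 e3; lra].
have [ev eh] := exit_off hd hl01 HA' g0 gl.
have bnd : 4 * (2 * ((2 * m%:R * `|l - u| + K1 * L ^+ 2) / p ^+ 2 +
    2 * (C * (1 + K1) * L ^+ 2)) + 2) <= 8 * (K2 + 1) * r * L ^+ 2.
  rewrite hl; have mL : m%:R * (r / L) <= r * L ^+ 2.
    apply: (@le_trans _ _ (L ^+ 3 * (r / L))).
      by apply: ler_wpM2r; [exact: ltW | rewrite L3 ler_nat].
    by rewrite le_eqVlt; apply/orP; left; apply/eqP; field; rewrite gt_eqF.
  have rr : L ^+ 2 <= r * L ^+ 2 by rewrite -[leLHS]mul1r; apply: ler_wpM2r => //; exact: ltW.
  have f1 : (2 * m%:R * (r / L) + K1 * L ^+ 2) / p ^+ 2 <=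
      (2 + K1) / p ^+ 2 * (r * L ^+ 2).
    rewrite [leRHS]mulrAC; apply: ler_wpM2r; first by rewrite invr_ge0 sqr_ge0.
    rewrite [leRHS]mulrDl; apply: lerD; first by rewrite -mulrA; apply: ler_wpM2l.
    by apply: ler_wpM2l => //; exact: ltW.
  have f2 : C * (1 + K1) * L ^+ 2 <= C * (1 + K1) * (r * L ^+ 2).
    by apply: ler_wpM2l => //; clear -C1 K10; rewrite mulr_ge0 //; lra.
  have f3 : 1 <= r * L ^+ 2 by apply: le_trans rr; rewrite exprn_ege1.
  have -> : 8 * (K2 + 1) * r * L ^+ 2 = 8 * ((2 + K1) / p ^+ 2 * (r * L ^+ 2)) +
     8 * (2 * (C * (1 + K1) * (r * L ^+ 2))) + 8 * (r * L ^+ 2) by rewrite /K2; ring.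
  clear -f1 f2 f3; lra.
have gg : 0 < g ^+ 2.
  apply: exprn_gt0; apply: mulr_gt0; last exact: divr_gt0.
  by apply: mulr_gt0 => //; exact: exprn_gt0.
have fin (P0 : R) : P0 * g ^+ 2 <= 8 * (K2 + 1) * r * L ^+ 2 -> P0 <= e.
  rewrite -ler_pdivlMr // => /le_trans; apply.
  have -> : 8 * (K2 + 1) * r * L ^+ 2 / g ^+ 2 = K3 / r ^+ 3.
    rewrite /g /K3; field; rewrite !gt_eqF //; lra.
  rewrite ler_pdivrMr; last exact: exprn_gt0.
  rewrite [leRHS]mulrC -ler_pdivrMr //; apply: (@le_trans _ _ r).
    by rewrite /r lerDr; clear -h1; lra.
  by rewrite exprS -[leLHS]mulr1; apply: ler_wpM2l; [exact: ltW | rewrite exprn_ege1].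
split=> lu; apply: fin.
- exact: le_trans (ev lu n0) bnd.
- exact: le_trans (eh lu m0) bnd.
Qed.

End NearExitAsymptotics.

(** * Walks over N^(2/3) steps with barriers of height N^(1/3) *)

Section Scales.
Variable R : realType.
Implicit Types (e r th L : R).

Lemma stay_scale (u r e : R) : 0 < u < 1 -> 1 <= r -> 0 < e ->
  exists2 th : R, 0 < th & exists Lam : R, forall L l k, Lam <= L ->
    l = u + r / L -> L ^+ 2 <= k%:R + 1 ->
    stay u l (axis k) (Num.truncn (th * L)).+1 <= e.
Proof.
move=> hu r1 e0; have /andP[u0 u1] := hu.
pose g0 := u * (1 - u) / 2.
have g00 : 0 < g0 by rewrite /g0 divr_gt0 // mulr_gt0 // subr_gt0.
have r0 : 0 < r by lra.
(* [be L] is the B of [stay_le]; this choice turns 4 B |l - u| <= g0 into an equality. *)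
pose be := g0 / (4 * r); have be0 : 0 < be by rewrite divr_gt0 // mulr_gt0.
pose K := 8 / be + 8 * be / g0.
have K0 : 0 < K by rewrite addr_gt0 // divr_gt0 // mulr_gt0.
(* Ensures th <= be and th K <= e, where th K is the bound that [stay_le] finally gives. *)
pose th := be * e / (be * K + e).
have den : 0 < be * K + e by rewrite addr_gt0 // mulr_gt0.
have th0 : 0 < th by rewrite divr_gt0 // mulr_gt0.
have bK : 0 <= be * K by rewrite mulr_ge0 // ltW.
have thb : th <= be.
  by rewrite ler_pdivrMr // ler_pM2l //; lra.
have thK : th * K <= e.
  rewrite /th mulrAC ler_pdivrMr // mulrAC mulrC ler_pM2l //; lra.
have t1 : 0 < th^-1 by rewrite invr_gt0.
have t2 : 0 < be^-1 by rewrite invr_gt0.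
have t3 : 0 < r / g0 by rewrite divr_gt0.
exists th => //; exists (1 + th^-1 + 2 * be^-1 + r / g0) => L l k LL lE Lk.
have L0 : 0 < L by lra.
have tL : r / L <= g0.
  by rewrite ler_pdivrMr // mulrC -ler_pdivrMr //; lra.
have rL : 0 < r / L by rewrite divr_gt0.
have gu : g0 <= (1 - u) / 2 by rewrite /g0 ler_pM2r //; nra.
have thL : 1 <= th * L by rewrite -ler_pdivrMl // mulr1; lra.
have beL : 2 <= be * L by rewrite mulrC -ler_pdivrMr //; lra.
move: K0 thK; set h := (Num.truncn _).+1 => K0 thK.
have h1 : h%:R <= th * L + 1 by rewrite /h -natr1 lerD2r truncn_le //; lra.
have h2 : 0 <= (h%:R : R) by [].
have thbL : th * L <= be * L by apply: ler_wpM2r => //; exact: ltW.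
have l01 : 0 <= l <= 1.
  by rewrite lE; clear -u0 u1 rL tL gu; apply/andP; split; lra.
have sg : g0 <= u * (1 - l) + (1 - u) * l.
  have : u * ((1 - u) / 2) <= u * (1 - l).
    by rewrite lE; clear -u0 rL tL gu; apply: ler_wpM2l; lra.
  have : 0 <= (1 - u) * l by clear -l01 u1; apply: mulr_ge0; lra.
  by rewrite /g0; lra.
have sg0 : 0 < u * (1 - l) + (1 - u) * l by lra.
have lu : `|l - u| = r / L.
  by rewrite lE addrAC subrr add0r gtr0_norm.
have dr : 4 * (be * L) * `|l - u| <= u * (1 - l) + (1 - u) * l.
  apply: le_trans sg; rewrite lu le_eqVlt; apply/orP; left; apply/eqP.
  by rewrite /be; field; rewrite !gt_eqF.
have hB : h%:R <= be * L + 1 by clear -h1 thbL; lra.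
have u01 : 0 <= u <= 1 by rewrite !ltW.
have := @stay_le _ _ u l (axis k) (be * L) h u01 l01 (axis_uniq k) beL sg0 dr hB.
rewrite size_axis => /le_trans; apply; apply: le_trans thK.
have B2 : 0 < (be * L) ^+ 2 - 1 by rewrite subr_gt0 exprn_egt1 //; clear -beL; lra.
have f1 : ((be * L) ^+ 2 - 1)^-1 <= 2 / (be * L) ^+ 2.
  have b2 : 0 < (be * L) ^+ 2 by clear -B2; lra.
  rewrite ler_pdivlMr // mulrC ler_pdivrMr //.
  have : 2 * 2 <= (be * L) ^+ 2 by rewrite expr2; apply: ler_pM.
  clear; lra.
have f2 : 2 / (u * (1 - l) + (1 - u) * l) / (k%:R + 1) <= 2 / (g0 * L ^+ 2).
  rewrite -mulrA -invfM; apply: ler_wpM2l => //.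
  have d1 : 0 < g0 * L ^+ 2 by apply: mulr_gt0 => //; exact: exprn_gt0.
  have d2 : g0 * L ^+ 2 <= (u * (1 - l) + (1 - u) * l) * (k%:R + 1).
    by apply: ler_pM => //; [exact: ltW | exact: sqr_ge0].
  by rewrite lef_pV2 ?posrE //; exact: lt_le_trans d2.
have f3 : h%:R * (2 * (be * L) - h%:R) <= 4 * th * be * L ^+ 2.
  apply: (@le_trans _ _ (h%:R * (2 * (be * L)))).
    by apply: ler_wpM2l => //; clear -h2; lra.
  apply: (@le_trans _ _ (2 * (th * L) * (2 * (be * L)))).
    by clear -h1 thL beL; apply: ler_wpM2r; lra.
  by rewrite le_eqVlt; apply/orP; left; apply/eqP; ring.
have -> : th * K = 4 * th * be * L ^+ 2 * (2 / (be * L) ^+ 2 + 2 / (g0 * L ^+ 2)).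
  by rewrite /K; field; rewrite !gt_eqF.
apply: ler_pM => //.
- by apply: mulr_ge0 => //; clear -hB beL; lra.
- apply: addr_ge0; first by rewrite invr_ge0 ltW.
  by apply: divr_ge0; [apply: divr_ge0 => //; exact: ltW | rewrite natr1].
- exact: lerD.
Qed.

Lemma hit_scale (r e th : R) : 0 <= r -> 0 < e -> 0 < th ->
  exists2 de : R, 0 < de & exists Lam : R, forall L a b k, Lam <= L ->
    0 <= a <= 1 -> 0 <= b <= 1 -> `|b - a| <= r / L -> k%:R <= de * L ^+ 2 ->
    1 - stay a b (axis k) (Num.truncn (th * L)).+1 <= e.
Proof.
move=> r0 e0 th0; pose C := 1 + 4 * th * r.
have C0 : 0 < C.
  have : 0 <= 4 * th * r by rewrite mulr_ge0 // mulr_ge0 // ltW.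
  by rewrite /C; lra.
have t1 : 0 < th^-1 by rewrite invr_gt0.
exists (e * th ^+ 2 / C); first by rewrite divr_gt0 // mulr_gt0 // exprn_gt0.
exists (1 + th^-1) => L a b k LL a01 b01 ab kL.
have L0 : 0 < L by lra.
have thL : 1 <= th * L by rewrite -ler_pdivrMl // mulr1; lra.
set h := (Num.truncn _).+1.
have h1 : h%:R <= th * L + 1 by rewrite /h -natr1 lerD2r truncn_le //; lra.
have h2 : th * L <= h%:R by rewrite /h ltW // truncnS_gt.
have h0 : 0 < (h%:R : R) by [].
have CC : a * (1 - b) + (1 - a) * b + 2 * h%:R * `|b - a| <= C.
  have s1 : a * (1 - b) + (1 - a) * b <= 1.
    by case/andP: a01 => a0 a1; case/andP: b01 => b0 b1; nra.
  have : 2 * h%:R * `|b - a| <= 4 * th * r.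
    apply: (@le_trans _ _ (4 * (th * L) * (r / L))).
      by apply: ler_pM => //; lra.
    by rewrite le_eqVlt; apply/orP; left; apply/eqP; field; rewrite gt_eqF.
  by rewrite /C; lra.
(* With H = h the initial potential vanishes and only the time term k C / h^2 remains. *)
have := @hit_le _ _ a b (axis k) (h%:R) C h a01 b01 (axis_uniq k) h0 CC.
rewrite subrr expr0n /= add0r size_axis => /le_trans; apply.
rewrite ler_pdivrMr ?exprn_gt0 //.
have := ler_wpM2r (ltW C0) kL.
have -> : e * th ^+ 2 / C * L ^+ 2 * C = e * (th * L) ^+ 2 by field; rewrite gt_eqF.
move=> /le_trans; apply; apply: ler_wpM2l; first exact: ltW.
by rewrite lerXn2r ?nnegrE //; lra.
Qed.

End Scales.

Section NearExitSmall.
Variables (R : realType) (p u : R).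
Hypotheses (hp : 0 < p < 1) (hu : 0 < u < 1).

Local Notation kap := (slope p u).
Local Notation vert := (vert_param p).
Local Notation E0 := (expect p u (vert u)).

Lemma near_exit_small (th D0 e : R) : 0 < th -> 0 <= D0 -> 0 < e ->
  exists2 de : R, 0 < de & exists Lam : R, forall L N M n k, Lam <= L ->
    L ^+ 3 = N%:R -> L ^+ 2 = pow23 R N -> (M <= N)%N -> th * N%:R <= M%:R ->
    `|n%:R - kap * M%:R| <= D0 -> k%:R <= de * L ^+ 2 ->
    E0 M n (fun x => (near_exit M n k x)%:R) <= e.
Proof.
move=> th0 D00 e0; have hv := vert01 hp hu.
have /andP[p0 p1] := hp; have /andP[u0 u1] := hu; have k0 := slope_gt0 hp hu.
have e5 : 0 < e / 5 by rewrite divr_gt0.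
have th2 : 0 < th / 2 by rewrite divr_gt0.
(* The order of choices matters: r makes the sandwich of increments likely, then t puts the barrier
   t L within reach of L^2 steps, and finally de keeps it out of reach of de L^2 steps. *)
have [r r1 [La HA]] := exit_off_scale hp hu th2 e5.
have [t t0 [Lb HB]] := stay_scale hu r1 e5.
have rp : 0 <= r / p by rewrite divr_ge0 //; lra.
have [de de0 [Lc HC]] := hit_scale rp e5 t0.
have r0 : 0 < r by lra.
have [Ld Ldp Ld0] : exists2 Ld, 0 <= Ld & forall L, Ld <= L ->
    [/\ 1 <= L, D0 <= L, 2 / th <= L, (1 + de) / (th / 2) / kap <= L /\ de / (th / 2) <= L
      & 2 * r / (u * (1 - u)) <= L].
  pose q1 := 2 / th; pose q2 := (1 + de) / (th / 2) / kap.
  pose q3 := de / (th / 2); pose q4 := 2 * r / (u * (1 - u)).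
  have d1 : 0 < q1 by rewrite divr_gt0.
  have d2 : 0 < q2 by apply: divr_gt0 => //; apply: divr_gt0 => //; lra.
  have d3 : 0 < q3 by rewrite divr_gt0.
  have d4 : 0 < q4 by rewrite divr_gt0 // mulr_gt0 // subr_gt0.
  exists (1 + D0 + q1 + q2 + q3 + q4); first lra.
  move=> L LL; rewrite -/q1 -/q2 -/q3 -/q4; clear -LL D00 d1 d2 d3 d4.
  by split; [lra|lra|lra|split; lra|lra].
exists de => //; exists (Num.max La (Num.max Lb (Num.max Lc Ld))).
move=> L N M n k; rewrite !ge_max => /and4P[LLa LLb LLc LLd] L3 L2 MN thM hd kL.
have [L1 LD Lth [Ln LM] Lr] := Ld0 L LLd.
have L0 : 0 < L by apply: lt_le_trans L1.
have L22 : 0 < L ^+ 2 by rewrite exprn_gt0.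
have rL0 : 0 < r / L by rewrite divr_gt0.
have rL : r / L <= u * (1 - u) / 2.
  have uu0 : 0 < u * (1 - u) by rewrite mulr_gt0 ?subr_gt0.
  move: Lr; rewrite ler_pdivrMr // => Lr; rewrite ler_pdivrMr //; clear -Lr; lra.
have uu1 : u * (1 - u) / 2 <= u / 2 by rewrite ler_pM2r // -[leRHS]mulr1 ler_pM2l // lerBlDl lerDr ltW.
have uu2 : u * (1 - u) / 2 <= (1 - u) / 2.
  by rewrite ler_pM2r // -[leRHS]mul1r ler_pM2r ?subr_gt0 //; exact: ltW.
pose lp := u + r / L; pose lm := u - r / L.
have lp01 : 0 < lp < 1 by rewrite /lp; clear -rL rL0 uu2 u0 u1; apply/andP; split; lra.
have lm01 : 0 < lm < 1 by rewrite /lm; clear -rL rL0 uu1 u0 u1; apply/andP; split; lra.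
have alp : `|lp - u| = r / L by rewrite /lp addrAC subrr add0r gtr0_norm.
have alm : `|lm - u| = r / L by rewrite /lm addrAC subrr add0r normrN gtr0_norm.
pose z0 := Num.truncn (L ^+ 2).
have z1 : z0%:R <= L ^+ 2 by rewrite /z0 truncn_le // ltW.
have z2 : L ^+ 2 <= z0%:R + 1 by rewrite natr1 ltW // truncnS_gt.
have thL : L ^+ 2 <= th / 2 * N%:R.
  rewrite -L3 [L ^+ 3]exprS mulrA -[leLHS]mul1r; apply: ler_wpM2r; first exact: ltW.
  by move: Lth; rewrite ler_pdivrMr // => Lth; clear -Lth; lra.
have z0M : (z0 <= M)%N by rewrite -(ler_nat R); clear -z1 thL thM L22; lra.
have kM : (k <= M)%N.
  rewrite -(ler_nat R); apply: (le_trans kL); apply: le_trans thM.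
  rewrite -L3 [L ^+ 3]exprS [leRHS]mulrA; apply: ler_wpM2r; first exact: ltW.
  by move: LM; rewrite ler_pdivrMr // => LM; have := mulr_gt0 L0 th0; clear -LM; lra.
have kn : (k <= n)%N.
  rewrite -(ler_nat R); apply: (le_trans kL).
  have a1 : (1 + de) * L ^+ 2 <= kap * M%:R.
    apply: (@le_trans _ _ (kap * (th * N%:R))); last by rewrite ler_pM2l.
    have -> : kap * (th * N%:R) = kap * th * L * L ^+ 2 by rewrite -L3; ring.
    apply: ler_wpM2r; first exact: ltW.
    move: Ln; rewrite ler_pdivrMr // ler_pdivrMr // => Ln.
    have : 0 <= L * kap * th by apply: mulr_ge0; [apply: mulr_ge0 |]; exact: ltW.
    clear -Ln; lra.
  have LL : L <= L ^+ 2 by rewrite expr2 -[leLHS]mul1r; apply: ler_wpM2r => //; exact: ltW.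
  have := ler_norm (kap * M%:R - n%:R); rewrite distrC => a2; clear -a1 a2 hd LD LL; lra.
have LL : L <= L ^+ 2 by rewrite expr2 -[leLHS]mul1r; apply: ler_wpM2r => //; exact: ltW.
have kL2 : 0 <= kap * L ^+ 2 by apply: mulr_ge0; exact: ltW.
have hdM : `|n%:R - kap * M%:R| <= (1 + kap) * L ^+ 2 by clear -hd LD LL kL2; lra.
have hdz : `|n%:R - kap * (M - z0)%:R| <= (1 + kap) * L ^+ 2.
  rewrite natrB // mulrBr opprB addrCA addrC.
  apply: (le_trans (ler_normD _ _)); rewrite normrM (gtr0_norm k0) normr_nat.
  have : kap * z0%:R <= kap * L ^+ 2 by rewrite ler_pM2l.
  clear -hd LD LL; lra.
have Mz : th / 2 * N%:R <= (M - z0)%:R by rewrite natrB //; clear -thM thL z1; lra.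
have M2 : th / 2 * N%:R <= M%:R by clear -thM thL L22; lra.
have ulp : u <= lp by rewrite /lp lerDl ltW.
have lmu : lm <= u by rewrite /lm gerBl ltW.
have MzN : (M - z0 <= N)%N by apply: leq_trans MN; apply: leq_subr.
have [T1 _] := HA L N (M - z0)%N n lp LLa L3 L2 MzN Mz hdz alp lp01.
have [_ T2] := HA L N M n lm LLa L3 L2 MN M2 hdM alm lm01.
have T3 := HB L lp z0 LLb (erefl _) z2.
have h01 (y0 : R) : 0 < y0 < 1 -> 0 <= y0 <= 1 by move=> /andP[y1 y2]; rewrite !ltW.
have rLp : r / L <= r / p / L.
  have -> : r / p / L = r / L / p by ring.
  by rewrite ler_pdivlMr // -[leRHS]mulr1 ler_pM2l //; exact: ltW.
have T4 : 1 - stay u lm (axis k) (Num.truncn (t * L)).+1 <= e / 5.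
  by apply: HC => //; [exact: h01 | exact: h01 | rewrite alm].
have T5 : 1 - stay (vert u) (vert lp) (axis k) (Num.truncn (t * L)).+1 <= e / 5.
  apply: HC => //; [exact: h01 | by apply: h01; apply: vert01 |].
  apply: (le_trans (vert_lip hp hu lp01)).
  by rewrite alp le_eqVlt; apply/orP; left; apply/eqP; ring.
have := @near_exit_bound _ p hp u (vert u) lp (vert lp) lm (vert lm) M n k z0
  (Num.truncn (t * L)).+1 (h01 _ hu) (h01 _ hv) (h01 _ lp01)
  (h01 _ (vert01 hp lp01)) (h01 _ lm01) (h01 _ (vert01 hp lm01))
  (stationary_vert hp lp01) (stationary_vert hp lm01) z0M kM kn.
have := T1 ulp; have := T2 lmu; move: T3 T4 T5.
set x1 := through_prob _ _ _ _ _ _; set x2 := through_prob _ _ _ _ _ _.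
set x3 := stay _ _ _ _; set x4 := stay _ _ _ _; set x5 := stay _ _ _ _.
set x6 := expect _ _ _ _ _ _; clear; lra.
Qed.

End NearExitSmall.

(** * From passage near a point to an exit near the origin *)

Section ClosePassage.

Local Open Scope classical_set_scope.
Local Open Scope ring_scope.

(** The point lies strictly inside the quadrant at (i0, j0), so [oreach_bulk] splits the path there
    and [exit_point] traces it back to the axes. *)
Lemma near_exit_passage c i0 j0 M n k i j : (0 < i <= k)%N -> (0 < j <= k)%N ->
  oreach c (i0 + i, j0 + j)%N (i0 + M, j0 + n)%N ->
  near_exit M n k (rev M n (shift i0 j0 c)).
Proof.
move=> /andP[i1 ik] /andP[j1 jk] /oreach_shift; rewrite /= !addKn.
set y := shift i0 j0 c => r; have [/= iM jn] := oreach_le r.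
have [z near] := exit_point iM jn (@oreach_bulk y (i, j) M n i1 j1 r).
have [axh axv] := rev_axes M n y.
apply/hasP; exists z; first by rewrite mem_iota; lia.
rewrite revK axh axv; apply/orP.
by case: near => -[zk near]; [left|right].
Qed.

Section Passage.
Variables (R : realType) (p u : R).
Hypotheses (hp : 0 < p < 1) (hu : 0 < u < 1).
Local Notation kap := (slope p u).
Local Notation E0 := (expect p u (vert_param p u)).
Local Notation n_ := (n_u p u).

Definition passes (tau delta : R) N c : bool :=
  has (fun z : site => `|z.1%:R - tau * N%:R| + `|z.2%:R - tau * (n_ N)%:R| <=
    delta * pow23 R N) (path_of p u c N).

Lemma passes_supported tau delta N : supported (rect N (n_ N)) (passes tau delta N).
Proof. by move=> x y xy; rewrite /passes (@path_supported _ p u N x y xy). Qed.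

Lemma passes_le_near_exit (tau delta : R) N i0 j0 k : (i0 <= N)%N -> (j0 <= n_ N)%N ->
  (k <= N - i0)%N -> (k <= n_ N - j0)%N ->
  (forall z : site, `|z.1%:R - tau * N%:R| + `|z.2%:R - tau * (n_ N)%:R| <=
      delta * pow23 R N -> (i0 < z.1 <= i0 + k)%N && (j0 < z.2 <= j0 + k)%N) ->
  E0 N (n_ N) (fun c => (passes tau delta N c)%:R) <=
  E0 (N - i0) (n_ N - j0) (fun c => (near_exit (N - i0) (n_ N - j0) k c)%:R).
Proof.
move=> iN jn kM kn hz; set M := (N - i0)%N; set n := (n_ N - j0)%N.
have ns : supported (rect M n) (fun y => (near_exit M n k y)%:R : R).
  by move=> y y' yy; rewrite (near_exit_supported kM kn yy).
have rs : supported (rect M n) (fun y => (near_exit M n k (rev M n y))%:R : R).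
  move=> y y' yy; apply: ns => -[i j]; rewrite mem_rect /rev /= => ij.
  by case: ifP => h; apply: yy; rewrite mem_rect /=; lia.
rewrite -(expect_rev p u (vert_param p u) ns).
have := expect_shift i0 j0 (stationary_vert hp hu) rs.
rewrite /M /n !subnKC // => <-; apply: expect_le => // c.
rewrite ler_nat; case hc : (passes _ _ _ _) => //; move/hasP: hc => [[i j] ijp /hz /=].
move=> /andP[/andP[i1 i2] /andP[j1 j2]].
rewrite (@near_exit_passage _ _ _ _ _ _ (i - i0) (j - j0)) //; [lia|lia|].
by move: (path_ofP ijp); rewrite !subnKC // ltnW.
Qed.

Lemma passage_small tau e : 0 < tau < 1 -> 0 < e ->
  exists2 delta : R, 0 < delta & exists Lam : R, forall L N, Lam <= L ->
    L ^+ 3 = N%:R -> L ^+ 2 = pow23 R N ->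
    E0 N (n_ N) (fun c => (passes tau delta N c)%:R) <= e.
Proof.
move=> /andP[t0 t1] e0; have k0 := slope_gt0 hp hu.
have th0 : 0 < 1 - tau by lra.
have [de de0 [Lam H]] := near_exit_small hp hu th0 ler01 e0.
have ki0 : 0 < kap^-1 by rewrite invr_gt0.
(* K (delta s + 2) is the side of a square at the corner that contains the ball of radius delta s.
   With delta = de / (2 K) it is at most de s as soon as 4 K <= de s. *)
pose K := 2 + kap^-1 + 2 * kap; have K0 : 0 < K by rewrite /K; lra.
pose delta := de / (2 * K).
have d0 : 0 < delta by rewrite divr_gt0 // mulr_gt0.
have Kd : K * delta = de / 2 by rewrite /delta; field; rewrite gt_eqF.
exists delta => //.
have [Ld Ld0 HLd] : exists2 Ld : R, 0 <= Ld & forall L, Ld <= L -> [/\ 1 <= L,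
    (1 + kap^-1) * (delta + 2) <= tau * L, 4 * K <= de * L, de <= (1 - tau) * L
    & de + 1 <= kap * ((1 - tau) * L)].
  pose q1 := (1 + kap^-1) * (delta + 2) / tau; pose q2 := 4 * K / de.
  pose q3 := de / (1 - tau); pose q4 := (de + 1) / kap / (1 - tau).
  have d1 : 0 < q1 by rewrite divr_gt0 // mulr_gt0 //; lra.
  have d2 : 0 < q2 by rewrite divr_gt0 // mulr_gt0.
  have d3 : 0 < q3 by rewrite divr_gt0.
  have d4 : 0 < q4 by apply: divr_gt0 => //; apply: divr_gt0 => //; lra.
  exists (1 + q1 + q2 + q3 + q4); first lra.
  move=> L LL; split; first lra.
  - by rewrite -ler_pdivrMl // mulrC -/q1; lra.
  - by rewrite -ler_pdivrMl // mulrC -/q2; lra.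
  - by rewrite -ler_pdivrMl // mulrC -/q3; lra.
  - by rewrite -ler_pdivrMl // -ler_pdivrMl // mulrC [kap^-1 * _]mulrC -/q4; lra.
exists (Num.max Lam Ld) => L N; rewrite ge_max => /andP[LL /HLd[L1 h1 h2 h3 h4]] L3 L2.
have s0 : 1 <= L ^+ 2 by rewrite exprn_ege1.
have Ns : N%:R = L * L ^+ 2 by rewrite -L3 exprS.
have LLs : L <= L ^+ 2 by rewrite expr2 -[leLHS]mulr1 ler_pM2l //; lra.
move: (H L N) Ns s0 LLs (esym L2); rewrite -{1}L2; set s := L ^+ 2.
move: s => s Hs Ns s0 LLs sE.
have ds0 : 0 < delta * s by rewrite mulr_gt0 //; lra.
have ds2 : 0 <= delta * s + 2 by rewrite addr_ge0 // ltW.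
have Kds : K * (delta * s) = de * s / 2 by rewrite mulrA Kd; ring.
have scale (x y : R) : x <= y * L -> x * s <= y * N%:R.
  by move=> xy; rewrite Ns mulrA ler_wpM2r //; lra.
have g1 := scale _ _ h1; have g3 := scale _ _ h3.
have g4 : (de + 1) * s <= kap * (1 - tau) * N%:R by apply: scale; rewrite -mulrA.
have g2 : 4 * K <= de * s by apply: (le_trans h2); rewrite ler_pM2l.
(* The corner lies on the characteristic, southwest of the ball; the factor 1 + kap^-1 makes both
   offsets rho and kap rho at least delta s + 2. *)
pose rho := (1 + kap^-1) * (delta * s + 2).
have rho0 : delta * s + 2 <= rho.
  by rewrite /rho -[leLHS]mul1r ler_wpM2r // lerDl ltW.
have krho : kap * rho = (kap + 1) * (delta * s + 2).
  by rewrite /rho; field; rewrite gt_eqF.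
have rhoN : rho <= tau * N%:R.
  apply: le_trans g1; rewrite /rho -[leRHS]mulrA; apply: ler_wpM2l; first by rewrite addr_ge0 // ltW.
  by rewrite mulrDl lerD2l ler_peMr.
have rhoE : rho = delta * s + 2 + kap^-1 * (delta * s) + 2 * kap^-1 by rewrite /rho; ring.
have kds : 0 < kap * (delta * s) by rewrite mulr_gt0.
have kids : 0 < kap^-1 * (delta * s) by rewrite mulr_gt0.
have KE : K * (delta * s + 2) = 2 * (delta * s) + kap^-1 * (delta * s)
   + 2 * (kap * (delta * s)) + 4 + 2 * kap^-1 + 4 * kap by rewrite /K; ring.
have krhoE : kap * rho = kap * (delta * s) + delta * s + 2 * kap + 2 by rewrite krho; ring.
pose i0 := Num.truncn (tau * N%:R - rho); pose j0 := Num.truncn (kap * i0%:R).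
pose k := Num.truncn (K * (delta * s + 2)).
have i1 : i0%:R <= tau * N%:R - rho by rewrite truncn_le // subr_ge0.
have i2 : tau * N%:R - rho < i0%:R + 1 by rewrite natr1 truncnS_gt.
have kin : 0 <= kap * i0%:R by rewrite mulr_ge0 // ltW.
have j1 : j0%:R <= kap * i0%:R by rewrite truncn_le.
have j2 : kap * i0%:R < j0%:R + 1 by rewrite natr1 truncnS_gt.
have K20 : 0 <= K * (delta * s + 2) by rewrite mulr_ge0 // ltW.
have k1 : k%:R <= K * (delta * s + 2) by rewrite truncn_le.
have k2 : K * (delta * s + 2) < k%:R + 1 by rewrite natr1 truncnS_gt.
have /andP[n1 n2] := n_u_bounds hp hu N.
have N0 := ler0n R N; have tN : tau * N%:R <= N%:R by rewrite -[leRHS]mul1r ler_wpM2r // ltW.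
have m1 : kap * i0%:R <= kap * (tau * N%:R) - kap * rho by rewrite -mulrBr ler_pM2l.
have m2 : kap * (tau * N%:R) - kap * rho < kap * i0%:R + kap.
  have : kap * (tau * N%:R - rho) < kap * (i0%:R + 1) by rewrite ltr_pM2l.
  by rewrite mulrBr mulrDr mulr1.
have m3 : kap * (tau * N%:R) <= kap * N%:R by rewrite ler_pM2l.
have nt1 : tau * (n_ N)%:R <= kap * (tau * N%:R) by rewrite mulrCA ler_pM2l.
have nt2 : kap * (tau * N%:R) <= tau * (n_ N)%:R + 1.
  have : kap * (tau * N%:R) <= tau * ((n_ N)%:R + 1).
    by rewrite mulrCA ler_pM2l // ltW.
  by rewrite mulrDr mulr1; clear -t1; lra.
have iN : (i0 <= N)%N by rewrite -(ler_nat R); clear -i1 rho0 ds2 tN; lra.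
have jn : (j0 <= n_ N)%N.
  rewrite -ltnS -(ltr_nat R) -natr1; clear -j1 m1 krhoE kds ds0 k0 m3 n2; lra.
have Me : (N - i0)%:R = N%:R - i0%:R :> R by rewrite natrB.
have ne : (n_ N - j0)%:R = (n_ N)%:R - j0%:R :> R by rewrite natrB.
have thM : (1 - tau) * N%:R <= (N - i0)%:R.
  by rewrite Me mulrBl mul1r; clear -i1 rho0 ds2; lra.
have hd : `|(n_ N - j0)%:R - kap * (N - i0)%:R| <= 1.
  by rewrite Me ne ler_norml mulrBr; clear -n1 n2 j1 j2; apply/andP; split; lra.
have kde : k%:R <= de * s.
  by apply: (le_trans k1); rewrite mulrDr Kds; clear -g2; lra.
have kM : (k <= N - i0)%N by rewrite -(ler_nat R); clear -kde g3 thM; lra.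
have kn : (k <= n_ N - j0)%N.
  rewrite -(ler_nat R) ne.
  have : kap * (1 - tau) * N%:R = kap * N%:R - kap * (tau * N%:R) by ring.
  move: g4; rewrite mulrDl mul1r; clear -n2 j1 m1 kde krhoE kds ds0 k0 s0; lra.
apply: le_trans (Hs (N - i0)%N (n_ N - j0)%N k LL L3 erefl (leq_subr _ _) thM hd kde).
apply: passes_le_near_exit => // -[i j] /=; rewrite sE => hz.
have := ler_norm (i%:R - tau * N%:R); have := lerNnormlW (lexx `|i%:R - tau * N%:R|).
have := ler_norm (j%:R - tau * (n_ N)%:R).
have := lerNnormlW (lexx `|j%:R - tau * (n_ N)%:R|).
have := normr_ge0 (i%:R - tau * N%:R); have := normr_ge0 (j%:R - tau * (n_ N)%:R).
move: hz; set x := `|_|; set y := `|_| => hz y0 x0 y1 y2 x1 x2.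
rewrite -(ltr_nat R i0) -(ltr_nat R j0).
have -> : (i <= i0 + k)%N.
  rewrite -ltnS -(ltr_nat R) -natr1 natrD.
  clear -i2 k2 KE rhoE hz y0 x2 kds ds0 ki0 k0; lra.
have -> : (j <= j0 + k)%N.
  rewrite -ltnS -(ltr_nat R) -natr1 natrD.
  clear -j2 m2 k2 KE krhoE kids hz x0 y2 kds ds0 ki0 k0 nt1; lra.
rewrite !andbT; apply/andP; split.
  clear -i1 rho0 hz y0 x1; lra.
clear -j1 m1 krhoE hz x0 y1 nt2 k0 kds; lra.
Qed.

End Passage.

Section PassageProbability.
Context (R : realType) (d : measure_display) (T : measurableType d).
Variables (P : probability T R) (p u : R) (omega : nat -> nat -> {RV P >-> bool}).
Hypotheses (hp : 0 < p < 1) (hu : 0 < u < 1).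
Hypothesis homega : boundary_environment p u omega.

Lemma limn_esup_le (f : nat -> \bar R) (l : \bar R) N0 :
  (forall N, (N0 <= N)%N -> (f N <= l)%E) -> (limn_esup f <= l)%E.
Proof.
move=> fl; rewrite limn_esup_lim; rewrite (cvg_lim _ (@cvg_esups_inf _ f)) //.
apply: ge_ereal_inf; exists (esups f N0); first by exists N0.
by apply: ge_ereal_sup => _ [N /= NN <-]; apply: fl.
Qed.

Lemma passage_probability tau eps : 0 < tau < 1 -> 0 < eps ->
  exists2 delta : R, 0 < delta &
    (limn_esup (fun N : nat => P (close_passage p u omega tau delta N)) <= eps%:E)%E.
Proof.
move=> ht e0; have [delta d0 [Lam H]] := passage_small hp hu ht e0.
(* From this index on the cube root of N exceeds Lam. *)
exists delta => //; apply: (@limn_esup_le _ _ (Num.truncn (Num.max 0 Lam ^+ 3)).+1) => N NL.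
have -> : close_passage p u omega tau delta N =
    [set t | passes p u tau delta N (fun v => omega v.1 v.2 t)].
  apply/seteqP; split=> t /=; first by case=> z zp hz; apply/hasP; exists z.
  by move=> /hasP[z zp hz]; exists z.
rewrite (@boundary_environment_prob _ _ _ _ _ _ _ hp hu homega N (n_u p u N)); last first.
  exact: passes_supported.
have r0 : 0 <= (N%:R : R) `^ 3^-1 by exact: powR_ge0.
have r3 : (N%:R `^ 3^-1) ^+ 3 = N%:R :> R.
  by rewrite -powR_mulrn // -powRrM mulVf // powRr1.
rewrite lee_fin; apply: (H (N%:R `^ 3^-1)) => //; last first.
  by rewrite -powR_mulrn // -powRrM mulrC.
apply: (@le_trans _ _ (Num.max 0 Lam)); first by rewrite le_max lexx orbT.
rewrite -(@ler_pXn2r _ 3) ?nnegrE ?le_max ?lexx // r3 ltW //.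
by apply: lt_le_trans (truncnS_gt _) _; rewrite ler_nat.
Qed.

End PassageProbability.

End ClosePassage.

Local Open Scope classical_set_scope.
Local Open Scope ring_scope.

Theorem theorem2p9 (R : realType) (d : measure_display) (T : measurableType d)
    (P : probability T R) (p u : R) (hp : 0 < p < 1) (hu : 0 < u < 1)
    (omega : nat -> nat -> {RV P >-> bool})
    (homega : boundary_environment p u omega) :
  (forall tau : R, 0 <= tau < 1 ->
    exists C1 C2 : R, forall (N : nat) (b : R), (1 <= N)%N -> C1 <= b ->
      (P (horizontal_deviation p u omega tau b N) <= (C2 * b ^- 3)%:E)%E /\
      (P (vertical_deviation p u omega tau b N) <= (C2 * b ^- 3)%:E)%E) /\
  (forall tau : R, 0 < tau < 1 ->
    forall eps : R, 0 < eps ->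
      exists2 delta : R, 0 < delta &
        (limn_esup (fun N : nat => P (close_passage p u omega tau delta N))
           <= eps%:E)%E).
Proof.
split=> tau ht; first exact: (deviation_probability hp hu homega ht).
by move=> eps; exact: (passage_probability hp hu homega ht).
Qed.
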